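(* An open set $U\subset\mathbb{R}^N$ with $\mathcal H^{N-1}(\partial U)<\infty$ is an extension domain for any $\mathbf F\in\mathcal{DM}^\infty(U)$. More generally, if $\Omega\subset\mathbb{R}^N$ is open and $\mathbf F\in\mathcal{DM}^\infty_{loc}(\Omega)$, then any open set of finite perimeter $U\Subset\Omega$ is an extension domain for $\mathbf F$.
   Context: $\mathcal{DM}^\infty(U)$ is the set of $\mathbf F\in L^\infty(U;\mathbb{R}^N)$ whose distributional divergence is a signed Radon measure of finite total variation on $U$; $\mathcal{DM}^\infty_{loc}(\Omega)$ the set of $\mathbf F\in L^\infty_{loc}(\Omega;\mathbb{R}^N)$ whose divergence is a signed Radon measure on $\Omega$ (finite on compactly contained sets). An open set $U$ is an extension domain for $\mathbf F\in\mathcal{DM}^\infty(U)$ if there exists $\mathbf F^*\in\mathcal{DM}^\infty(\mathbb{R}^N)$ with $\mathbf F^*=\mathbf F$ on $U$. *)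

(* Defs.v *)
From HB Require Import structures.
From mathcomp Require Import all_boot all_order all_algebra.
From mathcomp Require Import all_classical all_reals all_analysis.
Set Implicit Arguments. Unset Strict Implicit. Unset Printing Implicit Defensive.
Import Order.TTheory GRing.Theory Num.Theory.
Import numFieldNormedType.Exports.
Local Open Scope classical_set_scope.
Local Open Scope ring_scope.

Section defs.
Context {R : realType} {N : nat}.
Notation V := 'rV[R]_N.

(* Euclidean norm and distance on R^N (the library norm on 'rV is the max-norm). *)
Definition eucl (x : V) : R := Num.sqrt (\sum_(i < N) x ord0 i ^+ 2).
Definition edist (x y : V) : R := eucl (x - y).

Definition ebasis (i : 'I_N) : V := delta_mx ord0 i.

Definition BorelRN : Type := g_sigma_algebraType (@open V).

Definition box (a b : V) : set V :=
  [set x | forall i, a ord0 i <= x ord0 i <= b ord0 i].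
Definition box_vol (a b : V) : R := \prod_(i < N) (b ord0 i - a ord0 i).
Definition lebN (A : set BorelRN) : \bar R :=
  ereal_inf [set (\sum_(0 <= k <oo) (box_vol (ab.1 k) (ab.2 k))%:E)%E
            | ab in [set ab : (nat -> V) * (nat -> V) |
                     (forall k i, ab.1 k ord0 i <= ab.2 k ord0 i) /\
                     A `<=` \bigcup_k box (ab.1 k) (ab.2 k)]].

(* s-dimensional Hausdorff measure w.r.t. the Euclidean distance, without the
   normalising constant omega_s / 2^s (irrelevant for finiteness).
   diam C = sup of distances; empty sets contribute 0. *)
Definition ediam (C : set V) : R :=
  sup [set edist x y | x in C & y in C].
Definition diam_pow (s : nat) (C : set V) : R :=
  if `[< C = set0 >] then 0 else ediam C ^+ s.
Definition hausdorff_pre (s : nat) (delta : R) (A : set V) : \bar R :=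
  ereal_inf [set (\sum_(0 <= k <oo) (diam_pow s (C k))%:E)%E
            | C in [set C : nat -> set V |
                    A `<=` \bigcup_k C k /\
                    (forall k x y, C k x -> C k y -> edist x y <= delta)]].
Definition hausdorff (s : nat) (A : set V) : \bar R :=
  ereal_sup [set hausdorff_pre s delta A | delta in [set d : R | 0 < d]].

Definition boundary (A : set V) : set V := closure A `\` interior A.

Definition compactly_contained (U Omega : set V) : Prop :=
  compact (closure U) /\ closure U `<=` Omega.

Definition compact_support_in {Y : zmodType} (f : V -> Y) (U : set V) : Prop :=
  exists K : set V, compact K /\ K `<=` U /\ (forall x, ~ K x -> f x = 0).

Definition iter_derive (vs : seq V) (f : V -> R) : V -> R :=
  foldr (fun v g => fun x => 'D_v g x) f vs.
Definition smooth (f : V -> R) : Prop :=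
  forall vs : seq V, continuous (iter_derive vs f) /\
    (forall (v x : V), derivable (iter_derive vs f) x v).
Definition C1 (f : V -> R) : Prop :=
  continuous f /\ forall v : V,
    (forall x, derivable f x v) /\ continuous (fun x => 'D_v f x).

Definition test_fun (U : set V) (phi : V -> R) : Prop :=
  smooth phi /\ compact_support_in phi U.
Definition C1c_field (Phi : V -> V) : Prop :=
  (forall i, C1 (fun x => Phi x ord0 i)) /\ compact_support_in Phi setT.

Definition divergence (Phi : V -> V) (x : V) : R :=
  \sum_(i < N) 'D_(ebasis i) (fun y => Phi y ord0 i) x.
Definition dot_grad (F : V -> V) (phi : V -> R) (x : V) : R :=
  \sum_(i < N) F x ord0 i * 'D_(ebasis i) phi x.

Definition perimeter (U : set V) : \bar R :=
  ereal_sup [set (\int[lebN]_(x in (U : set BorelRN)) (divergence Phi x)%:E)%E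
            | Phi in [set Phi | C1c_field Phi /\ forall x, eucl (Phi x) <= 1]].
Definition finite_perimeter (U : set V) : Prop := (perimeter U < +oo)%E.

Definition meas_field (D : set V) (F : V -> V) : Prop :=
  forall i, @measurable_fun _ _ BorelRN R (D : set BorelRN)
                            ((fun x : V => F x ord0 i) : BorelRN -> R).

Definition ess_bounded_on (D : set V) (F : V -> V) : Prop :=
  exists M : R, lebN ([set x | D x /\ M < eucl (F x)] : set BorelRN) = 0%E.

Definition div_is (U : set V) (F : V -> V)
  (mu1 mu2 : {measure set BorelRN -> \bar R}) : Prop :=
  forall phi, test_fun U phi ->
    (\int[lebN]_(x in (U : set BorelRN)) (dot_grad F phi x)%:E =
     - ((\int[mu1]_(x in (U : set BorelRN)) (phi x)%:E) -
        (\int[mu2]_(x in (U : set BorelRN)) (phi x)%:E)))%E.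

(* DM^oo(U): bounded fields whose divergence is a finite signed Radon measure
   on U (written via its Jordan decomposition mu1 - mu2, mu_i finite on U). *)
Definition DM_infty (U : set V) (F : V -> V) : Prop :=
  meas_field U F /\ ess_bounded_on U F /\
  exists mu1 mu2 : {measure set BorelRN -> \bar R},
    (mu1 (U : set BorelRN) < +oo)%E /\ (mu2 (U : set BorelRN) < +oo)%E /\
    div_is U F mu1 mu2.

(* DM^oo_loc(Omega): locally bounded fields whose divergence is a signed Radon
   measure on Omega (mu1 - mu2, each finite on compact subsets of Omega). *)
Definition DM_infty_loc (Omega : set V) (F : V -> V) : Prop :=
  meas_field Omega F /\
  (forall K, compact K -> K `<=` Omega -> ess_bounded_on K F) /\
  exists mu1 mu2 : {measure set BorelRN -> \bar R},
    (forall K, compact K -> K `<=` Omega ->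
       (mu1 (K : set BorelRN) < +oo)%E /\ (mu2 (K : set BorelRN) < +oo)%E) /\
    div_is Omega F mu1 mu2.

Definition extension_domain (U : set V) (F : V -> V) : Prop :=
  exists Fs : V -> V, DM_infty setT Fs /\
    lebN ([set x | U x /\ Fs x <> F x] : set BorelRN) = 0%E.

End defs.

(* Main.v *)
(** In both parts the extension is [F], truncated at its essential bound, inside
    [U] and zero outside. By the Riesz representation theorem its divergence is
    a finite signed measure as soon as [|int_U F . grad f| <= C sup |f|] for all
    test functions [f] on the whole space.

    If the boundary has finite Hausdorff measure, cover it (on the support of
    [f]) by boxes of small radii [r_k] with [sum_k r_k^(N-1)] bounded, and let
    [eta] be a product of cutoffs vanishing near the boundary. Then [f eta] on
    [U] is a test function on [U], and the remaining terms are at most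
    [int |f F . grad eta| <= C sup |f| sum_k r_k^(N-1)] up to an error that
    tends to zero with the radii.

    If [U] has finite perimeter, test the perimeter with the mollification of
    [f F]. Its divergence is the mollification of [f div F + F . grad f]; the
    first term has integral over [U] at most [sup |f| |div F|(K)], with [K] a
    compact neighbourhood of [U], and the second converges to
    [int_U F . grad f]. *)
Require Import Defs.
From HB Require Import structures.
From mathcomp Require Import all_boot all_order all_algebra.
From mathcomp Require Import all_classical all_reals all_analysis.
From mathcomp Require Import measurable_realfun ring lra.
Set Implicit Arguments. Unset Strict Implicit. Unset Printing Implicit Defensive.
Import Order.TTheory GRing.Theory Num.Theory.
Import numFieldNormedType.Exports.
Local Open Scope classical_set_scope.
Local Open Scope ring_scope.

(** * Lebesgue measure on Borel sets *)

(** [lebN] is given only as an infimum over covers by boxes, and the Riesz measures have to be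
    constructed as well. Both are gauges: infima of the total cost of countable covers, whose pieces
    are boxes in one case and nonnegative test functions in the other. Since half-spaces generate
    the Borel sets, countable additivity reduces to splitting each piece along a half-space with
    arbitrarily small loss.

    Volumes enter through upper bounds for boxes and translation invariance; the mollifier is
    normalized by its own integral.

    The exponent [N - 1] arises because a cutoff of radius [r] has a gradient of order [1 / r] on a
    box of volume at most of order [r^N]. In the perimeter part the error of mollification is
    carried by a collar, the points of [U] that a kernel of width [eps] connects with the
    complement. Collars shrink to the empty set because [U] is open, so their measure absorbs the
    gradient of [f], on which the final constant must not depend. *)

Section double_series.
Local Open Scope ereal_scope.
Context {R : realType}.

(** The enumeration is chosen before the summand because a family of covers and its costs must be
    flattened along the same indices. *)
Lemma double_series_reindex : exists f : nat -> nat * nat,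
  forall a : nat * nat -> \bar R, (forall i, 0 <= a i) ->
  \sum_(0 <= k <oo) a (f k) =
  \sum_(0 <= i <oo) \sum_(0 <= j <oo) a (i, j).
Proof.
have /card_esym/ppcard_eqP[f] := card_nat2.
exists f => a a0.
rewrite nneseries_esumT; last by move=> k; exact: a0.
transitivity (\esum_(i in [set: nat * nat]) a i).
  rewrite [RHS](reindex_esum [set: nat] setT f)//.
rewrite (_ : setT = \bigcup_k [set (k, j) | j in setT]); last first.
  by rewrite predeqE => -[i j]; split => // _; exists i => //; exists j.
rewrite esum_bigcupT /=; last 2 first.
  - apply/trivIsetP => i j _ _ ij.
    rewrite predeqE => -[n m] /=; split => //= -[] [_] _ [<-{n} _].
    by move=> [m' _] [] /esym/eqP; rewrite (negbTE ij).
  - by move=> n; exact: a0.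
rewrite -nneseries_esumT; last by move=> k; exact: esum_ge0.
apply: eq_eseriesr => /= i _.
rewrite [RHS]nneseries_esumT; last by move=> k; exact: a0.
rewrite (reindex_esum [set: nat] _ (fun j => (i, j)))//.
split => [j _|x y _ _ [] //|_ [j _ <-]]; by exists j.
Qed.
Lemma series_cons (Y : Type) (a : Y -> \bar R) (y : Y) (z : nat -> Y) :
  (forall y, 0 <= a y) ->
  \sum_(0 <= k <oo) a (if k is k'.+1 then z k' else y) =
  a y + \sum_(0 <= k <oo) a (z k).
Proof.
move=> a0; rewrite nneseries_recl; [|by move=> k _; exact: a0|by []].
congr (_ + _).
rewrite -(@nneseries_addn _ (fun k => a (if k is k'.+1 then z k' else y)) 1%N) //.
by apply: eq_eseriesr => k _; rewrite addn1.
Qed.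
End double_series.

(** * Outer measures from countable covers by weighted pieces *)

Section gauge.
Local Open Scope ereal_scope.
Context {R : realType} {T X : Type}.
Variables (c : X -> \bar R) (g : X -> T -> \bar R) (x0 : X).
Hypotheses (c0 : forall s, 0 <= c s) (g0 : forall s t, 0 <= g s t).
Hypothesis cx0 : c x0 = 0.

Definition gauge_covers (f : T -> \bar R) (s : nat -> X) :=
  forall t, f t <= \sum_(0 <= k <oo) g (s k) t.

(* Instances: boxes with their volumes give [lebN]; nonnegative test functions
   with their values under a positive functional give the Riesz measure. *)
Definition gauge_int (f : T -> \bar R) : \bar R :=
  ereal_inf [set \sum_(0 <= k <oo) c (s k) | s in gauge_covers f].

Definition gauge_measure (A : set T) : \bar R :=
  gauge_int (fun t => (\1_A t)%:E).

Lemma gauge_int_ge0 f : 0 <= gauge_int f.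
Proof. by apply: le_ereal_inf_tmp => _ [s _ <-]; exact: nneseries_ge0. Qed.

Lemma gauge_int_le f s : gauge_covers f s ->
  gauge_int f <= \sum_(0 <= k <oo) c (s k).
Proof. by move=> fs; apply: ereal_inf_lbound; exists s. Qed.

Lemma le_gauge_int f h : (forall t, f t <= h t) -> gauge_int f <= gauge_int h.
Proof.
move=> fh; apply/ereal_inf_le_tmp => _ [s hs <-]; exists s => // t.
exact: le_trans (fh t) (hs t).
Qed.

Lemma gauge_int_single f s : (forall t, f t <= g s t) -> gauge_int f <= c s.
Proof.
move=> fs.
(* The free piece [x0] pads a single piece to a sequence. *)
have -> : c s = \sum_(0 <= k <oo) c (if k is k'.+1 then x0 else s).
  rewrite (@series_cons _ _ c s (fun=> x0))//.
  by rewrite eseries0 ?adde0 // => k _ _; rewrite cx0.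
apply: gauge_int_le => t; rewrite (@series_cons _ _ (g^~ t) s (fun=> x0))//.
by rewrite (le_trans (fs t))// leeDl// nneseries_ge0.
Qed.

Lemma gauge_int0 f : (forall t, f t <= 0) -> gauge_int f = 0.
Proof.
move=> f0; apply/eqP; rewrite eq_le gauge_int_ge0 andbT -[leRHS]cx0.
by apply: gauge_int_single => t; exact: le_trans (f0 t) (g0 _ _).
Qed.

Lemma gauge_int_adherent f (e : R) : (0 < e)%R -> gauge_int f < +oo ->
  exists2 s, gauge_covers f s & \sum_(0 <= k <oo) c (s k) <= gauge_int f + e%:E.
Proof.
move=> e0 foo.
have ffin : gauge_int f \is a fin_num by rewrite ge0_fin_numE// gauge_int_ge0.
have [_ [s fs <-]] := lb_ereal_inf_adherent e0 ffin.
by move/ltW => ?; exists s.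
Qed.

(** Covers of the [F n] that are optimal up to [e / 2 ^ n.+1] are merged along the common
    enumeration. It is stated for functions, not sets, because the Riesz measure compares a test
    function with a sum of indicators of its superlevel sets. *)
Lemma gauge_int_sigma_subadditive f (F : nat -> T -> \bar R) :
  (forall i t, 0 <= F i t) ->
  (forall t, f t <= \sum_(0 <= i <oo) F i t) ->
  gauge_int f <= \sum_(0 <= i <oo) gauge_int (F i).
Proof.
move=> F0 fF.
have [[i ioo]|] := pselect (exists i, gauge_int (F i) = +oo).
  rewrite (eseries_pinfty _ _ ioo) ?leey// => n _.
  by rewrite -ltNye (lt_le_trans _ (gauge_int_ge0 _)).
rewrite -forallNE => Foo.
apply/lee_addgt0Pr => e e0.
rewrite (le_trans _ (epsilon_trick _ _ (ltW e0)))//; last first.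
  by move=> n; exact: gauge_int_ge0.
have [G PG] : {G : nat -> nat -> X & forall n, gauge_covers (F n) (G n) /\
    \sum_(0 <= k <oo) c (G n k) <= gauge_int (F n) + (e / (2 ^ n.+1)%:R)%:E}.
  apply: (@choice _ _ (fun n G => gauge_covers (F n) G /\
    \sum_(0 <= k <oo) c (G k) <= gauge_int (F n) + (e / (2 ^ n.+1)%:R)%:E)) => n.
  have en : (0 < e / (2 ^ n.+1)%:R)%R by rewrite divr_gt0// ltr0n expn_gt0.
  have [|s ? ?] := gauge_int_adherent en (_ : gauge_int (F n) < +oo).
    by rewrite ltey; apply/eqP; exact: Foo.
  by exists s.
have [u uP] := @double_series_reindex R.
apply: (@le_trans _ _ (\sum_(0 <= k <oo) c (G (u k).1 (u k).2))).
  apply: gauge_int_le => t; rewrite (uP (fun p => g (G p.1 p.2) t))//.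
  apply: (le_trans (fF t)); apply: lee_nneseries => [i _ _|i _]; first exact: F0.
  exact: (PG i).1.
rewrite (uP (fun p => c (G p.1 p.2)))//; apply: lee_nneseries => [i _ _|i _].
  exact: nneseries_ge0.
exact: (PG i).2.
Qed.

Lemma gauge_int_subadditive f (F : nat -> T -> \bar R) n :
  (forall i t, 0 <= F i t) -> (forall t, f t <= \sum_(i < n) F i t) ->
  gauge_int f <= \sum_(i < n) gauge_int (F i).
Proof.
move=> F0 fF; pose G i t := if (i < n)%N then F i t else 0.
have G0 i t : 0 <= G i t by rewrite /G; case: ifP.
have cut (a : nat -> \bar R) : (forall i, 0 <= a i) ->
    (forall i, (n <= i)%N -> a i = 0) ->
    \sum_(0 <= i <oo) a i = \sum_(i < n) a i.
  move=> a0 an; rewrite (@nneseries_split _ _ 0 n)// add0n.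
  by rewrite big_mkord eseries0 ?adde0// => i ni _; exact: an.
apply: (@le_trans _ _ (\sum_(0 <= i <oo) gauge_int (G i))).
  apply: gauge_int_sigma_subadditive => // t; rewrite cut//; last first.
    by move=> i; rewrite /G leqNgt => /negbTE ->.
  by apply: (le_trans (fF t)); apply: lee_sum => i _; rewrite /G ltn_ord.
rewrite cut; last 2 first.
- by move=> i; exact: gauge_int_ge0.
- by move=> i; rewrite /G leqNgt => /negbTE ->; exact: gauge_int0.
by apply: lee_sum => i _; rewrite /G ltn_ord.
Qed.

Lemma gauge_measure0 : gauge_measure set0 = 0.
Proof. by apply: gauge_int0 => t; rewrite indic0. Qed.

Lemma gauge_measure_sigma_subadditive : sigma_subadditive gauge_measure.
Proof.
move=> F; apply: gauge_int_sigma_subadditive => [i t|t].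
  by rewrite lee_fin.
have [[k _ Fkt]|nF] := pselect ((\bigcup_n F n) t); last first.
  rewrite indicE memNset//; apply: nneseries_ge0 => k _ _.
  by rewrite lee_fin.
rewrite (@nneseriesD1 _ _ k xpredT); [|by move=> m _; rewrite lee_fin|by []].
rewrite !indicE !mem_set//; last by exists k.
by rewrite leeDl// nneseries_ge0// => m _ _; rewrite lee_fin.
Qed.

Lemma le_gauge_measure : {homo gauge_measure : A B / A `<=` B >-> A <= B}.
Proof.
move=> A B AB; apply: le_gauge_int => t; rewrite lee_fin !indicE ler_nat.
by case: (boolP (t \in A)) => // /set_mem /AB /mem_set ->.
Qed.

(* A set that splits every piece without changing its cost is Caratheodory
   measurable. The piece of the complement may be chosen differently for each
   index of a cover, so a loss [e] that is arbitrarily small per piece is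
   harmless. *)
Lemma gauge_caratheodory (mu : {outer_measure set T -> \bar R}) (H : set T) :
  (mu : set T -> \bar R) =1 gauge_measure ->
  (forall s (e : R), (0 < e)%R -> exists v (u : nat -> X),
     [/\ forall t, ~ H t -> g s t <= g v t,
         forall t, H t -> g s t <= \sum_(0 <= k <oo) g (u k) t &
         c v + \sum_(0 <= k <oo) c (u k) <= c s + e%:E]) ->
  mu.-caratheodory H.
Proof.
move=> muE split; apply: le_caratheodory_measurable => A; rewrite !muE.
have [->|Aoo] := eqVneq (gauge_measure A) +oo; first by rewrite leey.
apply/lee_addgt0Pr => e e0.
have e20 : (0 < e / 2)%R by rewrite divr_gt0.
have [|s As sle] := @gauge_int_adherent (fun t => (\1_A t)%:E) _ e20.
  by rewrite ltey.
have [v vP] : {v : nat -> X * (nat -> X) & forall n,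
  [/\ forall t, ~ H t -> g (s n) t <= g (v n).1 t,
      forall t, H t -> g (s n) t <= \sum_(0 <= k <oo) g ((v n).2 k) t &
      c (v n).1 + \sum_(0 <= k <oo) c ((v n).2 k)
        <= c (s n) + (e / 2 / (2 ^ n.+1)%:R)%:E]}.
  apply: (@choice _ _ (fun n v => [/\ forall t, ~ H t -> g (s n) t <= g v.1 t,
      forall t, H t -> g (s n) t <= \sum_(0 <= k <oo) g (v.2 k) t &
      c v.1 + \sum_(0 <= k <oo) c (v.2 k)
        <= c (s n) + (e / 2 / (2 ^ n.+1)%:R)%:E])) => n.
  have en : (0 < e / 2 / (2 ^ n.+1)%:R)%R by rewrite divr_gt0// ltr0n expn_gt0.
  by have [a [b]] := split (s n) _ en; exists (a, b).
have [u uP] := @double_series_reindex R.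
have le1 : gauge_measure (A `&` ~` H) <= \sum_(0 <= n <oo) c (v n).1.
  apply: gauge_int_le => t; rewrite indicE.
  have [/set_mem[At Ht]|_] := boolP (t \in A `&` ~` H); last exact: nneseries_ge0.
  have := As t; rewrite indicE mem_set// => /le_trans; apply.
  by apply: lee_nneseries => [//|n _]; have [+ _ _] := vP n; apply.
have le2 : gauge_measure (A `&` H) <=
    \sum_(0 <= n <oo) \sum_(0 <= k <oo) c ((v n).2 k).
  rewrite -(uP (fun p => c ((v p.1).2 p.2)))//.
  apply: gauge_int_le => t; rewrite indicE.
  have [/set_mem[At Ht]|_] := boolP (t \in A `&` H); last exact: nneseries_ge0.
  have := As t; rewrite indicE mem_set// => /le_trans; apply.
  rewrite (uP (fun p => g ((v p.1).2 p.2) t))//.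
  by apply: lee_nneseries => [//|n _]; have [_ + _] := vP n; apply.
apply: le_trans (leeD le2 le1) _.
rewrite -nneseriesD//; last by move=> n _ _; exact: nneseries_ge0.
apply: (@le_trans _ _ (\sum_(0 <= n <oo) (c (s n) + (e / 2 / (2 ^ n.+1)%:R)%:E))).
  apply: lee_nneseries => [n _ _|n _].
    by rewrite adde_ge0// nneseries_ge0.
  by rewrite addeC; have [_ _] := vP n.
apply: le_trans (epsilon_trick _ _ _) _ => //; first exact: ltW.
by rewrite [in leRHS](splitr e) EFinD addeA leeD2r.
Qed.
End gauge.

(** * Boxes, half-spaces and the Borel sets *)

Section coordinates.
Context {R : realType} {N : nat}.
Notation V := 'rV[R]_N.

Definition obox (c : V) (r : R) : set V :=
  [set x | forall i, `|x ord0 i - c ord0 i| < r].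

Lemma obox_center (c : V) r : 0 < r -> obox c r c.
Proof. by move=> r0 i; rewrite subrr normr0. Qed.


Lemma ball_obox (c : V) r : 0 < r -> ball c r = obox c r.
Proof.
move=> r0; rewrite predeqE => y; split.
  by move=> [_ cy] i; have := cy ord0 i; rewrite /ball /= distrC.
by move=> cy; split => // i j; rewrite (ord1 i) /ball /= distrC; exact: cy.
Qed.

Lemma nbhs_obox (x : V) (A : set V) :
  nbhs x A <-> exists2 r : R, 0 < r & obox x r `<=` A.
Proof.
split=> [/nbhs_ballP[r /= r0]|[r r0]]; rewrite -?ball_obox// => rA; first by exists r; rewrite -?ball_obox.
by apply/nbhs_ballP; exists r.
Qed.

Lemma open_obox (c : V) r : 0 < r -> open (obox c r).
Proof. by move=> r0; rewrite -ball_obox//; exact: ball_open. Qed.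
End coordinates.

Section borel_sets.
Context {R : realType} {N : nat}.
Notation V := 'rV[R]_N.

Definition halfspace (i : 'I_N) (c : R) : set V := [set x | x ord0 i < c].

(** A countable base. The radius is below [r / 2] because a point of the small box is compared with
    [x] through the rational centre. *)
Lemma rat_obox (x : V) (r : R) : 0 < r ->
  exists (q : 'rV[rat]_N) (k : nat),
    obox (map_mx ratr q) (k.+1%:R^-1) x /\ obox (map_mx ratr q) (k.+1%:R^-1) `<=` obox x r.
Proof.
move=> r0; have [k] := @ltr_add_invr R 0 (r / 2) ltac:(by rewrite divr_gt0).
rewrite add0r => kr.
have q_ (i : 'I_N) : {q : rat | `|ratr q - x ord0 i| < k.+1%:R^-1}.
  apply: cid; have [q] := @rat_in_itvoo R (x ord0 i - k.+1%:R^-1) (x ord0 i + k.+1%:R^-1) ltac:(by rewrite ltrBlDr -addrA ltrDl addr_gt0 ?invr_gt0).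
  by rewrite in_itv/= => qx; exists q; rewrite distrC ltr_distlC qx.
exists (\row_i sval (q_ i)), k; split.
  by move=> i; rewrite !mxE distrC; case: (q_ i).
move=> y yq i; have := yq i; rewrite !mxE; case: (q_ i) => q /= qx yqi.
rewrite (le_lt_trans (ler_distD (ratr q) _ _))//.
rewrite (splitr r) ltrD//; exact: lt_trans kr.
Qed.

(** Open boxes are finite intersections of strips, and open sets are countable unions of rational
    boxes. Caratheodory measurability and measurability of vector-valued maps can therefore be
    tested one coordinate at a time. *)
Lemma open_sigma_halfspace (M : set (set V)) : sigma_algebra setT M ->
  (forall i c, M (halfspace i c)) -> @open V `<=` M.
Proof.
move=> [M0 MC MU] Mh.
have MC' A : M A -> M (~` A) by rewrite -setTD; exact: MC.
have MU2 A B : M A -> M B -> M (A `|` B).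
  move=> MA MB; rewrite -bigcup2E; apply: MU => -[|[|n]] //=.
have MI2 A B : M A -> M B -> M (A `&` B).
  by move=> MA MB; rewrite -[A `&` B]setCK setCI; apply: (MC'); apply: MU2; exact: MC'.
have Mge i c : M [set x : V | c < x ord0 i].
  have -> : [set x : V | c < x ord0 i] =
      \bigcup_k ~` halfspace i (c + k.+1%:R^-1).
    rewrite predeqE => x; split => [/= cx|[k _] /= /negP].
      have [k kx] := @ltr_add_invr R _ _ cx.
      by exists k => //=; apply/negP; rewrite -leNgt ltW.
    by rewrite -leNgt; apply: lt_le_trans; rewrite ltrDl invr_gt0.
  by apply: MU => k; apply: MC'; exact: Mh.
have Mbox c (r : R) : M (obox c r).
  suff H (s : seq 'I_N) : M [set x : V | forall i, i \in s -> `|x ord0 i - c ord0 i| < r].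
    have := H (enum 'I_N); congr M; rewrite predeqE => x.
    by split => [xc i|xc i _]; apply: xc; rewrite mem_enum.
  elim: s => [|i s IH].
    have -> : [set x : V | forall i, i \in [::] -> `|x ord0 i - c ord0 i| < r] = ~` set0.
      by rewrite setC0 predeqE.
    exact: MC'.
  have -> : [set x : V | forall j, j \in i :: s -> `|x ord0 j - c ord0 j| < r] =
      ([set x : V | c ord0 i - r < x ord0 i] `&` halfspace i (c ord0 i + r)) `&`
      [set x : V | forall j, j \in s -> `|x ord0 j - c ord0 j| < r].
    rewrite predeqE => x; rewrite /halfspace/=; split.
      move=> xc; split; last by move=> k ks; apply: xc; rewrite inE ks orbT.
      by apply/andP; rewrite -ltr_distlC distrC; apply: xc; rewrite mem_head.
    move=> [[h1 h2] h3] k; rewrite inE => /orP[/eqP ->|]; last exact: h3.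
    by rewrite distrC ltr_distlC h1.
  by apply: (MI2) => //; exact: MI2.
move=> O oO.
pose F m := if unpickle m is Some (q, k) then
  (if `[< obox (map_mx ratr q) (k.+1%:R^-1) `<=` O >] then obox (map_mx ratr (q : 'rV[rat]_N)) (k.+1%:R^-1 : R) else set0)
  else set0.
have -> : O = \bigcup_m F m.
  rewrite predeqE => x; split => [Ox|[m _]]; last first.
    by rewrite /F; case: unpickle => // -[q k]; case: asboolP => // h /h.
  have /nbhs_obox[r r0 rO] := open_nbhs_nbhs (conj oO Ox).
  have [q [k [qx qr]]] := rat_obox x r0.
  exists (pickle (q, k)) => //; rewrite /F pickleK asboolT//.
  exact: subset_trans rO.
apply: MU => m; rewrite /F; case: unpickle => // -[q k].
by case: ifP.
Qed.
End borel_sets.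

Section borel_measurability.
Context {R : realType} {N : nat}.
Notation V := 'rV[R]_N.
Notation B := (@BorelRN R N).

Lemma measurable_open (O : set V) : open O -> measurable (O : set B).
Proof. exact: sub_sigma_algebra. Qed.

Lemma measurable_closed (C : set V) : closed C -> measurable (C : set B).
Proof.
move=> cC; rewrite -[C]setCK; apply: measurableC; apply: measurable_open.
exact: closed_openC.
Qed.

Lemma measurable_compact (K : set V) : compact K -> measurable (K : set B).
Proof. by move=> cK; apply: measurable_closed; apply: compact_closed. Qed.

Lemma continuous_borelRN_measurable (D : set B) (f : V -> R) : measurable D ->
  continuous f -> measurable_fun D (f : B -> R).
Proof.
move=> mD cf; apply: measurable_funS measurableT _ _ => //.
apply: (measurability _ (RGenOpens.measurableE R)).
move=> _ [_ [a [b ->] <-]]; rewrite setTI; apply: measurable_open.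
move/continuousP : cf; apply; exact: interval_open.
Qed.

(** The sets with measurable preimage form a sigma-algebra, which contains the half-spaces by
    hypothesis. *)
Lemma measurable_fun_coord d (T : measurableType d) (D : set T) (f : T -> V) :
  (forall i, measurable_fun D (fun t => f t ord0 i)) -> measurable_fun D (f : T -> B).
Proof.
move=> mf mD; suff : measurable_fun D (f : T -> B) by apply.
apply: (@measurability _ _ _ B D f (@open V)); first by [].
move=> _ [U oU <-].
apply: (@open_sigma_halfspace R N (image_set_system D f measurable)) => //.
  split=> [|A mA|A mA]; rewrite /image_set_system/=.
  - by rewrite preimage_set0 setI0.
  - rewrite (_ : D `&` _ = D `\` (D `&` f @^-1` A)); first exact: measurableD.
    by rewrite predeqE => t; split => [[Dt [_ nA]]|[Dt nA]]; split => //; [case|split => // At; exact: nA].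
  - by rewrite preimage_bigcup setI_bigcupr; exact: bigcupT_measurable.
move=> i c; rewrite /image_set_system/=.
have := mf i mD `]-oo, c[%classic (measurable_itv _).
by congr measurable; congr (_ `&` _); rewrite predeqE => t /=; rewrite in_itv.
Qed.

(** Caratheodory-measurable sets form a sigma-algebra on which the outer measure is additive. Both
    the Lebesgue and the Riesz measure become measures on Borel sets through this lemma. *)
Lemma caratheodory_semi_sigma_additive (mu : {outer_measure set V -> \bar R}) :
  (forall i c, mu.-caratheodory (halfspace i c)) ->
  semi_sigma_additive (mu : set B -> \bar R).
Proof.
move=> H F mF tF mUF.
have sub : (@measurable _ B) `<=` mu.-caratheodory.
  apply: smallest_sub.
    exact: (@sigma_algebra_measurable _ (caratheodory_type mu)).
  apply: open_sigma_halfspace => //.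
  exact: (@sigma_algebra_measurable _ (caratheodory_type mu)).
apply: (@caratheodory_measure_sigma_additive R V mu F) => //.
- move=> i; exact: sub.
- exact: sub.
Qed.
End borel_measurability.

(** * Lebesgue measure in positive dimension *)

Section lebesgue_measure_RN.
Context {R : realType} {n : nat}.
Notation N := n.+1.
Notation V := 'rV[R]_N.
Notation B := (@BorelRN R N).
Notation lam := (@lebN R N).

Lemma box_vol_ge0 (a b : V) : (forall i, a ord0 i <= b ord0 i) -> 0 <= box_vol a b.
Proof. by move=> ab; apply: prodr_ge0 => i _; rewrite subr_ge0. Qed.

(** Bundling the order of the corners makes every cost nonnegative, as the gauge requires. *)
Let pbox := {ab : V * V | forall i, ab.1 ord0 i <= ab.2 ord0 i}.
Let cost (p : pbox) : \bar R := (box_vol (sval p).1 (sval p).2)%:E.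
Let prof (p : pbox) (x : V) : \bar R := (\1_(box (sval p).1 (sval p).2) x)%:E.

(** The one-point box is free because the dimension is positive; in dimension zero the empty product
    would give it volume 1. *)
Let p0 : pbox := exist (fun ab : V * V => forall i, ab.1 ord0 i <= ab.2 ord0 i)
  (0, 0) (fun i => lexx _).

Let cost_ge0 p : (0 <= cost p)%E.
Proof. by rewrite lee_fin; apply: box_vol_ge0; case: p. Qed.

Let prof_ge0 p x : (0 <= prof p x)%E.
Proof. by rewrite lee_fin. Qed.

Let cost0 : cost p0 = 0%E.
Proof. by rewrite /cost /box_vol /= big_ord_recl subrr mul0r. Qed.

(** Boxes cover [A] exactly when the sum of their indicators dominates the indicator of [A]. *)
Let lebNE (A : set V) : lebN (A : set B) = gauge_measure cost prof A.
Proof.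
rewrite /lebN /gauge_measure /gauge_int; congr ereal_inf.
rewrite predeqE => y; split.
  move=> [[a b] [/= ab AU] <-].
  exists (fun k => exist _ (a k, b k) (ab k)) => // t.
  rewrite indicE; have [/set_mem /AU [k _ tk]|_] := boolP (t \in A); last exact: nneseries_ge0.
  rewrite (@nneseriesD1 _ _ k xpredT)// {1}/prof/= indicE mem_set//.
  by rewrite leeDl// nneseries_ge0.
move=> [s As <-]; exists (fun k => (sval (s k)).1, fun k => (sval (s k)).2) => //=.
split=> [k i|x Ax]; first by case: (s k).
apply: contrapT => nU; have := As x; rewrite indicE mem_set//= leNgt => /negP; apply.
rewrite eseries0 ?lte01// => k _ _; rewrite /prof indicE memNset// => xk.
by apply: nU; exists k.
Qed.

Let lamo (A : set V) : \bar R := gauge_measure cost prof A.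
HB.instance Definition _ := isOuterMeasure.Build R V lamo
  (gauge_measure0 cost_ge0 prof_ge0 cost0)
  (fun A => gauge_int_ge0 prof cost_ge0 _)
  (@le_gauge_measure _ _ _ cost prof)
  (gauge_measure_sigma_subadditive cost_ge0 prof_ge0).

Let split_box (i : 'I_N) (c : R) (p : pbox) : exists q1 q2 : pbox,
  [/\ forall x, ~ halfspace i c x -> (prof p x <= prof q1 x)%E,
      forall x, halfspace i c x -> (prof p x <= prof q2 x)%E &
      (cost q1 + cost q2 <= cost p)%E].
Proof.
case: p => -[a b] /= ab.
(* The cut is clamped between the corners, so both halves are ordered boxes even if the hyperplane
   misses the box, and the two volumes add up exactly. *)
pose cl := Num.min (b ord0 i) (Num.max (a ord0 i) c).
have acl : a ord0 i <= cl by rewrite /cl le_min ab le_max lexx.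
have clb : cl <= b ord0 i by rewrite /cl ge_min lexx.
pose upd (v : V) : V := \row_j (if j == i then cl else v ord0 j).
have h1 j : (upd a) ord0 j <= b ord0 j.
  by rewrite mxE; case: eqP => [->|_].
have h2 j : a ord0 j <= (upd b) ord0 j.
  by rewrite mxE; case: eqP => [->|_].
exists (exist _ (upd a, b) h1), (exist _ (a, upd b) h2).
have le_prof (q q' : pbox) x : (box (sval q).1 (sval q).2 x -> box (sval q').1 (sval q').2 x) ->
    (prof q x <= prof q' x)%E.
  move=> qq'; rewrite lee_fin !indicE ler_nat.
  by case: (boolP (x \in box (sval q).1 _)) => // /set_mem /qq' /mem_set ->.
split.
- move=> x xc; apply: le_prof => /= xab j; have /andP[xa xb] := xab j.
  rewrite mxE xb andbT; case: eqP => // ji; rewrite ji in xa xb *.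
  rewrite /cl ge_min ge_max xa /=; move/negP : xc; rewrite -leNgt => ->.
  by rewrite orbT.
- move=> x xc; apply: le_prof => /= xab j; have /andP[xa xb] := xab j.
  rewrite mxE xa/=; case: eqP => // ji; rewrite ji in xa xb *.
  by rewrite /cl le_min xb le_max (ltW xc) orbT.
- have E (f : 'I_N -> R) : \prod_(j < N) f j = f i * \prod_(j < N | j != i) f j.
    by rewrite (bigD1 i).
  rewrite /cost -EFinD lee_fin /box_vol/= !E !mxE eqxx.
  rewrite (eq_bigr (fun j => b ord0 j - a ord0 j)); last first.
    by move=> j ji; rewrite mxE (negbTE ji).
  rewrite [X in _ + _ * X <= _](eq_bigr (fun j => b ord0 j - a ord0 j)); last first.
    by move=> j ji; rewrite mxE (negbTE ji).
  by rewrite -mulrDl addrA subrK.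
Qed.

Let lamo_caratheodory i c : lamo.-caratheodory (halfspace i c).
Proof.
apply: (gauge_caratheodory cost_ge0 prof_ge0) => // p e e0.
have [q1 [q2 [h1 h2 h3]]] := split_box i c p.
exists q1, (fun k => if k is _.+1 then p0 else q2); split=> //.
  move=> x xc; rewrite (@series_cons _ _ (prof^~ x) q2 (fun=> p0))//.
  by rewrite (le_trans (h2 x xc))// leeDl// nneseries_ge0.
rewrite (@series_cons _ _ cost q2 (fun=> p0))// [X in (_ + (_ + X))%E]eseries0//.
by rewrite adde0 (le_trans h3)// leeDl// lee_fin ltW.
Qed.

Lemma lebN_semi_sigma_additive : semi_sigma_additive (lam : set B -> \bar R).
Proof.
have -> : (lam : set B -> \bar R) = lamo.
  by rewrite funeqE => A; rewrite /lamo -lebNE.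
exact: caratheodory_semi_sigma_additive lamo_caratheodory.
Qed.

Let lebN0 : lam set0 = 0%E.
Proof. by rewrite lebNE; exact: outer_measure0 lamo. Qed.

Let lebN_ge0 A : (0 <= lam A)%E.
Proof. by rewrite lebNE; exact: outer_measure_ge0 lamo A. Qed.

HB.instance Definition _ := isMeasure.Build _ B R lam
  lebN0 lebN_ge0 lebN_semi_sigma_additive.

Lemma lebN_box (a b : V) : (forall i, a ord0 i <= b ord0 i) ->
  (lam (box a b : set B) <= (box_vol a b)%:E)%E.
Proof.
move=> ab; rewrite lebNE -/(cost (exist _ (a, b) ab)).
by apply: (gauge_int_single cost_ge0 prof_ge0 cost0) => t.
Qed.

Lemma le_lebN (A A' : set V) : A `<=` A' -> (lam (A : set B) <= lam (A' : set B))%E.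
Proof. by rewrite !lebNE; exact: le_gauge_measure. Qed.

Lemma lebN_obox (c : V) (r : R) : 0 <= r ->
  (lam (obox c r : set B) <= ((2 * r) ^+ N)%:E)%E.
Proof.
move=> r0; pose a : V := \row_i (c ord0 i - r); pose b : V := \row_i (c ord0 i + r).
have ab i : a ord0 i <= b ord0 i by rewrite !mxE lerD2l ge0_cp.
apply: (@le_trans _ _ (lam (box a b : set B))).
  apply: le_lebN => x xc i.
  by rewrite !mxE; have /ltW := xc i; rewrite distrC ler_distlC.
apply: (le_trans (lebN_box ab)); rewrite lee_fin /box_vol.
rewrite (eq_bigr (fun=> 2 * r)); last first.
  by move=> i _; rewrite !mxE; ring.
by rewrite prodr_const card_ord.
Qed.

Let lebN_shift_le (v : V) (A : set V) :
  (lam ([set x : V | A (x + v)%R] : set B) <= lam (A : set B))%E.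
Proof.
rewrite /lebN; apply: ereal_inf_le_tmp => _ [[a b] [/= ab AU] <-].
exists (fun k => a k - v, fun k => b k - v) => /=.
  split=> [k i|x /AU[k _ xk]]; first by rewrite !mxE lerD2r.
  exists k => // i; have := xk i.
  by rewrite !mxE lerBlDr lerBrDr.
apply: eq_eseriesr => k _; congr EFin; apply: eq_bigr => i _.
by rewrite !mxE; ring.
Qed.

Lemma lebN_shift (v : V) (A : set V) :
  lam ([set x : V | A (x + v)%R] : set B) = lam (A : set B).
Proof.
apply/eqP; rewrite eq_le lebN_shift_le/=.
rewrite -[X in (X <= _)%E](_ : lam ([set x : V | [set x : V | A (x + v)%R] (x - v)%R] : set B) = _).
  exact: lebN_shift_le.
by congr lebN; rewrite predeqE => x /=; rewrite subrK.
Qed.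

Lemma lebN_bounded (A : set V) (r : R) : A `<=` obox 0 r -> (lam (A : set B) < +oo)%E.
Proof.
move=> Ar; have [r0|r0] := leP 0 r.
  apply: (@le_lt_trans _ _ ((2 * r) ^+ N)%:E); last by rewrite ltry.
  apply: le_trans (lebN_obox 0 r0).
  exact: le_lebN.
rewrite (_ : A = set0) ?measure0// predeqE => x; split => // /Ar /(_ ord0).
by move/(le_lt_trans (normr_ge0 _)); rewrite ltNge (ltW r0).
Qed.

Lemma lebN_sigma_finite : sigma_finite [set: B] lam.
Proof.
exists (fun k => obox 0 k.+1%:R).
  rewrite predeqE => x; split => // _.
  have [k xk] : exists k : nat, forall i, `|x ord0 i| < k.+1%:R.
    exists (Num.trunc (\sum_i `|x ord0 i|)) => i.
    apply: le_lt_trans (truncnS_gt _).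
    by rewrite (bigD1 i)//= lerDl sumr_ge0.
  by exists k => // i; rewrite mxE subr0.
move=> k; split; first by apply: measurable_open; exact: open_obox.
exact: lebN_bounded (@subset_refl _ _).
Qed.
HB.instance Definition _ := Measure_isSigmaFinite.Build _ B R lam lebN_sigma_finite.
End lebesgue_measure_RN.

(** * Smooth functions *)

Section flat_function.
Context {R : realType}.

(** The whole family [exp(-1/t) t^-m], extended by zero, is kept because differentiation sends its
    members to linear combinations of other members. *)
Definition flat (m : nat) (t : R) : R :=
  if 0 < t then expR (- t^-1) * t^-1 ^+ m else 0.

Lemma flat_ge0 m t : 0 <= flat m t.
Proof.
by rewrite /flat; case: ifP => // t0; rewrite mulr_ge0 ?expR_ge0 ?exprn_ge0// invr_ge0 ltW.
Qed.

Lemma flat_gt0 m t : (0 < flat m t) = (0 < t).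
Proof.
rewrite /flat; case: ifP => [t0|_]; last by rewrite ltxx.
by rewrite mulr_gt0 ?expR_gt0 ?exprn_gt0// invr_gt0.
Qed.

Lemma flat_eq0 m t : t <= 0 -> flat m t = 0.
Proof. by rewrite /flat leNgt => /negbTE ->. Qed.

(** From [exp s >= s^(m+1) / (m+1)!] at [s = 1/t]. It settles differentiability at 0, where the
    difference quotient of [flat m] is [flat m.+1]. *)
Lemma flat_bound m t : flat m t <= (m.+1)`!%:R * `|t|.
Proof.
rewrite /flat; case: ifP => t0; last by rewrite mulr_ge0.
rewrite gtr0_norm// expRN.
have it0 : 0 <= t^-1 by rewrite invr_ge0 ltW.
have := expR_ge1Dxn m it0.
set F := _%:R; move=> H; have F0 : 0 < F by rewrite ltr0n fact_gt0.
have {}H : t^-1 ^+ m.+1 / F <= expR t^-1 by rewrite (le_trans _ H)// lerDr.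
rewrite mulrC ler_pdivrMr ?expR_gt0//.
rewrite (le_trans _ (ler_wpM2l _ H))//; last by rewrite mulr_ge0// ltW.
have -> : F * t * (t^-1 ^+ m.+1 / F) = (F / F) * (t / t) * t^-1 ^+ m.
  by rewrite exprS; ring.
by rewrite !mulfV ?lt0r_neq0// !mul1r.
Qed.

Lemma is_derive_cvg (V : normedModType R) (f : V -> R) (x v : V) (l : R) :
  h^-1 *: (f (h *: v + x) - f x) @[h --> 0^'] --> l -> is_derive x v f l.
Proof. by move=> H; apply: DeriveDef; [exact: cvgP H|exact: cvg_lim H]. Qed.

Lemma is_derive_flat m (t : R) :
  is_derive t (1 : R) (flat m) (flat m.+2 t - m%:R * flat m.+1 t).
Proof.
have [t0|t0|->] := ltgtP t 0.
- rewrite !flat_eq0 ?(ltW t0)// mulr0 subrr.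
  apply: (@near_eq_is_derive R R R (fun=> 0)).
    by near=> s; rewrite flat_eq0//; apply: ltW; near: s; exact: lt_nbhsl.
- apply: (@near_eq_is_derive R R R ((expR \o (fun s : R => - s^-1)) * (fun s : R => s^-1) ^+ m)).
    near=> s; rewrite /flat ifT; last by near: s; exact: lt_nbhsr.
    by rewrite exprfctE.
  have dV : is_derive t (1 : R) (fun s : R => s^-1) (- t ^- 2).
    have := @is_deriveV R id t 1 1 (lt0r_neq0 t0) (is_derive_id _ _).
    by rewrite /= [_ *: _]mulr1.
  apply: is_derive_eq.
  rewrite /flat t0 /= exprfctE /GRing.scale/=.
  case: m => [|m] /=; first by rewrite !mul0r; field; rewrite lt0r_neq0.
  by rewrite !exprS; field; rewrite lt0r_neq0.
- rewrite !flat_eq0// mulr0 subrr; apply: is_derive_cvg.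
  rewrite flat_eq0//; apply/cvgr0Pnorm_lt => e e0.
  near=> h.
  have h0 : h != 0 by near: h; exact: nbhs_dnbhs_neq.
  have -> : h^-1 *: (flat m (h *: (1 : R) + 0) - 0) = flat m.+1 h.
    rewrite subr0 addr0 [_ *: 1]mulr1 /flat; case: ifP => // _; last by rewrite scaler0.
    by rewrite exprS /GRing.scale/= mulrCA.
  rewrite ger0_norm ?flat_ge0//.
  rewrite (le_lt_trans (flat_bound _ _))// mulrC -ltr_pdivlMr ?ltr0n ?fact_gt0//.
  by near: h; apply: dnbhs0_lt; rewrite divr_gt0// ltr0n fact_gt0.
Unshelve. all: by end_near. Qed.

End flat_function.

(** * Closure properties and locality of smoothness *)

Section smooth_functions.
Context {R : realType} {N : nat}.
Notation V := 'rV[R]_N.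

(* A class of functions that contains the cutoffs below and whose directional
   derivatives stay in the class; this is what makes them smooth. *)
Inductive smooth_term : (V -> R) -> Prop :=
| Smooth_base f : smooth f -> smooth_term f
| Smooth_cst c : smooth_term (fun=> c)
| Smooth_coord i : smooth_term (fun x => x ord0 i)
| Smooth_add f g : smooth_term f -> smooth_term g -> smooth_term (fun x => f x + g x)
| Smooth_mul f g : smooth_term f -> smooth_term g -> smooth_term (fun x => f x * g x)
| Smooth_inv f : smooth_term f -> (forall x, f x != 0) -> smooth_term (fun x => (f x)^-1)
| Smooth_flat m f : smooth_term f -> smooth_term (fun x => flat m (f x)).

Lemma iter_derive_rcons vs v (f : V -> R) :
  iter_derive (rcons vs v) f = iter_derive vs (fun x => 'D_v f x).
Proof. by rewrite /iter_derive foldr_rcons. Qed.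

Lemma smooth_derive v (f : V -> R) : smooth f -> smooth (fun x => 'D_v f x).
Proof. by move=> sf vs; rewrite -iter_derive_rcons; exact: sf. Qed.

(** Restriction to the line [h *: v + x] reduces this to the chain rule in one variable, so a
    derivative of [f] in the single direction [v] suffices. *)
Lemma is_derive_comp1 (e : R -> R) (f : V -> R) (x v : V) (a b : R) :
  is_derive (f x) (1 : R) e a -> is_derive x v f b ->
  is_derive x v (fun y => e (f y)) (a * b).
Proof.
move=> de df.
have d1 : is_derive (0 : R) (1 : R) (fun h : R => f (h *: v + x)) b.
  apply: is_derive_cvg; case: df => df <-.
  have -> : (fun h : R => h^-1 *: (f ((h *: (1 : R) + 0) *: v + x) - f (0 *: v + x))) =
    (fun h : R => h^-1 *: (f (h *: v + x) - f x)).
    by rewrite funeqE => h; rewrite addr0 scale0r add0r [_ *: 1]mulr1.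
  exact: df.
have d2 : is_derive ((fun h : R => f (h *: v + x)) 0) (1 : R) e a by rewrite /= scale0r add0r.
have [H1 H2] := is_derive1_comp d2 d1.
apply: is_derive_cvg; rewrite -H2.
have -> : (fun h : R => h^-1 *: (e (f (h *: v + x)) - e (f x))) =
   (fun h : R => h^-1 *: ((e \o (fun h : R => f (h *: v + x))) (h *: (1 : R) + 0) - (e \o (fun h : R => f (h *: v + x))) 0)).
  by rewrite funeqE => h /=; rewrite addr0 scale0r add0r [_ *: 1]mulr1.
exact: H1.
Qed.

Lemma smooth_term_step f : smooth_term f -> continuous f /\
  forall v, exists2 g, smooth_term g & forall x, is_derive x v f (g x).
Proof.
elim=> {f}.
- move=> f sf; split; first by have [] := sf [::].
  move=> v; exists (fun x => 'D_v f x); first exact/Smooth_base/smooth_derive.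
  by move=> x; apply: derivableP; have [_] := sf [::]; exact.
- move=> c; split; first exact: cst_continuous.
  move=> v; exists (fun=> 0); first exact: Smooth_cst.
  by move=> x; exact: is_derive_cst.
- move=> i; split; first exact: coord_continuous.
  move=> v; exists (fun=> v ord0 i); first exact: Smooth_cst.
  move=> x; apply: is_derive_cvg.
  apply: cvg_near_cst; near=> h.
  have h0 : h != 0 by near: h; exact: nbhs_dnbhs_neq.
  by rewrite !mxE addrK /GRing.scale/= mulKf.
- move=> f g sf [cf df] sg [cg dg]; split.
    by move=> x; apply: (@continuousD R R V f g x); [exact: cf|exact: cg].
  move=> v; have [f' sf' ff'] := df v; have [g' sg' gg'] := dg v.
  exists (fun x => f' x + g' x); first exact: Smooth_add.
  by move=> x; exact: is_deriveD.
- move=> f g sf [cf df] sg [cg dg]; split.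
    by move=> x; apply: (@continuousM R V f g x); [exact: cf|exact: cg].
  move=> v; have [f' sf' ff'] := df v; have [g' sg' gg'] := dg v.
  exists (fun x => f x * g' x + g x * f' x).
    by apply: Smooth_add; exact: Smooth_mul.
  by move=> x; exact: is_deriveM.
- move=> f sf [cf df] f0; split.
    by move=> x; apply: (@continuousV R V f x) => //; exact: cf.
  move=> v; have [f' sf' ff'] := df v.
  exists (fun x => -1 * ((f x)^-1 * (f x)^-1) * f' x).
    do 2! apply: Smooth_mul => //; first exact: Smooth_cst.
    by apply: Smooth_mul; exact: Smooth_inv.
  move=> x; have [dfx dfxE] := ff' x; apply: DeriveDef; first exact: derivableV.
  rewrite deriveV// dfxE /GRing.scale/= mulN1r -invfM -expr2; congr (_ * _).
- move=> m f sf [cf df]; split.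
    move=> x; apply: continuous_comp; first exact: cf.
    have := is_derive_flat m (f x) => -[] /derivable1_diffP d _.
    exact: differentiable_continuous.
  move=> v; have [f' sf' ff'] := df v.
  exists (fun x => (flat m.+2 (f x) + (- m%:R) * flat m.+1 (f x)) * f' x).
    apply: Smooth_mul => //; apply: Smooth_add; first exact: Smooth_flat.
    by apply: Smooth_mul; [exact: Smooth_cst|exact: Smooth_flat].
  move=> x; apply: is_derive_comp1 => //; rewrite mulNr; exact: is_derive_flat.
Unshelve. all: by end_near. Qed.

Lemma smooth_term_smooth f : smooth_term f -> smooth f.
Proof.
move=> sf vs.
suff /smooth_term_step[cg dg] : smooth_term (iter_derive vs f).
  by split => // v x; have [g _ /(_ x)[]] := dg v.
elim: vs => //= v vs /smooth_term_step[_ /(_ v)[g sg dg]].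
rewrite (_ : (fun x => _) = g)//; apply/funext => x.
by have [_] := dg x.
Qed.

Implicit Types f g : V -> R.

Lemma smooth_cst (c : R) : smooth (fun _ : V => c).
Proof. by apply: smooth_term_smooth; exact: Smooth_cst. Qed.

Lemma smoothD f g : smooth f -> smooth g -> smooth (fun x => f x + g x).
Proof. by move=> *; apply: smooth_term_smooth; apply: Smooth_add; exact: Smooth_base. Qed.

Lemma smoothM f g : smooth f -> smooth g -> smooth (fun x => f x * g x).
Proof. by move=> *; apply: smooth_term_smooth; apply: Smooth_mul; exact: Smooth_base. Qed.

Lemma smoothZ (c : R) f : smooth f -> smooth (fun x => c * f x).
Proof. by move=> ?; apply: smoothM => //; exact: smooth_cst. Qed.

Lemma smoothN f : smooth f -> smooth (fun x => - f x).
Proof.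
move=> sf; have := smoothZ (-1) sf; congr smooth.
by apply/funext => x; rewrite mulN1r.
Qed.

Lemma smoothB f g : smooth f -> smooth g -> smooth (fun x => f x - g x).
Proof. by move=> sf sg; exact: smoothD sf (smoothN sg). Qed.

Lemma smooth_inv f : smooth f -> (forall x, f x != 0) -> smooth (fun x => (f x)^-1).
Proof. by move=> *; apply: smooth_term_smooth; apply: Smooth_inv => //; exact: Smooth_base. Qed.

Lemma smooth_continuous f : smooth f -> continuous f.
Proof. by move=> sf; have [] := sf [::]. Qed.

Lemma smooth_derivable f x v : smooth f -> derivable f x v.
Proof. by move=> sf; have [_] := sf [::]; exact. Qed.

Lemma smooth_prod (I : Type) (s : seq I) (F : I -> V -> R) :
  (forall i, smooth (F i)) -> smooth (fun x => \prod_(i <- s) F i x).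
Proof.
move=> sF; elim: s => [|i s IH].
  have := smooth_cst 1; congr smooth; apply/funext => x; by rewrite big_nil.
have := smoothM (sF i) IH; congr smooth; apply/funext => x; by rewrite big_cons.
Qed.

Lemma near_continuous f g (x : V) :
  (\forall y \near x, f y = g y) -> {for x, continuous g} -> {for x, continuous f}.
Proof.
move=> fg cg; rewrite /prop_for /continuous_at (nbhs_singleton fg).
have gf : {near nbhs x, g =1 f} by apply: filterS fg => y ->.
exact: cvg_trans (near_eq_cvg gf) cg.
Qed.

(** Iterated derivatives depend on germs only. This handles functions defined by cases, such as a
    product with cutoffs inside [U] extended by zero. *)
Lemma smooth_local (f : V -> R) :
  (forall x : V, exists2 g, smooth g & \forall y \near x, f y = g y) -> smooth f.
Proof.
move=> H.
have near_iter vs (g : V -> R) (x : V) : (\forall y \near x, f y = g y) ->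
    \forall y \near x, iter_derive vs f y = iter_derive vs g y.
  move=> fg; elim: vs => //= v vs.
  move=> /nbhs_interior; apply: filterS => y fgy; exact: near_eq_derive.
move=> vs; split.
  move=> x; have [g sg fg] := H x; have [cg _] := sg vs.
  by apply: (@near_continuous _ (iter_derive vs g)) (cg x); exact: near_iter.
move=> v x; have [g sg fg] := H x; have [_ dg] := sg vs.
apply: (near_eq_derivable _ (dg v x)).
by apply: filterS (near_iter vs g x fg) => y ->.
Qed.
End smooth_functions.

(** * Test functions and cutoffs *)

Section test_functions.
Context {R : realType} {N : nat}.
Notation V := 'rV[R]_N.
Implicit Types (f g : V -> R) (U : set V).

Definition cbox (c : V) (r : R) : set V := [set x | forall i, `|x ord0 i - c ord0 i| <= r].

Lemma compact_cbox (c : V) r : compact (cbox c r).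
Proof.
have -> : cbox c r = [set x : V | forall i, `[c ord0 i - r, c ord0 i + r]%classic (x ord0 i)].
  by rewrite predeqE => x; split => H i; have := H i; rewrite /= in_itv/= distrC ler_distlC.
have H (i : 'I_N) : compact `[c ord0 i - r, c ord0 i + r]%classic by exact: segment_compact.
exact: rV_compact H.
Qed.

Lemma obox_cbox (c : V) r : obox c r `<=` cbox c r.
Proof. by move=> x xc i; exact/ltW. Qed.

Lemma sub_obox (c : V) (r s : R) : r <= s -> obox c r `<=` obox c s.
Proof. by move=> rs x xc i; exact: lt_le_trans rs. Qed.

Lemma test_smooth U f : test_fun U f -> smooth f.
Proof. by case. Qed.

Lemma test_sub U W f : U `<=` W -> test_fun U f -> test_fun W f.
Proof.
by move=> UW [sf [K [cK [KU f0]]]]; split => //; exists K; split => //; split => //; exact: subset_trans UW.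
Qed.

Lemma test0 U : test_fun U (fun _ : V => 0).
Proof.
by split; [exact: smooth_cst|exists set0; split; [exact: compact0|split]].
Qed.

Lemma testD U f g : test_fun U f -> test_fun U g -> test_fun U (fun x => f x + g x).
Proof.
move=> [sf [K [cK [KU f0]]]] [sg [L [cL [LU g0]]]]; split; first exact: smoothD.
exists (K `|` L); split; first exact: compactU.
split; first by rewrite subUset.
by move=> x /not_orP[nK nL]; rewrite f0// g0// addr0.
Qed.

Lemma testMr U f g : test_fun U f -> smooth g -> test_fun U (fun x => f x * g x).
Proof.
move=> [sf [K [cK [KU f0]]]] sg; split; first exact: smoothM.
by exists K; split => //; split => // x xK; rewrite f0// mul0r.
Qed.

Lemma testMl U f g : smooth f -> test_fun U g -> test_fun U (fun x => f x * g x).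
Proof.
move=> sf tg; have := testMr tg sf; congr test_fun.
by apply/funext => x; rewrite mulrC.
Qed.

Lemma testZ U (c : R) f : test_fun U f -> test_fun U (fun x => c * f x).
Proof. by move=> tf; apply: testMl => //; exact: smooth_cst. Qed.

Lemma testN U f : test_fun U f -> test_fun U (fun x => - f x).
Proof.
move=> tf; have := testZ (-1) tf; congr test_fun.
by apply/funext => x; rewrite mulN1r.
Qed.

Lemma testB U f g : test_fun U f -> test_fun U g -> test_fun U (fun x => f x - g x).
Proof. by move=> tf tg; exact: testD tf (testN tg). Qed.

Lemma derive_support f (K : set V) v x : closed K -> (forall x, ~ K x -> f x = 0) ->
  ~ K x -> 'D_v f x = 0.
Proof.
move=> cK f0 nK.
have E : \forall y \near x, f y = (fun=> 0) y.
  have : nbhs x (~` K) by apply: open_nbhs_nbhs; split => //; exact: closed_openC.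
  by apply: filterS => y /f0.
by rewrite (near_eq_derive _ E) (@derive_cst R V R 0).
Qed.

Lemma test_derive U f v : test_fun U f -> test_fun U (fun x => 'D_v f x).
Proof.
move=> [sf [K [cK [KU f0]]]]; split; first exact: smooth_derive.
exists K; split => //; split => // x nK.
exact: (@derive_support f K v x (compact_closed _ cK) f0 nK).
Qed.

Lemma test_bounded U f : test_fun U f -> exists2 c : R, 0 <= c & forall x, `|f x| <= c.
Proof.
move=> [sf [K [cK [_ f0]]]].
have cf : continuous (fun x => `|f x|).
  move=> x; apply: (@continuous_comp _ _ _ f (fun y : R => `|y|)); last exact: norm_continuous.
  exact: smooth_continuous.
have [K0|K0] := eqVneq K set0.
  by exists 0 => // x; rewrite f0 ?normr0// K0.
have [] := @compact_EVT_max V R (fun x => `|f x|) K _ cK _.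
- exact/set0P.
- exact: continuous_subspaceT.
move=> c _ cmax; exists `|f c| => // x.
have [Kx|nKx] := pselect (K x); first by apply: cmax; rewrite inE.
by rewrite f0// normr0.
Qed.

Lemma smooth_deriveD f g x v : smooth f -> smooth g ->
  'D_v (fun y => f y + g y) x = 'D_v f x + 'D_v g x.
Proof.
move=> sf sg; have df := derivableP (@smooth_derivable _ _ f x v sf).
have dg := derivableP (@smooth_derivable _ _ g x v sg).
by have [_] : is_derive x v (fun y => f y + g y) ('D_v f x + 'D_v g x) by exact: is_deriveD.
Qed.

Lemma smooth_deriveM f g x v : smooth f -> smooth g ->
  'D_v (fun y => f y * g y) x = f x * 'D_v g x + g x * 'D_v f x.
Proof.
move=> sf sg; have df := derivableP (@smooth_derivable _ _ f x v sf).
have dg := derivableP (@smooth_derivable _ _ g x v sg).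
by have [_] : is_derive x v (fun y => f y * g y) (f x * 'D_v g x + g x * 'D_v f x)
  by exact: is_deriveM.
Qed.

Lemma smooth_deriveZ (c : R) f x v : smooth f -> 'D_v (fun y => c * f y) x = c * 'D_v f x.
Proof.
move=> sf; rewrite smooth_deriveM//; last exact: smooth_cst.
by rewrite (@derive_cst R V R c) mulr0 addr0.
Qed.

(** The selected indices form a list without repetitions, so that finite sums over them stay below
    sums over the whole cover. *)
Lemma finite_box_cover (I : choiceType) (K : set V) (D : set I) (c : I -> V) (r : I -> R) :
  compact K -> (forall i, D i -> 0 < r i) ->
  K `<=` \bigcup_(i in D) obox (c i) (r i) ->
  exists s : seq I, [/\ uniq s, forall i, i \in s -> D i &
    forall x, K x -> exists2 i, i \in s & obox (c i) (r i) x].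
Proof.
move=> cK r0 KD; have : cover_compact K by rewrite -compact_cover.
move=> /(_ I D (fun i => obox (c i) (r i))) [].
- by move=> i Di; apply: open_obox; exact: r0.
- exact: KD.
move=> D' D'D KD'; exists (finmap.enum_fset D'); split.
- exact: finmap.fset_uniq.
- by move=> i /D'D; rewrite inE.
- by move=> x /KD'[i /= iD' xi]; exists i.
Qed.
End test_functions.

(** * Cutoffs for boxes and for compact sets *)

Section cutoff.
Context {R : realType} {N : nat}.
Notation V := 'rV[R]_N.

(** A smooth even step: the numerator vanishes for [t^2 >= 4], the second term of the denominator
    for [t^2 <= 1], and the two never vanish together. Evenness will make the mollifier
    symmetric. *)
Definition bump1 (t : R) : R := flat 0 (4 - t ^+ 2) / (flat 0 (4 - t ^+ 2) + flat 0 (t ^+ 2 - 1)).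

Let den_gt0 (t : R) : 0 < flat 0 (4 - t ^+ 2) + flat 0 (t ^+ 2 - 1).
Proof.
have [t1|t1] := ltP 1 (t ^+ 2).
  by rewrite ltr_wpDl ?flat_ge0// flat_gt0 subr_gt0.
by rewrite ltr_pwDl ?flat_ge0// flat_gt0 subr_gt0 (le_lt_trans t1)// ltr1n.
Qed.

Lemma bump1_ge0 t : 0 <= bump1 t.
Proof. by rewrite divr_ge0 ?flat_ge0// ltW. Qed.

Lemma bump1_le1 t : bump1 t <= 1.
Proof. by rewrite ler_pdivrMr// mul1r lerDl flat_ge0. Qed.

Lemma bump1_eq1 t : `|t| <= 1 -> bump1 t = 1.
Proof.
move=> t1; rewrite /bump1 [X in _ / (_ + X)]flat_eq0; last first.
  by rewrite subr_le0 -real_normK ?num_real// expr_le1.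
rewrite addr0 divff// gt_eqF// flat_gt0 subr_gt0 -real_normK ?num_real//.
by rewrite (@le_lt_trans _ _ 1) ?ltr1n// expr_le1.
Qed.

Lemma bump1_eq0 t : 2 <= `|t| -> bump1 t = 0.
Proof.
move=> t2; rewrite /bump1 flat_eq0 ?mul0r// subr_le0 -real_normK ?num_real//.
by rewrite (_ : 4 = 2 ^+ 2 :> R) ?ler_pXn2r ?nnegrE//; ring.
Qed.

Lemma bump1N t : bump1 (- t) = bump1 t.
Proof. by rewrite /bump1 sqrrN. Qed.

Definition obump (c : V) (r : R) (x : V) : R :=
  \prod_(i < N) bump1 (r^-1 * (x ord0 i - c ord0 i)).

Lemma smooth_obump c r : smooth (obump c r).
Proof.
apply: smooth_prod => i; apply: smooth_term_smooth.
have st : smooth_term (fun x : V => (r^-1 * (x ord0 i + - c ord0 i)) ^+ 2).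
  apply: Smooth_mul; (apply: Smooth_mul; [exact: Smooth_cst|apply: Smooth_add; [exact: Smooth_coord|exact: Smooth_cst]]).
have st1 : smooth_term (fun x : V => flat 0 (4 - (r^-1 * (x ord0 i + - c ord0 i)) ^+ 2)).
  apply: Smooth_flat; apply: Smooth_add; first exact: Smooth_cst.
  have := Smooth_mul (Smooth_cst (-1)) st; congr smooth_term.
  by apply/funext => x; rewrite mulN1r.
have st2 : smooth_term (fun x : V => flat 0 ((r^-1 * (x ord0 i + - c ord0 i)) ^+ 2 - 1)).
  by apply: Smooth_flat; apply: Smooth_add => //; exact: Smooth_cst.
apply: Smooth_mul => //; apply: Smooth_inv; first exact: Smooth_add.
by move=> x; rewrite gt_eqF// den_gt0.
Qed.

Lemma obump_ge0 c r x : 0 <= obump c r x.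
Proof. by apply: prodr_ge0 => i _; exact: bump1_ge0. Qed.

Lemma obump_le1 c r x : obump c r x <= 1.
Proof. by apply: prodr_ile1 => i _; rewrite bump1_ge0 bump1_le1. Qed.

Lemma obump_eq1 c r x : 0 < r -> cbox c r x -> obump c r x = 1.
Proof.
move=> r0 xc; apply: big1 => i _; apply: bump1_eq1.
by rewrite normrM gtr0_norm ?invr_gt0// mulrC ler_pdivrMr// mul1r.
Qed.

Lemma obump_eq0 c r x : 0 < r -> ~ obox c (2 * r) x -> obump c r x = 0.
Proof.
move=> r0 /existsNP[i /negP]; rewrite -leNgt => xi.
rewrite /obump (bigD1 i)//= bump1_eq0 ?mul0r//.
by rewrite normrM gtr0_norm ?invr_gt0// mulrC ler_pdivlMr.
Qed.

Lemma obumpN r x : obump 0 r (- x) = obump 0 r x.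
Proof.
by apply: eq_bigr => i _; rewrite !mxE !subr0 mulrN bump1N.
Qed.

Lemma obump_scale c r x : obump c r x = obump 0 1 (r^-1 *: (x - c)).
Proof. by apply: eq_bigr => i _; rewrite !mxE invr1 mul1r subr0. Qed.

Lemma test_obump c r : 0 < r -> test_fun setT (obump c r).
Proof.
move=> r0; split; first exact: smooth_obump.
exists (cbox c (2 * r)); split; first exact: compact_cbox.
split => // x xc; apply: obump_eq0 => //; apply: contra_not xc; exact: obox_cbox.
Qed.

Lemma is_derive_scale (f : V -> R) (c v x : V) (a : R) : (forall y, derivable f y v) ->
  is_derive x v (fun y => f (a *: (y - c))) (a * 'D_v f (a *: (x - c))).
Proof.
move=> df.
have d1 : is_derive (0 : R) (1 : R) (fun h : R => f (h *: v + a *: (x - c))) ('D_v f (a *: (x - c))).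
  apply: is_derive_cvg.
  have -> : (fun h : R => h^-1 *: (f ((h *: (1 : R) + 0) *: v + a *: (x - c)) - f (0 *: v + a *: (x - c)))) =
    (fun h : R => h^-1 *: (f (h *: v + a *: (x - c)) - f (a *: (x - c)))).
    by rewrite funeqE => h; rewrite addr0 scale0r add0r [_ *: 1]mulr1.
  exact: df.
have d2 : is_derive (0 : R) (1 : R) ( *%R a) a.
  by apply: is_derive_eq; rewrite [_ *: 1]mulr1.
have d1' : is_derive (a * 0) (1 : R) (fun h : R => f (h *: v + a *: (x - c))) ('D_v f (a *: (x - c))).
  by rewrite mulr0.
have [H1 H2] := is_derive1_comp d1' d2.
rewrite mulrC -H2; apply: is_derive_cvg.
have -> : (fun h : R => h^-1 *: (f (a *: (h *: v + x - c)) - f (a *: (x - c)))) =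
  (fun h : R => h^-1 *: (((fun h : R => f (h *: v + a *: (x - c))) \o  *%R a) (h *: (1 : R) + 0) -
    ((fun h : R => f (h *: v + a *: (x - c))) \o  *%R a) 0)).
  apply/funext => h /=; rewrite mulr0 scale0r add0r addr0 [_ *: 1]mulr1.
  have -> : a *: (h *: v + x - c) = (a * h) *: v + a *: (x - c).
    by rewrite -scalerA -scalerDr addrA.
  by [].
exact: H1.
Qed.

Lemma derive_scale (f : V -> R) (c v x : V) (a : R) : (forall y, derivable f y v) ->
  'D_v (fun y => f (a *: (y - c))) x = a * 'D_v f (a *: (x - c)).
Proof. by move=> df; have [_ ->] := @is_derive_scale f c v x a df. Qed.

(** Rescaling reduces every cutoff to the unit one, so [C] depends neither on the centre nor on the
    radius. *)
Lemma obump_derive_bound (v : V) : exists2 C : R, 0 <= C &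
  forall c r x, 0 < r -> `|'D_v (obump c r) x| <= C / r.
Proof.
have [C C0 HC] := test_bounded (test_derive v (test_obump 0 ltr01)).
exists C => // c r x r0.
rewrite (_ : obump c r = fun y => obump 0 1 (r^-1 *: (y - c))); last first.
  by apply/funext => y; exact: obump_scale.
rewrite derive_scale; last by move=> y; exact: smooth_derivable (smooth_obump _ _).
by rewrite normrM gtr0_norm ?invr_gt0// mulrC ler_wpM2r// invr_ge0 ltW.
Qed.

(** The support is the closed box of radius [2 * r]; the open box of radius [3 * r] contains it with
    room to spare and serves as the carrier in the error estimates. *)
Lemma obump_derive_eq0 (v c : V) r x : 0 < r -> ~ obox c (3 * r) x -> 'D_v (obump c r) x = 0.
Proof.
move=> r0 xc; apply: (@derive_support _ _ _ (cbox c (2 * r))).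
- by apply: compact_closed => //; exact: compact_cbox.
- move=> y yc; apply: obump_eq0 => //; apply: contra_not yc; exact: obox_cbox.
- apply: contra_not xc => xc i; rewrite (le_lt_trans (xc i))// ltr_pM2r//.
  by rewrite ltr_nat.
Qed.

(** One minus the product of [1 - obump] over a finite cover. It equals 1 on a neighbourhood [W] of
    [K], not merely on [K], so that multiplication by it leaves gradients on [K] unchanged. *)
Lemma exists_cutoff (K O : set V) : compact K -> open O -> K `<=` O ->
  exists theta : V -> R, [/\ test_fun O theta, forall x, 0 <= theta x <= 1 &
    exists W : set V, [/\ open W, K `<=` W & forall x, W x -> theta x = 1]].
Proof.
move=> cK oO KO.
have /choice[r rP] : forall x : V, exists r : R, 0 < r /\ (K x -> obox x (3 * r) `<=` O).
  move=> x; have [Kx|nKx] := pselect (K x); last by exists 1.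
  have /nbhs_obox[r r0 rO] := open_nbhs_nbhs (conj oO (KO _ Kx)).
  by exists (r / 3); rewrite divr_gt0//; split => // _; rewrite mulrCA mulfV// mulr1.
have r0 x : 0 < r x by have [] := rP x.
have [//|x Kx|s [us sK Ks]] := @finite_box_cover R N V K K id r cK.
  by exists x => //; exact: obox_center.
pose theta x := 1 - \prod_(c <- s) (1 - obump c (r c) x).
have prod01 x : 0 <= \prod_(c <- s) (1 - obump c (r c) x) <= 1.
  apply/andP; split.
    by apply: prodr_ge0 => c _; rewrite subr_ge0 obump_le1.
  by apply: prodr_ile1 => c _; rewrite subr_ge0 obump_le1/= gerBl obump_ge0.
exists theta; split.
- split.
    apply: smoothB; first exact: smooth_cst.
    apply: smooth_prod => c; apply: smoothB; first exact: smooth_cst.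
    exact: smooth_obump.
  exists (\big[setU/set0]_(c <- s) cbox c (2 * r c)); split.
    elim/big_rec : _ => [|c A _ cA]; first exact: compact0.
    by apply: compactU => //; exact: compact_cbox.
  split=> x.
    rewrite -bigcup_seq => -[c /= cs xc].
    have [_ /(_ (sK _ cs))] := rP c; apply => i.
    by rewrite (le_lt_trans (xc i))// ltr_pM2r// ltr_nat.
  move=> xs; rewrite /theta big_seq big1 ?subrr// => c cs.
  rewrite obump_eq0 ?subr0// => xc; apply: xs; rewrite -bigcup_seq.
  by exists c => //; exact: obox_cbox.
- by move=> x; rewrite subr_ge0 gerBl; move: (prod01 x) => /andP[-> ->].
- exists (\bigcup_(c in [set` s]) obox c (r c)); split.
  + by apply: bigcup_open => c _; exact: open_obox.
  + by move=> x /Ks[c cs xc]; exists c.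
  + move=> x [c /= cs xc]; rewrite /theta (big_rem c)//= obump_eq1//.
      by rewrite subrr mul0r subr0.
    exact: obox_cbox.
Qed.
End cutoff.

(** * Riesz representation *)

Section integrability.
Context {R : realType} {N : nat}.
Notation V := 'rV[R]_N.
Notation B := (@BorelRN R N).

Lemma bounded_by_integrable d (T : measurableType d) (mu : {measure set T -> \bar R})
    (A : set T) (f : T -> R) (c : R) : measurable A -> (mu A < +oo)%E ->
  measurable_fun A f -> (forall x, A x -> `|f x| <= c) ->
  mu.-integrable A (EFin \o f).
Proof.
move=> mA Afin mf fc; apply: measurable_bounded_integrable => //.
exists c; split; first exact: num_real.
by move=> M cM x Ax /=; rewrite (le_trans (fc x Ax))// ltW.
Qed.

Lemma test_measurable (D : set B) U (f : V -> R) : measurable D -> test_fun U f ->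
  measurable_fun D (f : B -> R).
Proof.
by move=> mD [sf _]; apply: continuous_borelRN_measurable => //; exact: smooth_continuous.
Qed.

Lemma test_integrable_fin (mu : {measure set B -> \bar R}) (D : set B) U (f : V -> R) :
  measurable D -> (mu D < +oo)%E -> test_fun U f -> mu.-integrable D (EFin \o f).
Proof.
move=> mD muD tf; have [c c0 fc] := test_bounded tf.
by apply: (@bounded_by_integrable _ B mu D f c) => //; exact: test_measurable tf.
Qed.
End integrability.

Section nonneg_series.
Local Open Scope ereal_scope.
Context {R : realType}.

Lemma nneseries_le_bound (a : nat -> \bar R) M : (forall k, 0 <= a k) ->
  (forall n, \sum_(k < n) a k <= M) -> \sum_(0 <= k <oo) a k <= M.
Proof.
move=> a0 aM; apply: lime_le; first exact: is_cvg_nneseries.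
by near=> n; rewrite big_mkord; exact: aM.
Unshelve. all: by end_near. Qed.

Lemma nneseries_ge_partial (a : nat -> \bar R) n : (forall k, 0 <= a k) ->
  \sum_(k < n) a k <= \sum_(0 <= k <oo) a k.
Proof.
by move=> a0; rewrite -(big_mkord xpredT); apply: nneseries_lim_ge => k _ _; exact: a0.
Qed.
End nonneg_series.

(** The sum counts the naturals below [t], that is, it rounds [t] up; [t <= n%:R] ensures that none
    of them is cut off. *)
Lemma layer_sum {R : realType} (t : R) n : 0 <= t -> t <= n%:R ->
  t <= \sum_(k < n) (k%:R < t)%R%:R <= t + 1.
Proof.
move=> t0 tn; apply/andP; split.
  elim: n tn => [|n IH] tn; first by rewrite big_ord0.
  have [nt|] := ltP n%:R t; last by move=> /IH; rewrite big_ord_recr/= => /le_trans; apply; rewrite lerDl.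
  rewrite (eq_bigr (fun=> 1)); first by rewrite sumr_const card_ord.
  move=> k _; rewrite (le_lt_trans _ nt)// ler_nat -ltnS; exact: ltn_ord.
elim: n {tn} => [|n IH]; first by rewrite big_ord0 addr_ge0.
rewrite big_ord_recr/=; have [nt|_] := ltP n%:R t; last by rewrite addr0.
rewrite lerD2r (le_trans _ (ltW nt))//.
rewrite -[leRHS](_ : \sum_(k < n) 1 = n%:R); first by apply: ler_sum => k _; case: (_ < _).
by rewrite sumr_const card_ord.
Qed.

(** * Positive functionals on nonnegative test functions *)

Section daniell.
Context {R : realType} {N : nat}.
Notation V := 'rV[R]_N.
Notation B := (@BorelRN R N).

(** Positive functionals are given on this cone because the positive part of a signed functional is
    formed there. *)
Definition nntest (f : V -> R) := test_fun setT f /\ forall x, 0 <= f x.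

Lemma nntest0 : nntest (fun=> 0).
Proof. by split => //; exact: test0. Qed.

Lemma nntestD f g : nntest f -> nntest g -> nntest (fun x => f x + g x).
Proof. by move=> [tf f0] [tg g0]; split => [|x]; [exact: testD|exact: addr_ge0]. Qed.

Lemma nntestB f g : nntest f -> nntest g -> (forall x, g x <= f x) -> nntest (fun x => f x - g x).
Proof. by move=> [tf f0] [tg g0] gf; split => [|x]; [exact: testB|rewrite subr_ge0]. Qed.

Lemma nntestZ (c : R) f : 0 <= c -> nntest f -> nntest (fun x => c * f x).
Proof. by move=> c0 [tf f0]; split => [|x]; [exact: testZ|exact: mulr_ge0]. Qed.

Lemma nntestM f g : nntest f -> smooth g -> (forall x, 0 <= g x) -> nntest (fun x => f x * g x).
Proof. by move=> [tf f0] sg g0; split => [|x]; [exact: testMr|exact: mulr_ge0]. Qed.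

Lemma nntest_sum (s : nat -> V -> R) n : (forall k, nntest (s k)) ->
  nntest (fun x => \sum_(k < n) s k x).
Proof.
move=> ns; elim: n => [|n IH].
  have := nntest0; congr nntest; apply/funext => x; by rewrite big_ord0.
have := nntestD IH (ns n); congr nntest; apply/funext => x; by rewrite big_ord_recr.
Qed.

Variable P : (V -> R) -> R.
Hypothesis P_ge0 : forall f, nntest f -> 0 <= P f.
Hypothesis PD : forall f g, nntest f -> nntest g -> P (fun x => f x + g x) = P f + P g.
Hypothesis PZ : forall (c : R) f, 0 <= c -> nntest f -> P (fun x => c * f x) = c * P f.
Variable C : R.
Hypothesis P_bounded : forall f, nntest f -> (forall x, f x <= 1) -> P f <= C.

Let P0 : P (fun=> 0) = 0.
Proof.
have := PZ (lexx 0) nntest0.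
have -> : (fun x : V => 0 * (fun _ : V => 0 : R) x) = (fun=> 0).
  by apply/funext => x; rewrite mul0r.
by rewrite mul0r.
Qed.

Let PB f g : nntest f -> nntest g -> (forall x, g x <= f x) ->
  P (fun x => f x - g x) = P f - P g.
Proof.
move=> nf ng gf; apply/eqP; rewrite eq_sym subr_eq -PD//; last exact: nntestB.
by apply/eqP; congr P; apply/funext => x; rewrite subrK.
Qed.

Let leP_ f g : nntest f -> nntest g -> (forall x, g x <= f x) -> P g <= P f.
Proof. by move=> nf ng gf; rewrite -subr_ge0 -PB// P_ge0//; exact: nntestB. Qed.

Let P_sum (s : nat -> V -> R) n : (forall k, nntest (s k)) ->
  P (fun x => \sum_(k < n) s k x) = \sum_(k < n) P (s k).
Proof.
move=> ns; elim: n => [|n IH].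
  by rewrite big_ord0 -[RHS]P0; congr P; apply/funext => x; rewrite big_ord0.
rewrite big_ord_recr/= -IH -PD//; last exact: nntest_sum.
by congr P; apply/funext => x; rewrite big_ord_recr.
Qed.

Let piece := {f : V -> R | nntest f}.
Let cost (p : piece) : \bar R := (P (sval p))%:E.
Let prof (p : piece) (x : V) : \bar R := (sval p x)%:E.
Let p0 : piece := exist _ (fun=> 0) nntest0.

Let cost_ge0 p : (0 <= cost p)%E.
Proof. by rewrite lee_fin; apply: P_ge0; case: p. Qed.

Let prof_ge0 p x : (0 <= prof p x)%E.
Proof. by rewrite lee_fin; case: p => f []. Qed.

Let cost0 : cost p0 = 0%E.
Proof. by rewrite /cost/= P0. Qed.

Let mo (A : set V) : \bar R := gauge_measure cost prof A.
HB.instance Definition _ := isOuterMeasure.Build R V mo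
  (gauge_measure0 cost_ge0 prof_ge0 cost0)
  (fun A => gauge_int_ge0 prof cost_ge0 _)
  (@le_gauge_measure _ _ _ cost prof)
  (gauge_measure_sigma_subadditive cost_ge0 prof_ge0).

(** With [s = flat 0 (c - x_i)] this is [s / (s + 1/(m+1))]: smooth functions that increase with [m]
    to the indicator of the half-space. *)
Let ramp (i : 'I_N) (c : R) (m : nat) (x : V) : R :=
  flat 0 (c - x ord0 i) * (flat 0 (c - x ord0 i) + m.+1%:R^-1)^-1.

Let ramp_den i (c : R) m (x : V) : 0 < flat 0 (c - x ord0 i) + m.+1%:R^-1.
Proof. by rewrite ltr_wpDl ?flat_ge0. Qed.

Let smooth_ramp i c m : smooth (ramp i c m).
Proof.
have st : smooth_term (fun x : V => flat 0 (c - x ord0 i)).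
  apply: Smooth_flat; apply: Smooth_add; first exact: Smooth_cst.
  have := Smooth_mul (Smooth_cst (-1)) (@Smooth_coord R N i); congr smooth_term.
  by apply/funext => x; rewrite mulN1r.
apply: smooth_term_smooth; apply: Smooth_mul => //; apply: Smooth_inv.
  by apply: Smooth_add => //; exact: Smooth_cst.
by move=> x; rewrite gt_eqF.
Qed.

Let ramp_ge0 i c m x : 0 <= ramp i c m x.
Proof. by rewrite /ramp divr_ge0 ?flat_ge0// ltW. Qed.

Let ramp_le1 i c m x : ramp i c m x <= 1.
Proof. by rewrite /ramp ler_pdivrMr// mul1r lerDl. Qed.

Let ramp_le i c m x : ramp i c m x <= ramp i c m.+1 x.
Proof.
rewrite /ramp ler_wpM2l ?flat_ge0// lef_pV2 ?posrE// lerD2l.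
by rewrite lef_pV2 ?posrE// ler_nat.
Qed.

Let ramp_out i c m x : ~ halfspace i c x -> ramp i c m x = 0.
Proof. by move=> /negP; rewrite -leNgt => cx; rewrite /ramp flat_eq0 ?mul0r// subr_le0. Qed.

Let ramp_in i c x (e : R) : halfspace i c x -> 0 < e ->
  exists m, 1 - ramp i c m x < e.
Proof.
move=> xc e0; have s0 : 0 < flat 0 (c - x ord0 i) by rewrite flat_gt0 subr_gt0.
have [m] := @ltr_add_invr R 0 (e * flat 0 (c - x ord0 i)) (mulr_gt0 e0 s0).
rewrite add0r => me; exists m.
rewrite /ramp -[X in X - _](mulfV (lt0r_neq0 (ramp_den i c m x))) -mulrBl addrAC subrr add0r.
rewrite ltr_pdivrMr// (lt_trans me)// mulrDr ltrDl.
by rewrite mulr_gt0// invr_gt0.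
Qed.

(** Inside the half-space [f] is covered by the telescoping pieces [f * (ramp k.+1 - ramp k)], of
    total cost at most [sup E]. Outside, where the ramps vanish, it is covered by [f * (1 - ramp m)]
    with [m] chosen so that [P (f * ramp m)] is within [e] of [sup E]. The costs add up to at most
    [P f + e]. *)
Let mo_caratheodory i c : mo.-caratheodory (halfspace i c).
Proof.
apply: (gauge_caratheodory cost_ge0 prof_ge0) => // -[f nf] e e0.
pose E := [set P (fun x => f x * ramp i c m x) | m in [set: nat]].
have nfr m : nntest (fun x => f x * ramp i c m x) by exact: nntestM.
have supE : has_sup E.
  split; first by exists (P (fun x => f x * ramp i c 0 x)); exists 0%N.
  exists (P f) => _ [m _ <-]; apply: leP_ => // x.
  by rewrite ler_piMr//; case: nf.
have [_ [m _ <-] Pm] := sup_adherent e0 supE.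
have nfB g g' : smooth g -> smooth g' -> (forall x, g' x <= g x) ->
    nntest (fun x => f x * (g x - g' x)).
  by move=> sg sg' gg'; apply: nntestM; [exact: nf|exact: smoothB|move=> x; rewrite subr_ge0].
have nv : nntest (fun x => f x * (1 - ramp i c m x)).
  by apply: (nfB (fun=> 1)) => //; exact: smooth_cst.
have nu k : nntest (fun x => f x * (ramp i c k.+1 x - ramp i c k x)) by exact: nfB.
pose u k : piece := if k is k'.+1 then exist _ _ (nu k') else exist _ _ (nfr 0%N).
have usum M x : \sum_(k < M.+1) sval (u k) x = f x * ramp i c M x.
  elim: M => [|M IH]; first by rewrite big_ord1.
  by rewrite big_ord_recr/= IH; ring.
have uP M : \sum_(k < M.+1) P (sval (u k)) = P (fun x => f x * ramp i c M x).
  rewrite -(@P_sum (fun k => sval (u k))); last by move=> k; case: (u k).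
  by congr P; apply/funext => x; exact: usum.
exists (exist _ _ nv), u; split.
- by move=> x xc; rewrite /prof/= ramp_out// subr0 mulr1.
- move=> x xc; rewrite /prof/=; apply/lee_addgt0Pr => d d0.
  have fx0 : 0 <= f x by case: nf.
  (* Division by [1 + f x], since [f x] itself may be 0. *)
  have [M HM] := ramp_in xc (divr_gt0 d0 (ltr_pwDl ltr01 fx0)).
  apply: (@le_trans _ _ ((f x * ramp i c M x)%:E + d%:E)%E).
    rewrite -EFinD lee_fin -lerBlDl.
    rewrite -[X in X - _]mulr1 -mulrBr.
    rewrite ltr_pdivlMr in HM; last by rewrite ltr_pwDl.
    apply: ltW; apply: le_lt_trans HM; rewrite mulrC.
    by rewrite ler_wpM2l ?subr_ge0// lerDr.
  rewrite leeD2r// -usum -sumEFin.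
  by apply: nneseries_ge_partial => k; exact: prof_ge0.
- apply: (@le_trans _ _ ((P (fun x => f x * (1 - ramp i c m x)))%:E + (sup E)%:E)%E).
    rewrite leeD2l//; apply: nneseries_le_bound => // -[|M].
      rewrite big_ord0 lee_fin (le_trans (P_ge0 (nfr 0%N)))//.
      by apply: (sup_upper_bound supE); exists 0%N.
    rewrite /cost sumEFin uP lee_fin.
    by apply: (sup_upper_bound supE); exists M.
  rewrite /cost/= -!EFinD lee_fin.
  have -> : P (fun x => f x * (1 - ramp i c m x)) = P f - P (fun x => f x * ramp i c m x).
    rewrite -PB//; first by congr P; apply/funext => x; ring.
    by move=> x; rewrite ler_piMr//; case: nf.
  move: Pm; set a := P _; set b := sup E; set c' := P _; lra.
Qed.

Let m (A : set B) : \bar R := mo A.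

Let m_additive : semi_sigma_additive m.
Proof. exact: caratheodory_semi_sigma_additive mo_caratheodory. Qed.

Let m0 : m set0 = 0%E. Proof. exact: outer_measure0 mo. Qed.
Let m_ge0 A : (0 <= m A)%E. Proof. exact: outer_measure_ge0 mo A. Qed.

HB.instance Definition _ := isMeasure.Build _ B R m m0 m_ge0 m_additive.

(* Dini: on the compact support of [f], finitely many of the [s k] already
   dominate [f] up to [e]. *)
Let daniell_continuous f (s : nat -> piece) : nntest f ->
  (forall x, ((f x)%:E <= \sum_(0 <= k <oo) prof (s k) x)%E) ->
  ((P f)%:E <= \sum_(0 <= k <oo) cost (s k))%E.
Proof.
move=> nf fs; have [[sf [K [cK [_ f0]]]] fge0] := nf.
have ns k : nntest (sval (s k)) by case: (s k).
have [th [tth th01 [W [_ KW thW]]]] := exists_cutoff cK openT (@subsetT _ K).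
have nth : nntest th by split => // x; case/andP: (th01 x).
(* A constant is not a test function, so the slack [e] is carried by a cutoff [th] equal to 1 on the
   support of [f]. *)
suff H (e : R) : 0 < e -> exists n, forall x, f x <= \sum_(k < n) sval (s k) x + e * th x.
  apply/lee_addgt0Pr => e e0.
  have Pth1 : 0 < 1 + P th by rewrite ltr_pwDl// P_ge0.
  have [n Hn] := H (e / (1 + P th)) (divr_gt0 e0 Pth1).
  apply: (@le_trans _ _ (\sum_(k < n) cost (s k) + e%:E)%E); last first.
    by rewrite leeD2r//; exact: nneseries_ge_partial.
  have nZ : nntest (fun x => e / (1 + P th) * th x).
    by apply: nntestZ => //; rewrite divr_ge0// ltW.
  have nS : nntest (fun x => \sum_(k < n) sval (s k) x) by exact: (@nntest_sum (fun k => sval (s k))).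
  rewrite /cost sumEFin -EFinD lee_fin.
  rewrite (le_trans (leP_ (nntestD nS nZ) nf Hn))//.
  rewrite PD// (@P_sum (fun k => sval (s k)))// lerD2l PZ//; last by rewrite divr_ge0// ltW.
  by rewrite mulrAC ler_pdivrMr// ler_wpM2l ?(ltW e0)// lerDr.
move=> e0; pose F n := [set x : V | f x < \sum_(k < n) sval (s k) x + e].
have oF n : open (F n).
  have cg : continuous (fun x : V => \sum_(k < n) sval (s k) x + e - f x).
    have [[sS _] _] := @nntest_sum (fun k => sval (s k)) n ns.
    exact: smooth_continuous (smoothB (smoothD sS (smooth_cst e)) sf).
  have -> : F n = (fun x : V => \sum_(k < n) sval (s k) x + e - f x) @^-1` [set y | 0 < y].
    by rewrite predeqE => x; rewrite /F/= subr_gt0.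
  by move/continuousP : cg; apply; exact: open_gt.
have : cover_compact K by rewrite -compact_cover.
move=> /(_ nat setT F) [].
- by move=> i _; exact: oF.
- move=> x Kx; apply: contrapT => nF.
  have {}nF n : \sum_(k < n) sval (s k) x + e <= f x.
    by rewrite leNgt; apply/negP => ?; apply: nF; exists n.
  have := fs x; apply/negP; rewrite -ltNge.
  apply: (@le_lt_trans _ _ (f x - e)%:E); last by rewrite lte_fin gtrBl.
  apply: nneseries_le_bound => [k|n]; first exact: prof_ge0.
  by rewrite sumEFin lee_fin lerBrDr.
move=> D _ KD.
exists (\max_(i <- finmap.enum_fset D) i)%N => x.
have sle n n' : (n <= n')%N -> \sum_(k < n) sval (s k) x <= \sum_(k < n') sval (s k) x.
  move=> nn'; rewrite -!(big_mkord xpredT (fun k => sval (s k) x)).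
  rewrite (@big_cat_nat _ _ _ n 0%N n')//= lerDl sumr_ge0// => k _.
  by have [] := ns k.
have [Kx|nKx] := pselect (K x); last first.
  rewrite f0// addr_ge0//; last by rewrite mulr_ge0 ?(ltW e0)//; case/andP: (th01 x).
  by apply: sumr_ge0 => k _; have [] := ns k.
have [i /= iD xi] := KD _ Kx.
rewrite (le_trans (ltW xi))// thW ?mulr1; last exact: KW.
by rewrite lerD2r; apply: sle; exact: leq_bigmax_seq.
Qed.

Let E1 := [set P f | f in [set f | nntest f /\ forall x, f x <= 1]].
Let L := sup E1.

Let supE1 : has_sup E1.
Proof.
split; first by exists (P (fun=> 0)); exists (fun=> 0) => //; split => //; exact: nntest0.
by exists C => _ [f [nf f1] <-]; exact: P_bounded.
Qed.

(** The pieces [u k] telescope to [1 - q M], a test function that is at most 1 and equals 1 on ever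
    larger boxes. They cover the whole space, and each partial cost is a competitor in the supremum
    [L]. *)
Let mT : (m setT <= L%:E)%E.
Proof.
pose q M (x : V) : R := \prod_(j < M) (1 - obump (0%R : V) j.+1%:R x).
have q0 M x : 0 <= q M x by apply: prodr_ge0 => j _; rewrite subr_ge0 obump_le1.
have sq M : smooth (q M).
  by apply: smooth_prod => j; apply: smoothB; [exact: smooth_cst|exact: smooth_obump].
have nu k : nntest (fun x => obump (0%R : V) k.+1%:R x * q k x).
  apply: nntestM => //; split; last by move=> x; exact: obump_ge0.
  exact: test_obump.
pose u k : piece := exist _ _ (nu k).
have us M x : \sum_(k < M) sval (u k) x = 1 - q M x.
  elim: M => [|M IH]; first by rewrite big_ord0 /q big_ord0 subrr.
  by rewrite big_ord_recr/= IH /q big_ord_recr/=; ring.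
apply: (@le_trans _ _ (\sum_(0 <= k <oo) cost (u k))%E).
  apply: gauge_int_le => x; rewrite indicT.
  have [M xM] : exists M : nat, obox 0 M.+1%:R x.
    exists (Num.trunc (\sum_i `|x ord0 i|)) => i; rewrite mxE subr0.
    apply: le_lt_trans (truncnS_gt _).
    by rewrite (bigD1 i)//= lerDl sumr_ge0.
  apply: le_trans (@nneseries_ge_partial _ _ M.+1 _); last by move=> k; exact: prof_ge0.
  rewrite /prof sumEFin us lee_fin /q big_ord_recr/= obump_eq1//; last exact: obox_cbox.
  by rewrite subrr mulr0 subr0.
apply: nneseries_le_bound => // M.
rewrite /cost sumEFin -(@P_sum (fun k => sval (u k)))// lee_fin.
apply: (sup_upper_bound supE1); exists (fun x => \sum_(k < M) sval (u k) x) => //; split.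
  exact: (@nntest_sum (fun k => sval (u k))).
by move=> x; rewrite us gerBl.
Qed.

Let mT_fin : (m setT < +oo)%E. Proof. exact: le_lt_trans mT (ltry _). Qed.

Let J f := \int[m]_x f x.

Let intm f : nntest f -> m.-integrable setT (EFin \o f).
Proof. by move=> [tf _]; exact: test_integrable_fin tf. Qed.

(** By the Dini argument [P f] is at most the gauge of [f], and [f] is at most the sum of the
    indicators of its superlevel sets at integer heights. *)
Let P_le_layers f n : nntest f -> (forall x, f x <= n%:R) ->
  ((P f)%:E <= \sum_(k < n) m [set x | (k%:R < f x)%R])%E.
Proof.
move=> nf fn; apply: (@le_trans _ _ (gauge_int cost prof (fun x => (f x)%:E))).
  by apply: le_ereal_inf_tmp => _ [s fs <-]; exact: daniell_continuous.
apply: (gauge_int_subadditive cost_ge0 prof_ge0 cost0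
  (F := fun k x => (\1_[set x | (k%:R < f x)%R] x)%:E)) => [k x|x].
  by rewrite lee_fin.
rewrite sumEFin lee_fin; have /andP[+ _] := layer_sum (nf.2 x) (fn x).
move=> /le_trans; apply; apply: ler_sum => k _; rewrite indicE.
by case: ltP => kx; [rewrite mem_set|].
Qed.

Let measurable_layer f (a : R) : nntest f -> measurable ([set x | a < f x] : set B).
Proof.
move=> [[sf _] _]; apply: measurable_open.
have /continuousP cf := smooth_continuous sf.
have -> : [set x | a < f x] = f @^-1` [set y | a < y] by [].
by apply: cf; exact: open_gt.
Qed.

(** The integer layers exceed [f] by at most 1, hence the error [m setT]. *)
Let P_le_J1 f : nntest f -> P f <= J f + fine (m setT).
Proof.
move=> nf; have [c c0 fc] := test_bounded nf.1.
pose n := (Num.trunc c).+1.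
have fn x : f x <= n%:R.
  by rewrite (le_trans (ler_norm _))// (le_trans (fc x))// ltW// truncnS_gt.
have JE : (J f)%:E = (\int[m]_x (f x)%:E)%E.
  by rewrite /J /Rintegral fineK//; apply: integrable_fin_num (intm nf).
have mf : @measurable_fun _ _ B (\bar R) setT (EFin \o f).
  by apply/measurable_EFinP; exact: test_measurable nf.1.
rewrite -lee_fin EFinD (le_trans (P_le_layers nf fn))//.
have mfin : m setT \is a fin_num by rewrite ge0_fin_numE.
rewrite JE fineK//.
have mE : m setT = (\int[m]_x (cst 1%:E) x)%E by rewrite integral_cst// mul1e.
rewrite [X in (_ <= _ + X)%E]mE -ge0_integralD//; last first.
  by move=> x _; rewrite lee_fin; case: nf.
have -> : (\sum_(k < n) m [set x | (k%:R < f x)%R])%E =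
    (\int[m]_x (\sum_(k < n) (\1_[set x | (k%:R < f x)%R] x)%:E))%E.
  rewrite ge0_integral_sum//.
    by apply: eq_bigr => k _; rewrite integral_indic// ?setIT//; exact: measurable_layer.
  by move=> k; apply/measurable_EFinP; apply: measurable_indic; exact: measurable_layer.
apply: ge0_le_integral => //.
- by move=> x _; apply: sume_ge0 => k _; rewrite lee_fin.
- apply: emeasurable_sum => k; apply/measurable_EFinP; apply: measurable_indic; exact: measurable_layer.
- by apply: emeasurable_funD => //; exact: measurable_cst.
move=> x _; rewrite sumEFin /= -EFinD lee_fin.
have /andP[_] := layer_sum (nf.2 x) (fn x); apply: le_trans.
apply: ler_sum => k _; rewrite indicE.
by case: ltP => kx; [case: (_ \in _)|rewrite memNset//= => /(le_lt_trans kx); rewrite ltxx].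
Qed.

Let JD f g : nntest f -> nntest g -> J (fun x => f x + g x) = J f + J g.
Proof. by move=> nf ng; rewrite /J RintegralD//; exact: intm. Qed.

Let JZ c f : nntest f -> J (fun x => c * f x) = c * J f.
Proof. by move=> nf; rewrite /J RintegralZl//; exact: intm. Qed.

(* The additive error of [P_le_J1] disappears by homogeneity. *)
Let P_le_J f : nntest f -> P f <= J f.
Proof.
move=> nf; apply/ler_addgt0Pr => e e0.
have eF : 0 < e / (1 + fine (m setT)) by rewrite divr_gt0// ltr_pwDl// fine_ge0.
have [k] := @ltr_add_invr R 0 _ eF.
rewrite add0r => ke.
have := P_le_J1 (nntestZ (ler0n R k.+1) nf).
rewrite PZ// JZ// => H.
have k0 : 0 < k.+1%:R :> R by [].
rewrite -(ler_pM2l k0) mulrDr (le_trans H)// lerD2l.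
have F0 : 0 < 1 + fine (m setT) by rewrite ltr_pwDl// fine_ge0.
rewrite ltr_pdivlMr// in ke.
have : k.+1%:R * (k.+1%:R^-1 * (1 + fine (m setT))) <= k.+1%:R * e.
  by rewrite ler_pM2l// ltW.
by rewrite mulrA mulfV// mul1r; apply: le_trans; rewrite lerDr.
Qed.

Let J_le1 f : nntest f -> (forall x, f x <= 1) -> J f <= L.
Proof.
move=> nf f1; rewrite -lee_fin (le_trans _ mT)//.
rewrite /J /Rintegral fineK//; last by apply: integrable_fin_num (intm nf).
have mE : m setT = (\int[m]_x (cst 1%:E) x)%E by rewrite integral_cst// mul1e.
rewrite mE; apply: ge0_le_integral => //.
- by move=> x _; rewrite lee_fin; case: nf.
- by apply/measurable_EFinP; exact: test_measurable nf.1.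
- by move=> x _; rewrite lee_fin.
Qed.

(** The reverse inequality comes from the complement: [P_le_J] is applied to [(c + 1) * th' - f],
    where [th'] is at most 1 and nearly attains [L]. Since [J th' <= L], the loss is at most
    [(c + 1) * (L - P th')], which is below [e]. *)
Let J_le_P f : nntest f -> J f <= P f.
Proof.
move=> nf; have [c c0 fc] := test_bounded nf.1.
apply/ler_addgt0Pr => e e0.
have c1 : 0 < c + 1 by rewrite ltr_wpDl.
have [_ [th [nth th1] <-]] := sup_adherent (divr_gt0 e0 c1) supE1.
rewrite -/L => Lth.
have [[sf [K [cK [_ f0]]]] fge0] := nf.
have [ka [tka ka01 [W [_ KW kaW]]]] := exists_cutoff cK openT (@subsetT _ K).
have nka : nntest ka by split => // x; case/andP: (ka01 x).
pose th' x := th x + ka x * (1 - th x).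
have nk : nntest (fun x => ka x * (1 - th x)).
  apply: (nntestM nka); last by move=> x; rewrite subr_ge0.
  by apply: smoothB; [exact: smooth_cst|exact: test_smooth nth.1].
have nth' : nntest th' by exact: nntestD.
have th'1 x : th' x <= 1.
  rewrite /th' -lerBrDl ler_piMl ?subr_ge0//; by case/andP: (ka01 x).
have Lth' : L - e / (c + 1) < P th'.
  by rewrite (lt_le_trans Lth)// PD// lerDl P_ge0.
have nZ : nntest (fun x => (c + 1) * th' x) by apply: nntestZ => //; exact: ltW.
have le_f x : f x <= (c + 1) * th' x.
  have [Kx|nKx] := pselect (K x); last first.
    by rewrite f0// mulr_ge0 ?(ltW c1)//; case: nth'.
  rewrite /th' kaW ?mul1r; last exact: KW.
  rewrite addrCA subrr addr0 mulr1 (le_trans (ler_norm _))// (le_trans (fc x))//.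
  by rewrite lerDl.
have nB : nntest (fun x => (c + 1) * th' x - f x) by exact: nntestB.
have J1 : J (fun x => (c + 1) * th' x) = J (fun x => (c + 1) * th' x - f x) + J f.
  by rewrite -JD//; congr J; apply/funext => x; rewrite subrK.
have P1 : P (fun x => (c + 1) * th' x) = P (fun x => (c + 1) * th' x - f x) + P f.
  by rewrite -PD//; congr P; apply/funext => x; rewrite subrK.
have := P_le_J nB; have := J_le1 nth' th'1.
move: J1 P1; rewrite JZ// PZ//; last exact: ltW.
have : (c + 1) * (L - e / (c + 1)) < (c + 1) * P th' by rewrite ltr_pM2l.
rewrite mulrBr mulrCA mulfV ?gt_eqF// mulr1.
have Hc : J th' <= L -> (c + 1) * J th' <= (c + 1) * L by rewrite ler_pM2l.
by move=> h1 h2 h3 /Hc h4 h5; lra.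
Qed.

Lemma daniell_representation : exists mu : {measure set B -> \bar R},
  (mu setT < +oo)%E /\ forall f, nntest f -> \int[mu]_x f x = P f.
Proof.
exists m; split => // f nf; apply/eqP; rewrite eq_le.
by rewrite J_le_P// P_le_J.
Qed.
End daniell.

(** * Bounded signed functionals as differences of positive ones *)

Section signed_representation.
Context {R : realType} {N : nat}.
Notation V := 'rV[R]_N.
Notation B := (@BorelRN R N).

Variables (T : (V -> R) -> R) (C : R).
Hypothesis C0 : 0 <= C.
Hypothesis TD : forall f g, test_fun setT f -> test_fun setT g ->
  T (fun x => f x + g x) = T f + T g.
Hypothesis TZ : forall (c : R) f, test_fun setT f -> T (fun x => c * f x) = c * T f.
Hypothesis T_bounded : forall f (c : R), test_fun setT f ->
  (forall x, `|f x| <= c) -> `|T f| <= C * c.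

Let below (f : V -> R) : set R := [set T g | g in [set g | nntest g /\ forall x, g x <= f x]].
(** The positive part of [T] in the Riesz decomposition, with smooth competitors; [Tp - T] is the
    negative part. *)
Let Tp f := sup (below f).

Let T0 : T (fun=> 0) = 0.
Proof.
have := TZ 0 (test0 setT).
have -> : (fun x : V => 0 * (fun _ : V => 0 : R) x) = (fun=> 0).
  by apply/funext => x; rewrite mul0r.
by rewrite mul0r.
Qed.

Let below_bound f g (c : R) : nntest g -> (forall x, g x <= f x) -> (forall x, f x <= c) -> T g <= C * c.
Proof.
move=> [tg g0] gf fc; rewrite (le_trans (ler_norm _))// T_bounded// => x.
by rewrite ger0_norm// (le_trans (gf x)).
Qed.

Let below_sup f : nntest f -> has_sup (below f).
Proof.
move=> [tf f0]; split.
  by exists (T (fun=> 0)); exists (fun=> 0) => //; split => //; exact: nntest0.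
have [c c0 fc] := test_bounded tf; exists (C * c) => _ [g [ng gf] <-].
by apply: (below_bound ng gf) => x; rewrite (le_trans (ler_norm _)).
Qed.

Let Tp_ub f g : nntest f -> nntest g -> (forall x, g x <= f x) -> T g <= Tp f.
Proof. by move=> nf ng gf; apply: (sup_upper_bound (below_sup nf)); exists g. Qed.

Let Tp_le f (a : R) : nntest f -> (forall g, nntest g -> (forall x, g x <= f x) -> T g <= a) ->
  Tp f <= a.
Proof.
move=> nf H; apply: ge_sup; first by case: (below_sup nf).
by move=> _ [g [ng gf] <-]; exact: H.
Qed.

Let Tp_ge0 f : nntest f -> 0 <= Tp f.
Proof. by move=> nf; rewrite -T0; apply: Tp_ub => //; [exact: nntest0|case: nf]. Qed.

Let Tp_geT f : nntest f -> T f <= Tp f.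
Proof. by move=> nf; exact: Tp_ub. Qed.

Let Tp_bounded f : nntest f -> (forall x, f x <= 1) -> Tp f <= C.
Proof.
move=> nf f1; apply: Tp_le => // g ng gf.
by rewrite -[leRHS]mulr1; exact: below_bound gf f1.
Qed.

Let TpZ_ge (c : R) f : 0 <= c -> nntest f -> c * Tp f <= Tp (fun x => c * f x).
Proof.
move=> c0 nf; have [cp|cn|<-] := ltgtP 0 c; first last.
- by rewrite mul0r Tp_ge0//; exact: nntestZ.
- by move: c0; rewrite leNgt cn.
rewrite -ler_pdivlMl//; apply: Tp_le => // g ng gf.
rewrite ler_pdivlMl// -TZ; last by case: ng.
by apply: Tp_ub; [exact: nntestZ|exact: nntestZ|move=> x; rewrite ler_pM2l].
Qed.

Let TpZ (c : R) f : 0 <= c -> nntest f -> Tp (fun x => c * f x) = c * Tp f.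
Proof.
move=> c0 nf; apply/eqP; rewrite eq_le TpZ_ge// andbT.
have [cp|cn|<-] := ltgtP 0 c; first last.
- rewrite mul0r; apply: Tp_le; first exact: nntestZ.
  move=> g [tg g0] gf; rewrite (_ : g = fun=> 0) ?T0//.
  by apply/funext => x; apply/eqP; rewrite eq_le g0 andbT (le_trans (gf x))// mul0r.
- by move: c0; rewrite leNgt cn.
rewrite -ler_pdivrMl//.
have ncf : nntest (fun x => c * f x) by exact: nntestZ.
have ci : 0 <= c^-1 by rewrite invr_ge0.
rewrite (le_trans (TpZ_ge ci ncf))//.
rewrite (_ : (fun x => c^-1 * (c * f x)) = f)//.
by apply/funext => x; rewrite mulKf// gt_eqF.
Qed.

(* Smooth substitute for the Riesz decomposition of [0 <= g <= f1 + f2]: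
   split [g] proportionally to [f1], [f2] and [e]. *)
Let TpD f1 f2 : nntest f1 -> nntest f2 -> Tp (fun x => f1 x + f2 x) = Tp f1 + Tp f2.
Proof.
move=> n1 n2; have n12 := nntestD n1 n2; apply/eqP; rewrite eq_le; apply/andP; split; last first.
  rewrite -lerBrDr; apply: Tp_le => // g1 ng1 g1f; rewrite lerBrDr addrC -lerBrDr.
  apply: Tp_le => // g2 ng2 g2f; rewrite lerBrDr addrC -TD; [|by case: ng1|by case: ng2].
  by apply: Tp_ub => //; [exact: nntestD|move=> x; exact: lerD].
apply: Tp_le => // g ng gf; apply/ler_addgt0Pr => e e0.
have C1 : 0 < C + 1 by rewrite ltr_wpDl.
(* The third share of [g] is [d * h] with [h] in [[0, 1]]. As [T h <= C], it contributes at most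
   [e]. *)
pose d := e / (C + 1); have d0 : 0 < d by exact: divr_gt0.
pose den x := f1 x + f2 x + d.
have den0 x : 0 < den x by rewrite ltr_wpDl// addr_ge0//; [case: n1|case: n2].
have sden : smooth (fun x => (den x)^-1).
  have sf1 := test_smooth n1.1; have sf2 := test_smooth n2.1.
  have sd : smooth den := smoothD (smoothD sf1 sf2) (smooth_cst d).
  exact: (smooth_inv sd (fun x => lt0r_neq0 (den0 x))).
pose h x := g x * (den x)^-1.
have nh : nntest h by apply: (nntestM ng sden) => x; rewrite invr_ge0 ltW.
have h1 x : h x <= 1.
  by rewrite /h ler_pdivrMr// mul1r (le_trans (gf x))// lerDl ltW.
have nfh f : nntest f -> nntest (fun x => f x * h x).
  by move=> nf; apply: (nntestM nf); [exact: test_smooth nh.1|case: nh].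
have fhf f : nntest f -> forall x, f x * h x <= f x.
  by move=> [_ f0] x; exact: ler_piMr.
have gE : T g = T (fun x => f1 x * h x) + T (fun x => f2 x * h x) + d * T h.
  have [th _] := nh; have [th1 _] := nfh _ n1; have [th2 _] := nfh _ n2.
  rewrite -(TZ d th) -(TD th1 th2) -(TD (testD th1 th2) (testZ d th)).
  congr T; apply/funext => x; rewrite -!mulrDl -/(den x).
  by rewrite mulrC /h mulfVK// gt_eqF.
rewrite gE -!addrA lerD//; first exact: Tp_ub n1 (nfh _ n1) (fhf _ n1).
rewrite lerD//; first exact: Tp_ub n2 (nfh _ n2) (fhf _ n2).
rewrite /d mulrAC ler_pdivrMr// ler_wpM2l ?(ltW e0)//.
rewrite (le_trans (below_bound nh (fun x => lexx _) h1))// mulr1.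
by rewrite lerDl.
Qed.

(** The positive representation is applied to [Tp] and to [Tp - T], bounded by [C] and [C + C] on
    functions with values in [[0, 1]]. *)
Lemma signed_representation : exists mu1 mu2 : {measure set B -> \bar R},
  [/\ (mu1 setT < +oo)%E, (mu2 setT < +oo)%E & forall f, test_fun setT f ->
    T f = \int[mu1]_x f x - \int[mu2]_x f x].
Proof.
have [mu1 [fin1 E1]] := daniell_representation Tp_ge0 TpD TpZ Tp_bounded.
have [|f g nf ng|c f c0 nf|f nf f1|mu2 [fin2 E2]] :=
  @daniell_representation R N (fun f => Tp f - T f) _ _ _ (C + C).
- by move=> f nf; rewrite subr_ge0 Tp_geT.
- by rewrite TpD// TD; [ring|case: nf|case: ng].
- by rewrite TpZ// TZ; [ring|case: nf].
- rewrite lerD ?Tp_bounded//.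
  rewrite (le_trans (ler_norm (- T f)))// normrN -[leRHS]mulr1 T_bounded//; first by case: nf.
  by move=> x; rewrite ger0_norm//; case: nf.
exists mu1, mu2; split => // f tf.
have nn_case g : nntest g -> T g = \int[mu1]_x g x - \int[mu2]_x g x.
  by move=> ng; rewrite E1// E2//; ring.
have [c c0 fc] := test_bounded tf; have [sf [K [cK [_ f0]]]] := tf.
have [th [tth th01 [W [_ KW thW]]]] := exists_cutoff cK openT (@subsetT _ K).
have nth : nntest th by split => // x; case/andP: (th01 x).
have ncth := nntestZ c0 nth.
(* Adding [c * th] makes [f] nonnegative; additivity of both sides then transfers the identity to
   signed [f]. *)
have nfc : nntest (fun x => f x + c * th x).
  split; first exact: testD tf ncth.1.
  move=> x; have [Kx|nKx] := pselect (K x).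
    rewrite thW; last exact: KW.
    by rewrite mulr1 -lerBlDr sub0r lerNl (le_trans (ler_norm _))// normrN.
  by rewrite f0// add0r mulr_ge0//; case: nth.
have H1 : T (fun x => f x + c * th x) = T f + T (fun x => c * th x).
  by rewrite TD//; case: ncth.
have intf (mu : {measure set B -> \bar R}) g : (mu setT < +oo)%E -> test_fun setT g ->
    mu.-integrable setT (EFin \o g) by move=> muf tg; exact: test_integrable_fin tg.
have HJ (mu : {measure set B -> \bar R}) : (mu setT < +oo)%E ->
    \int[mu]_x (f x + c * th x) = \int[mu]_x f x + \int[mu]_x (c * th x).
  by move=> muf; rewrite RintegralD//; apply: intf => //; case: ncth.
move: H1; rewrite (nn_case _ nfc) (nn_case _ ncth) !HJ//.
by move/eqP; rewrite -subr_eq => /eqP <-; ring.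
Qed.
End signed_representation.

(** * Lebesgue integrability and the functional attached to a bounded field *)

Section lebesgue_integrability.
Context {R : realType} {n : nat}.
Notation N := n.+1.
Notation V := 'rV[R]_N.
Notation B := (@BorelRN R N).
Notation lam := (@lebN R N).

Lemma compact_obox (K : set V) : compact K -> exists2 r : R, 0 < r & K `<=` obox 0 r.
Proof.
move=> cK; have [|s [_ _ Ks]] := @finite_box_cover R N nat K setT (fun=> 0) (fun k => k.+1%:R) cK (fun _ _ => ltr0Sn _ _).
  move=> x _; exists (Num.trunc (\sum_i `|x ord0 i|)) => // i; rewrite mxE subr0.
  apply: le_lt_trans (truncnS_gt _).
  by rewrite (bigD1 i)//= lerDl sumr_ge0.
exists (\max_(k <- s) k).+1%:R => // x /Ks[k ks].
by apply: sub_obox; rewrite ler_nat ltnS; exact: leq_bigmax_seq.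
Qed.

Lemma compact_lebN (K : set V) : compact K -> (lam (K : set B) < +oo)%E.
Proof. by move=> /compact_obox[r _]; exact: lebN_bounded. Qed.

Lemma compact_support_integrable (f : V -> R) (K : set V) (c : R) (D : set B) :
  measurable D -> compact K -> measurable_fun D (f : B -> R) ->
  (forall x, `|f x| <= c) -> (forall x, ~ K x -> f x = 0) ->
  lam.-integrable D (EFin \o f).
Proof.
move=> mD cK mf fc f0.
have mK : measurable (K : set B) by exact: measurable_compact.
have mDK : measurable (D `&` K : set B) by exact: measurableI.
have iDK : lam.-integrable (D `&` K) (EFin \o f).
  apply: (@bounded_by_integrable _ _ _ _ _ _ c) => //.
    by apply: le_lt_trans (compact_lebN cK); apply: le_measure; rewrite ?inE//; exact: subIsetr.
  exact: measurable_funS mf.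
rewrite (_ : EFin \o f = (EFin \o f) \_ K).
  apply/(integrable_mkcond _ mD).
  rewrite (_ : _ \_ D = (EFin \o f) \_ (D `&` K)); first exact/(integrable_mkcond _ mDK).
  by apply/funext => x; rewrite !patchE in_setI; case: (x \in D).
apply/funext => x; rewrite patchE; case: ifPn => // /negP xK /=.
by rewrite f0// => Kx; apply: xK; exact: mem_set.
Qed.
Lemma meas_field_mkcond (D : set B) (F : V -> V) : measurable D ->
  meas_field D F -> meas_field setT (fun x => if x \in D then F x else 0).
Proof.
move=> mD mF i; have := mF i => /(measurable_restrictT _ mD).
congr measurable_fun; apply/funext => x; rewrite patchE.
by case: ifP => //; rewrite mxE.
Qed.

Lemma normr_coord_eucl (x : V) i : `|x ord0 i| <= eucl x.
Proof.
rewrite /eucl -sqrtr_sqr ler_wsqrtr// (bigD1 i)//= lerDl.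
by apply: sumr_ge0 => j _; rewrite sqr_ge0.
Qed.

Lemma eucl_le (x : V) (c : R) : 0 <= c -> (forall i, `|x ord0 i| <= c) -> eucl x <= N%:R * c.
Proof.
move=> c0 xc; rewrite /eucl -[leRHS]ger0_norm ?mulr_ge0// -sqrtr_sqr ler_wsqrtr//.
apply: (@le_trans _ _ (\sum_(i < N) c ^+ 2)).
  apply: ler_sum => i _; rewrite -real_normK ?num_real// ler_pXn2r ?nnegrE//.
rewrite sumr_const card_ord exprMn -[leLHS]mulr_natl ler_wpM2r ?sqr_ge0//.
by rewrite -natrX ler_nat expnS leq_pmulr// expn_gt0.
Qed.

Lemma measurable_coord_eucl (D : set B) (F : V -> V) : measurable D -> meas_field D F ->
  measurable_fun D ((fun x => eucl (F x)) : B -> R).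
Proof.
move=> mD mF; apply: measurableT_comp.
  by apply: continuous_measurable_fun; exact: sqrt_continuous.
by apply: measurable_sum => i; apply: measurable_funX; exact: mF.
Qed.

Section dot_grad.
Variables (G : V -> V) (M : R).
Hypotheses (mG : meas_field setT G) (GM : forall x i, `|G x ord0 i| <= M).

Lemma dot_grad_integrable U f (D : set B) : measurable D -> test_fun U f ->
  lam.-integrable D (EFin \o dot_grad G f).
Proof.
move=> mD tf; have [sf [K [cK [_ f0]]]] := tf.
have M0 : 0 <= M by rewrite (le_trans _ (GM 0 ord0)).
have /choice[c cP] : forall i : 'I_N, exists c : R, 0 <= c /\ forall x, `|'D_(ebasis i) f x| <= c.
  by move=> i; have [c c0 fc] := test_bounded (test_derive (ebasis i) tf); exists c.
apply: (@compact_support_integrable _ K (\sum_i M * c i)) => //.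
- apply: measurable_sum => i; apply: measurable_funM.
    by apply: measurable_funS (mG i).
  exact: test_measurable (test_derive (ebasis i) tf).
- move=> x; rewrite (le_trans (ler_norm_sum _ _ _))//; apply: ler_sum => i _.
  by rewrite normrM ler_pM//; case: (cP i).
- move=> x nK; apply: big1 => i _.
  by rewrite (@derive_support _ _ f K (ebasis i) x _ f0)// ?mulr0//; exact: compact_closed.
Qed.

Lemma dot_gradD f g x : smooth f -> smooth g ->
  dot_grad G (fun x => f x + g x) x = dot_grad G f x + dot_grad G g x.
Proof.
move=> sf sg; rewrite /dot_grad -big_split; apply: eq_bigr => i _ /=.
by rewrite -mulrDr; congr (_ * _); exact: smooth_deriveD.
Qed.

Lemma dot_gradM f g x : smooth f -> smooth g ->
  dot_grad G (fun x => f x * g x) x = f x * dot_grad G g x + g x * dot_grad G f x.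
Proof.
move=> sf sg; rewrite /dot_grad !mulr_sumr -big_split; apply: eq_bigr => i _ /=.
rewrite [X in _ * X](_ : _ = f x * 'D_(ebasis i) g x + g x * 'D_(ebasis i) f x).
  by ring.
exact: smooth_deriveM.
Qed.

Lemma dot_gradZ (c : R) f x : smooth f -> dot_grad G (fun x => c * f x) x = c * dot_grad G f x.
Proof.
move=> sf; rewrite /dot_grad mulr_sumr; apply: eq_bigr => i _.
rewrite mulrCA; congr (_ * _).
exact: smooth_deriveZ.
Qed.

(** The functional represented is minus the integral of [G . grad f]; the sign is that of
    integration by parts and makes the measure the divergence of [G]. *)
Lemma DM_infty_of_bounded (C : R) : 0 <= C ->
  (forall f (c : R), test_fun setT f -> (forall x, `|f x| <= c) ->
     `|\int[lam]_x dot_grad G f x| <= C * c) ->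
  DM_infty setT G.
Proof.
move=> C0 H; split => //; split.
  exists (N%:R * M); rewrite (_ : [set _ | _] = set0) ?measure0//.
  rewrite predeqE => x; split => // -[_ /=]; apply/negP; rewrite -leNgt.
  by apply: eucl_le => // ; rewrite (le_trans _ (GM 0 ord0)).
have [|f g tf tg|c f tf|f c tf fc|mu1 [mu2 [fin1 fin2 E]]] :=
  @signed_representation R N (fun f => - \int[lam]_x dot_grad G f x) C.
- exact: C0.
- rewrite -opprD; congr (- _); rewrite -RintegralD//; [|exact: dot_grad_integrable tf|exact: dot_grad_integrable tg].
  by apply: eq_Rintegral => x _; apply: dot_gradD; [exact: test_smooth tf|exact: test_smooth tg].
- rewrite mulrN; congr (- _); rewrite -RintegralZl//; last exact: dot_grad_integrable tf.
  by apply: eq_Rintegral => x _; apply: dot_gradZ; exact: test_smooth tf.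
- by rewrite normrN; exact: H.
exists mu1, mu2; split => //; split => // f tf.
have int1 : mu1.-integrable setT (EFin \o f) by exact: test_integrable_fin tf.
have int2 : mu2.-integrable setT (EFin \o f) by exact: test_integrable_fin tf.
have intG : lam.-integrable setT (EFin \o dot_grad G f) by exact: dot_grad_integrable tf.
rewrite -[LHS]fineK; last exact: integrable_fin_num intG.
rewrite -[X in (- (X - _))%E]fineK; last exact: integrable_fin_num int1.
rewrite -[X in (- (_ - X))%E]fineK; last exact: integrable_fin_num int2.
have /eqP := E f tf; rewrite eqr_oppLR => /eqP EE.
by rewrite -EFinB -EFinN; congr EFin.
Qed.
End dot_grad.
End lebesgue_integrability.

(** * Open sets with boundary of finite Hausdorff measure *)

Section estimates.
Context {R : realType}.

Lemma sum_uniq_le (a : nat -> R) (s : seq nat) m : uniq s -> (forall k, 0 <= a k) ->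
  (forall k, k \in s -> (k < m)%N) -> \sum_(k <- s) a k <= \sum_(k < m) a k.
Proof.
move=> us a0 sm; rewrite -(big_mkord xpredT a).
have sE : perm_eq s [seq k <- index_iota 0 m | k \in s].
  apply: uniq_perm => //; first by rewrite filter_uniq// iota_uniq.
  move=> k; rewrite mem_filter mem_index_iota; apply/idP/idP; last by case/andP.
  by move=> ks; rewrite ks sm.
rewrite (perm_big _ sE) big_filter big_mkcond/=.
by apply: ler_sum => k _; case: ifP.
Qed.

Lemma sum_half_pow m : \sum_(k < m) (2^-1) ^+ k.+1 <= 1 :> R.
Proof.
suff -> : \sum_(k < m) (2^-1) ^+ k.+1 = 1 - (2^-1) ^+ m :> R by rewrite gerBl exprn_ge0// invr_ge0.
elim: m => [|m IH]; first by rewrite big_ord0 expr0 subrr.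
by rewrite big_ord_recr/= IH exprS; lra.
Qed.

(** A covering set may have diameter 0, or contain points at distance exactly its diameter. A
    slightly larger, positive radius makes room for an open box at a prescribed cost [e]. *)
Lemma exprn_right_close (n : nat) (d e delta : R) : 0 < e -> 0 < delta ->
  exists r, [/\ d < r, r <= d + delta & r ^+ n <= d ^+ n + e].
Proof.
move=> e0 delta0; have := @exprn_continuous R n d.
move=> /cvgrPdist_lt /(_ e e0) /nbhs_ballP[t /= t0 tP].
pose r := d + Num.min (t / 2) delta.
have m0 : 0 < Num.min (t / 2) delta by rewrite lt_min delta0 divr_gt0.
exists r; split; first by rewrite ltrDl.
  by rewrite lerD2l ge_min lexx orbT.
have /tP : ball d t r.
  rewrite /ball/= opprD addNKr normrN gtr0_norm// gt_min.
  by rewrite ltr_pdivrMr// ltr_pMr// ltr1n.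
rewrite distrC => /(le_lt_trans (ler_norm _)); rewrite ltrBlDl; exact: ltW.
Qed.

(** A union bound for cutoff values in [[0, 1]]. *)
Lemma one_sub_prod_le (I : Type) (s : seq I) (b : I -> R) : (forall k, 0 <= b k <= 1) ->
  0 <= 1 - \prod_(k <- s) (1 - b k) <= \sum_(k <- s) b k.
Proof.
move=> b01; elim: s => [|k s IH]; first by rewrite !big_nil subrr lexx.
rewrite !big_cons; move: IH; set p := \prod_(_ <- _) _; set q := \sum_(_ <- _) _.
have p1 : p <= 1.
  by apply: prodr_ile1 => j _; have /andP[? ?] := b01 j; rewrite subr_ge0 gerBl; apply/andP.
move=> /andP[h1 h2]; have /andP[h3 h4] := b01 k.
by apply/andP; split; nra.
Qed.
End estimates.

Section derive_products.
Context {R : realType} {N : nat}.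
Notation V := 'rV[R]_N.

(** In the Leibniz rule all undifferentiated factors lie in [[0, 1]]. *)
Lemma derive_prod_one_sub_le (I : Type) (s : seq I) (b : I -> V -> R) v x :
  (forall k, smooth (b k)) -> (forall k y, 0 <= b k y <= 1) ->
  `|'D_v (fun y => \prod_(k <- s) (1 - b k y)) x| <= \sum_(k <- s) `|'D_v (b k) x|.
Proof.
move=> sb b01; elim: s => [|k s IH].
  rewrite big_nil (_ : (fun y => _) = fun=> 1); last by apply/funext => y; rewrite big_nil.
  by rewrite (@derive_cst R V R 1) normr0.
have sp : smooth (fun y => \prod_(k <- s) (1 - b k y)).
  by apply: smooth_prod => j; exact: smoothB (smooth_cst 1) (sb j).
rewrite big_cons (_ : (fun y => _) = fun y => (1 - b k y) * \prod_(k <- s) (1 - b k y)); last first.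
  by apply/funext => y; rewrite big_cons.
rewrite smooth_deriveM//; last exact: smoothB (smooth_cst 1) (sb k).
have -> : 'D_v (fun y => 1 - b k y) x = - 'D_v (b k) x.
  rewrite (smooth_deriveD x v (smooth_cst 1) (smoothN (sb k))).
  rewrite (@derive_cst R V R 1) add0r.
  rewrite (_ : (fun y => - b k y) = (fun y => -1 * b k y)); last by apply/funext => y; rewrite mulN1r.
  by rewrite smooth_deriveZ// mulN1r.
rewrite (le_trans (ler_normD _ _))// addrC lerD//.
  rewrite normrM normrN ler_piMl//.
  have /andP[h1 h2] := @one_sub_prod_le R I s (fun k => b k x) (fun k => b01 k x).
  rewrite ger0_norm; first by rewrite -subr_ge0.
  by apply: prodr_ge0 => j _; rewrite subr_ge0; case/andP: (b01 j x).
apply: le_trans IH; rewrite normrM ler_piMl//.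
by have /andP[h1 h2] := b01 k x; rewrite ger0_norm ?subr_ge0// gerBl.
Qed.
End derive_products.

Section box_integral.
Context {R : realType} {n : nat}.
Notation N := n.+1.
Notation V := 'rV[R]_N.
Notation B := (@BorelRN R N).
Notation lam := (@lebN R N).

Lemma integral_le_boxes (I : Type) (E : V -> R) (s : seq I) (a : I -> R) (c : I -> V) (r : I -> R) :
  measurable_fun setT (E : B -> R) -> (forall k, 0 <= a k) -> (forall k, 0 < r k) ->
  (forall x, `|E x| <= \sum_(k <- s) a k * \1_(obox (c k) (r k)) x) ->
  (\int[lam]_x `|E x|%:E <= (\sum_(k <- s) a k * (2 * r k) ^+ N)%:E)%E.
Proof.
move=> mE a0 r0 Es.
have mo k : measurable (obox (c k) (r k) : set B) by apply: measurable_open; exact: open_obox.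
have mi k : @measurable_fun _ _ B (\bar R) setT (fun x => (a k * \1_(obox (c k) (r k)) x)%:E).
  by apply/measurable_EFinP; apply: measurable_funM => //; exact: measurable_indic.
apply: (@le_trans _ _ (\int[lam]_x (\sum_(k <- s) (a k * \1_(obox (c k) (r k)) x)%:E))%E).
  apply: ge0_le_integral => //.
  - by apply/measurable_EFinP; apply: measurableT_comp.
  - exact: emeasurable_sum.
  - by move=> x _; rewrite sumEFin lee_fin.
rewrite ge0_integral_sum//; last by move=> k x _; rewrite lee_fin mulr_ge0.
rewrite -sumEFin; apply: lee_sum => k _.
under eq_integral do rewrite EFinM.
have mI : @measurable_fun _ _ B (\bar R) setT (fun x => (\1_(obox (c k) (r k)) x)%:E).
  by apply/measurable_EFinP; exact: measurable_indic.
rewrite ge0_integralZl ?lee_fin//.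
rewrite integral_indic// setIT EFinM lee_wpmul2l ?lee_fin//.
by apply: lebN_obox; exact: ltW.
Qed.
End box_integral.

(** * From Hausdorff measure to covers by open boxes *)

Section hausdorff_cover.
Context {R : realType} {N : nat}.
Notation V := 'rV[R]_N.

(** [S] is independent of [delta]: it is the Hausdorff measure plus 1 for choosing a cover close to
    the infimum, plus 1 for enlarging the [k]-th diameter at cost [2^-(k+1)]. [D] discards empty
    pieces, which provide no centre and whose cost is 0 by convention, even for [n = 0]. *)
Lemma hausdorff_box_cover (n : nat) (A : set V) : (hausdorff n A < +oo)%E ->
  exists2 S : R, 0 <= S & forall delta : R, 0 < delta ->
    exists (D : set nat) (c : nat -> V) (r : nat -> R),
    [/\ forall k, 0 < r k, forall k, D k -> r k <= 2 * delta,
        A `<=` \bigcup_(k in D) obox (c k) (r k) &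
        forall s : seq nat, uniq s -> (forall k, k \in s -> D k) -> \sum_(k <- s) r k ^+ n <= S].
Proof.
move=> Hoo.
have pre_ge0 delta : (0 <= hausdorff_pre n delta A)%E.
  apply: le_ereal_inf_tmp => _ [C [_ Cd] <-]; apply: nneseries_ge0 => k _ _.
  rewrite lee_fin /diam_pow; case: asboolP => // C0; apply: exprn_ge0.
  rewrite /ediam; have [x Cx] : exists x, C k x by apply/set0P/eqP.
  apply: (@le_trans _ _ (Defs.edist x x)); first exact: sqrtr_ge0.
  apply: ub_le_sup; last by exists x => //; exists x.
  by exists delta => _ [y Cy [z Cz <-]]; exact: Cd Cy Cz.
have H0 : (0 <= hausdorff n A)%E.
  by apply: (le_trans (pre_ge0 1)); apply: ereal_sup_ubound; exists 1 => //=.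
have Hfin : hausdorff n A \is a fin_num by rewrite ge0_fin_numE.
exists (fine (hausdorff n A) + 2); first by rewrite addr_ge0// fine_ge0.
move=> delta delta0.
have : (hausdorff_pre n delta A < (fine (hausdorff n A) + 1)%:E)%E.
  apply: (@le_lt_trans _ _ (hausdorff n A)); first by apply: ereal_sup_ubound; exists delta.
  by rewrite -[ltLHS]fineK// lte_fin ltrDl.
move=> /ereal_inf_lt[_ [C [AC Cd] <-] Clt].
pose D : set nat := [set k | C k !=set0].
have /choice[c cP] : forall k, exists x : V, D k -> C k x.
  by move=> k; have [[x Cx]|nD] := pselect (D k); [exists x|exists 0].
have /choice[r rP] : forall k, exists r : R, [/\ ediam (C k) < r, r <= ediam (C k) + delta &
    r ^+ n <= ediam (C k) ^+ n + (2^-1) ^+ k.+1].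
  by move=> k; apply: exprn_right_close => //; rewrite exprn_gt0// invr_gt0.
have bnd k : has_ubound [set Defs.edist x y | x in C k & y in C k].
  by exists delta => _ [y Cy [z Cz <-]]; exact: Cd Cy Cz.
have dist_le k x y : C k x -> C k y -> Defs.edist x y <= ediam (C k).
  by move=> Cx Cy; apply: (ub_le_sup (bnd k)); exists x => //; exists y.
have diam0 k : 0 <= ediam (C k).
  have [[x Cx]|nD] := pselect (D k).
    by rewrite (le_trans _ (dist_le k _ _ Cx Cx))// sqrtr_ge0.
  rewrite /ediam (_ : [set _ | _ in _ & _ in _] = set0) ?sup0//.
  by rewrite predeqE => y; split => // -[x Cx _]; apply: nD; exists x.
have diam_le k : D k -> ediam (C k) <= delta.
  move=> [x Cx]; apply: ge_sup; first by exists (Defs.edist x x); exists x => //; exists x.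
  by move=> _ [y Cy [z Cz <-]]; exact: Cd Cy Cz.
exists D, c, r; split.
- by move=> k; have [h1 _ _] := rP k; exact: le_lt_trans (diam0 k) h1.
- move=> k Dk; have [_ h2 _] := rP k.
  by rewrite (le_trans h2)// mulr_natl mulr2n lerD2r diam_le.
- move=> x /AC[k _ Ckx]; have Dk : D k by exists x.
  exists k => // i; have [h1 _ _] := rP k.
  apply: le_lt_trans h1; apply: le_trans (dist_le k _ _ Ckx (cP k Dk)).
  rewrite /Defs.edist /eucl -sqrtr_sqr ler_wsqrtr// (bigD1 i)//= !mxE lerDl.
  by apply: sumr_ge0 => j _; rewrite sqr_ge0.
- move=> s us sD.
  have dp0 k : 0 <= diam_pow n (C k).
    by rewrite /diam_pow; case: asboolP => // _; rewrite exprn_ge0// diam0.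
  pose m := (\max_(k <- s) k).+1.
  have sm k : k \in s -> (k < m)%N by move=> ks; rewrite ltnS; exact: leq_bigmax_seq.
  apply: (@le_trans _ _ (\sum_(k <- s) (diam_pow n (C k) + (2^-1) ^+ k.+1))).
    rewrite big_seq [leRHS]big_seq; apply: ler_sum => k /sD Dk.
    have [_ _] := rP k; rewrite /diam_pow; case: asboolP => // C0.
    by move: Dk => [x]; rewrite C0.
  rewrite big_split/= -[2]/(1 + 1) addrA lerD//; last first.
    apply: le_trans (sum_half_pow m).
    have h0 k : 0 <= (2^-1 : R) ^+ k.+1 by rewrite exprn_ge0// invr_ge0.
    exact: (@sum_uniq_le _ (fun k => (2^-1) ^+ k.+1) s m us h0 sm).
  apply: le_trans (@sum_uniq_le _ (fun k => diam_pow n (C k)) s m us dp0 sm) _.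
  rewrite -lee_fin -sumEFin (le_trans _ (ltW Clt))//.
  by apply: nneseries_ge_partial => k; rewrite lee_fin.
Qed.
End hausdorff_cover.

(** * Cutting test functions off near the boundary *)

Section extension_by_zero.
Context {R : realType} {n : nat}.
Notation N := n.+1.
Notation V := 'rV[R]_N.
Notation B := (@BorelRN R N).
Notation lam := (@lebN R N).

Lemma boundary_closed (U : set V) : closed (boundary U).
Proof.
rewrite /boundary setDE; apply: closedI; first exact: closed_closure.
by apply: open_closedC; exact: open_interior.
Qed.

(* Multiplying by a product of cutoffs that vanish near the boundary turns a
   test function on the whole space into a test function on [U]. *)
Lemma test_restrict (U : set V) (f : V -> R) (K : set V) (s : seq nat) (c : nat -> V) (r : nat -> R) :
  open U -> smooth f -> compact K -> (forall x, ~ K x -> f x = 0) ->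
  (forall k, k \in s -> 0 < r k) ->
  (forall x, (K `&` boundary U) x -> exists2 k, k \in s & obox (c k) (r k) x) ->
  test_fun U (fun x => if x \in U then f x * \prod_(k <- s) (1 - obump (c k) (r k) x) else 0).
Proof.
move=> oU sf cK f0 r0 Ks; set z := fun x => _.
have sp : smooth (fun x : V => \prod_(k <- s) (1 - obump (c k) (r k) x)).
  by apply: smooth_prod => j; exact: smoothB (smooth_cst 1) (smooth_obump _ _).
have p0 x k : k \in s -> obox (c k) (r k) x -> \prod_(k <- s) (1 - obump (c k) (r k) x) = 0.
  move=> ks xk; rewrite (big_rem k)//= obump_eq1 ?subrr ?mul0r//; first exact: r0.
  exact: obox_cbox.
have clK : closed K by exact: compact_closed.
split.
  apply: smooth_local => x.
  have [Ux|nUx] := pselect (U x).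
    exists (fun x => f x * \prod_(k <- s) (1 - obump (c k) (r k) x)); first exact: smoothM.
    have : nbhs x U by exact: open_nbhs_nbhs.
    by apply: filterS => y Uy; rewrite /z mem_set.
  exists (fun=> 0); first exact: smooth_cst.
  have [cUx|ncUx] := pselect (closure U x); last first.
    have : nbhs x (~` closure U).
      by apply: open_nbhs_nbhs; split => //; apply: closed_openC; exact: closed_closure.
    by apply: filterS => y ncy; rewrite /z memNset// => Uy; apply: ncy; exact: subset_closure.
  have bx : boundary U x by split => //; move/interior_subset.
  have [Kx|nKx] := pselect (K x); last first.
    have : nbhs x (~` K) by apply: open_nbhs_nbhs; split => //; exact: closed_openC.
    by apply: filterS => y nKy; rewrite /z f0// mul0r; case: ifP.
  have [k ks xk] := Ks x (conj Kx bx).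
  have : nbhs x (obox (c k) (r k)).
    by apply: open_nbhs_nbhs; split => //; apply: open_obox; exact: r0.
  by apply: filterS => y yk; rewrite /z (p0 y k)// mulr0; case: ifP.
pose W := \bigcup_(k in [set` s]) obox (c k) (r k).
have oW : open W by apply: bigcup_open => k /= ks; apply: open_obox; exact: r0.
exists (K `&` (closure U `&` ~` W)); split.
  apply: compact_closedI => //.
  by apply: closedI; [exact: closed_closure|exact: open_closedC].
split.
  move=> x [Kx [cUx nWx]]; apply: contrapT => nUx; apply: nWx.
  have [|k ks xk] := Ks x; last by exists k.
  by split => //; split => //; move/interior_subset.
move=> x nx; rewrite /z; case: ifPn => // /set_mem Ux.
have [Kx|nKx] := pselect (K x); last by rewrite f0// mul0r.
have [[k /= ks xk]|nWx] := pselect (W x); first by rewrite (p0 x k)// mulr0.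
by exfalso; apply: nx; split => //; split => //; exact: subset_closure.
Qed.

Lemma eq_dot_grad_near (G : V -> V) (f g : V -> R) (x : V) :
  (\forall y \near x, f y = g y) -> dot_grad G f x = dot_grad G g x.
Proof.
by move=> fg; apply: eq_bigr => i _; congr (_ * _); exact: near_eq_derive.
Qed.

Lemma normr_dot_grad_le (G : V -> V) (M b : R) (g : V -> R) x :
  (forall i, `|G x ord0 i| <= M) -> (forall i, `|'D_(ebasis i) g x| <= b) ->
  `|dot_grad G g x| <= N%:R * M * b.
Proof.
move=> GM gb; rewrite (le_trans (ler_norm_sum _ _ _))//.
apply: (@le_trans _ _ (\sum_(i < N) M * b)).
  by apply: ler_sum => i _; rewrite normrM ler_pM.
by rewrite sumr_const card_ord -[leLHS]mulr_natl mulrA.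
Qed.

(** Replacing [f] by [f * eta] on [U] leaves two errors: [(1 - eta) G . grad f], whose share per box
    carries an additional factor [r k], and [f G . grad eta], whose share is of order [r k ^ n] and
    produces the constant [Q * C']. *)
Lemma extension_bound (U : set V) (G : V -> V) (M m : R) :
  open U -> (hausdorff n (boundary U) < +oo)%E ->
  meas_field setT G -> (forall x i, `|G x ord0 i| <= M) ->
  (forall x, ~ U x -> G x = 0) -> 0 <= m ->
  (forall f (c : R), test_fun U f -> (forall x, `|f x| <= c) ->
     `|\int[lam]_x dot_grad G f x| <= m * c) ->
  exists2 C : R, 0 <= C & forall f (c : R), test_fun setT f -> (forall x, `|f x| <= c) ->
     `|\int[lam]_x dot_grad G f x| <= C * c.
Proof.
move=> oU Hoo mG GM G0 m0 H.
have [S S0 HS] := hausdorff_box_cover Hoo.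
have M0 : 0 <= M by rewrite (le_trans _ (GM 0 ord0)).
have [C' C'0 HC'] : exists2 C' : R, 0 <= C' & forall (c : V) r x i, 0 < r ->
    `|'D_(ebasis i) (obump c r) x| <= C' / r.
  have /choice[C1 HC1] : forall i : 'I_N, exists C : R, 0 <= C /\ forall (c : V) r x, 0 < r ->
      `|'D_(ebasis i) (obump c r) x| <= C / r.
    by move=> i; have [C C0 HC] := @obump_derive_bound R N (ebasis i); exists C.
  exists (\sum_i C1 i); first by apply: sumr_ge0 => i _; case: (HC1 i).
  move=> c r x i r0; have [_ /(_ c r x r0)] := HC1 i; move=> /le_trans; apply.
  rewrite ler_wpM2r ?invr_ge0 ?(ltW r0)// (bigD1 i)//= lerDl.
  by apply: sumr_ge0 => j _; case: (HC1 j).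
(* [6 * r k] is the side of the box of radius [3 * r k] that carries the [k]-th error; [N * M]
   bounds the effect of the components of [G]. *)
pose Q := N%:R * M * 6 ^+ N * S.
have Q0 : 0 <= Q by rewrite !mulr_ge0 ?exprn_ge0.
exists (m + Q * C'); first by rewrite addr_ge0// mulr_ge0.
move=> f c tf fc; have c0 : 0 <= c by rewrite (le_trans _ (fc 0)).
have [sf [K [cK [_ f0]]]] := tf.
have [A A0 fA] : exists2 A : R, 0 <= A & forall x i, `|'D_(ebasis i) f x| <= A.
  have /choice[C1 HC1] : forall i : 'I_N, exists C : R, 0 <= C /\ forall x,
      `|'D_(ebasis i) f x| <= C.
    by move=> i; have [C C0 HC] := test_bounded (test_derive (ebasis i) tf); exists C.
  exists (\sum_i C1 i); first by apply: sumr_ge0 => i _; case: (HC1 i).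
  move=> x i; have [_ /(_ x)] := HC1 i; move=> /le_trans; apply.
  rewrite (bigD1 i)//= lerDl; by apply: sumr_ge0 => j _; case: (HC1 j).
(* The bound [A] on the gradient of [f] must not enter the constant. It comes with a factor [delta]
   and disappears as [delta] tends to 0. *)
suff main (delta : R) : 0 < delta ->
    `|\int[lam]_x dot_grad G f x| <= m * c + Q * (A * (2 * delta) + c * C').
  apply/ler_addgt0Pr => e e0.
  have QA0 : 0 < 2 * (Q * A) + 1 by rewrite ltr_wpDl// !mulr_ge0.
  rewrite (le_trans (main (e / (2 * (Q * A) + 1)) _))// ?divr_gt0//.
  set d := e / _.
  have -> : m * c + Q * (A * (2 * d) + c * C') = (m + Q * C') * c + 2 * (Q * A) * d by ring.
  by rewrite lerD2l /d mulrCA ler_piMr ?(ltW e0)// ler_pdivrMr// mul1r lerDl.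
move=> delta0; have [D [ce [r [r0 Dr Dcov DS]]]] := HS delta delta0.
have cKb : compact (K `&` boundary U).
  by apply: compact_closedI => //; exact: boundary_closed.
have [//||s [us sD Ks]] := @finite_box_cover R N nat (K `&` boundary U) D ce r cKb.
  by move=> x [_ /Dcov].
pose eta x := \prod_(k <- s) (1 - obump (ce k) (r k) x).
pose z x := if x \in U then f x * eta x else 0.
have seta : smooth eta.
  by apply: smooth_prod => j; exact: smoothB (smooth_cst 1) (smooth_obump _ _).
have tz : test_fun U z by exact: (test_restrict oU sf cK f0 (fun k _ => r0 k) Ks).
have b01 x k : 0 <= obump (ce k) (r k) x <= 1 by rewrite obump_ge0 obump_le1.
have etaP x : 0 <= 1 - eta x <= \sum_(k <- s) obump (ce k) (r k) x.
  exact: (@one_sub_prod_le R _ s (fun k => obump (ce k) (r k) x)).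
have eta0 x : 0 <= eta x by apply: prodr_ge0 => k _; rewrite subr_ge0 obump_le1.
have zc x : `|z x| <= c.
  rewrite /z; case: ifP => _; last by rewrite normr0.
  rewrite normrM (ger0_norm (eta0 x)) (le_trans _ (fc x))// ler_piMr//.
  by have /andP[+ _] := etaP x; rewrite subr_ge0.
have Hz := H z c tz zc.
pose E x := dot_grad G f x - dot_grad G z x.
pose a k := N%:R * M * (A + c * (C' / r k)).
have a0 k : 0 <= a k.
  by rewrite !mulr_ge0// addr_ge0// mulr_ge0// divr_ge0// ltW.
have E_le x : `|E x| <= \sum_(k <- s) a k * \1_(obox (ce k) (3 * r k)) x.
  have [Ux|nUx] := pselect (U x); last first.
    have dot0 g : dot_grad G g x = 0.
      by apply: big1 => i _; rewrite G0// mxE mul0r.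
    rewrite /E !dot0 subrr normr0.
    by apply: sumr_ge0 => k _; rewrite mulr_ge0.
  have -> : E x = (1 - eta x) * dot_grad G f x - f x * dot_grad G eta x.
    rewrite /E (@eq_dot_grad_near G z (fun x => f x * eta x)).
      by rewrite dot_gradM//; ring.
    have : nbhs x U by exact: open_nbhs_nbhs.
    by apply: filterS => y Uy; rewrite /z mem_set.
  have /andP[h1 h2] := etaP x.
  rewrite (le_trans (ler_normB _ _))// !normrM (ger0_norm h1).
  apply: (@le_trans _ _ ((\sum_(k <- s) \1_(obox (ce k) (3 * r k)) x) * (N%:R * M * A) +
      c * (N%:R * M * \sum_(k <- s) (C' / r k) * \1_(obox (ce k) (3 * r k)) x))).
    apply: lerD; apply: ler_pM => //.
    - apply: (le_trans h2); apply: ler_sum => k _; rewrite indicE.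
      have [xk|xk] := pselect (obox (ce k) (3 * r k) x).
        by rewrite mem_set//= obump_le1.
      rewrite memNset//= obump_eq0// => xk2; apply: xk.
      by apply: sub_obox xk2; rewrite ler_pM2r// ler_nat.
    - by apply: normr_dot_grad_le => // i; exact: fA.
    - apply: normr_dot_grad_le => // i.
      apply: (le_trans (@derive_prod_one_sub_le R N _ s (fun k => obump (ce k) (r k)) (ebasis i) x
        (fun k => smooth_obump _ _) (fun k y => b01 y k))).
      apply: ler_sum => k _; rewrite indicE.
      have [xk|xk] := pselect (obox (ce k) (3 * r k) x).
        by rewrite mem_set//= mulr1; exact: HC'.
      by rewrite obump_derive_eq0// normr0 mulr_ge0// divr_ge0// ltW.
  rewrite mulr_suml !mulr_sumr -big_split/=; apply: ler_sum => k _.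
  by rewrite le_eqVlt; apply/orP; left; apply/eqP; rewrite /a; ring.
have intf : lam.-integrable setT (EFin \o dot_grad G f) by exact: dot_grad_integrable tf.
have intz : lam.-integrable setT (EFin \o dot_grad G z) by exact: dot_grad_integrable tz.
have intE : lam.-integrable setT (EFin \o E).
  rewrite (_ : EFin \o E = ((EFin \o dot_grad G f) \- (EFin \o dot_grad G z))%E).
    exact: integrableB.
  by apply/funext => x; rewrite /= EFinB.
have -> : \int[lam]_x dot_grad G f x = \int[lam]_x dot_grad G z x + \int[lam]_x E x.
  rewrite -RintegralD//; apply: eq_Rintegral => x _; by rewrite /E; ring.
rewrite (le_trans (ler_normD _ _))// lerD//.
have mE : measurable_fun setT (E : B -> R).
  by apply/measurable_EFinP; exact: measurable_int intE.
have r30 k : 0 < 3 * r k by rewrite mulr_gt0.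
rewrite -lee_fin EFin_normr_Rintegral//.
apply: (le_trans (le_abse_integral _ _ _)) => //; first exact: measurable_int intE.
apply: (le_trans (@integral_le_boxes R n nat E s a ce (fun k => 3 * r k) mE a0 r30 E_le)).
rewrite lee_fin.
apply: (@le_trans _ _ (\sum_(k <- s) N%:R * M * 6 ^+ N * (A * (2 * delta) + c * C') * r k ^+ n)).
  rewrite big_seq [leRHS]big_seq; apply: ler_sum => k ks.
  (* One of the [N] powers of [r k] cancels the [1 / r k] from the cutoff gradient, leaving the
     Hausdorff exponent [n]. *)
  have -> : a k * (2 * (3 * r k)) ^+ N = N%:R * M * 6 ^+ N * (A * r k + c * C') * r k ^+ n.
    rewrite mulrA (_ : 2 * 3 = 6 :> R); last by ring.
    rewrite exprMn [r k ^+ N]exprS /a.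
    have rk : r k != 0 by rewrite gt_eqF.
    by rewrite [X in _ = _ * X * _](_ : _ = (A + c * (C' / r k)) * r k); [ring|field].
  rewrite ler_wpM2r ?exprn_ge0 ?(ltW (r0 k))// ler_wpM2l//; first by rewrite !mulr_ge0 ?exprn_ge0.
  by rewrite lerD2r ler_wpM2l//; exact: Dr (sD _ ks).
rewrite -mulr_sumr (_ : Q * _ = N%:R * M * 6 ^+ N * (A * (2 * delta) + c * C') * S); last first.
  by rewrite /Q; ring.
rewrite ler_wpM2l//; last exact: DS.
by rewrite !mulr_ge0 ?exprn_ge0// addr_ge0// !mulr_ge0// ltW.
Qed.
End extension_by_zero.

(** * Truncation of a field at its essential bound *)

Section truncation.
Context {R : realType} {n : nat}.
Notation N := n.+1.
Notation V := 'rV[R]_N.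
Notation B := (@BorelRN R N).
Notation lam := (@lebN R N).

Definition good_set (A : set V) (F : V -> V) (M : R) : set V := [set x | A x /\ eucl (F x) <= M].

(** Turns an essential bound on [A] into a pointwise bound on the whole space, as the cutoff and
    mollification estimates use it; only a null part of [A] is affected. *)
Definition truncate (A : set V) (F : V -> V) (M : R) (x : V) : V :=
  if x \in good_set A F M then F x else 0.

Variables (A : set V) (F : V -> V) (M : R).
Hypotheses (mA : measurable (A : set B)) (mF : meas_field A F).
Hypothesis FM : lam ([set x | A x /\ M < eucl (F x)] : set B) = 0%E.

Let mD : measurable (good_set A F M : set B).
Proof.
have := @measurable_coord_eucl R n A F mA mF mA `]-oo, M]%classic (measurable_itv _).
by congr measurable; rewrite predeqE => x /=; rewrite in_itv.
Qed.

Let mbad : measurable ([set x | A x /\ M < eucl (F x)] : set B).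
Proof.
have := @measurable_coord_eucl R n A F mA mF mA `]M, +oo[%classic (measurable_itv _).
by congr measurable; rewrite predeqE => x /=; rewrite in_itv/= andbT.
Qed.

Lemma meas_truncate : meas_field setT (truncate A F M).
Proof.
apply: meas_field_mkcond => // i; apply: measurable_funS (mF i) => //.
by move=> x [].
Qed.

Lemma truncate_le x i : `|truncate A F M x ord0 i| <= `|M|.
Proof.
rewrite /truncate; case: ifPn => [/set_mem[_ xM]|_]; last by rewrite mxE normr0.
by rewrite (le_trans (normr_coord_eucl _ _))// (le_trans xM)// ler_norm.
Qed.

Lemma truncate_out x : ~ A x -> truncate A F M x = 0.
Proof. by move=> nA; rewrite /truncate memNset// => -[]. Qed.

Lemma truncate_neq : lam ([set x | A x /\ truncate A F M x <> F x] : set B) = 0%E.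
Proof.
apply/eqP; rewrite eq_le measure_ge0 andbT -FM; apply: le_lebN => x [Ax nF].
split => //; rewrite ltNge; apply/negP => xM; apply: nF.
by rewrite /truncate mem_set.
Qed.

(** The integrands differ only where [F] exceeds [M] on [A], a null set. It is used with
    [D0 = A = U], and with a compact [A = K] inside [D0 = Omega]. *)
Lemma truncate_dot_grad (D0 : set V) U f : measurable (D0 : set B) -> A `<=` D0 ->
  meas_field D0 F -> test_fun U f ->
  (forall x, D0 x -> ~ A x -> dot_grad F f x = 0) ->
  (\int[lam]_(x in (D0 : set B)) (dot_grad F f x)%:E =
   \int[lam]_x (dot_grad (truncate A F M) f x)%:E)%E.
Proof.
move=> mD0 AD0 mF0 tf dot0.
have dotT0 x : ~ A x -> dot_grad (truncate A F M) f x = 0.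
  by move=> nA; apply: big1 => i _; rewrite truncate_out// mxE mul0r.
have -> : (\int[lam]_x (dot_grad (truncate A F M) f x)%:E =
   \int[lam]_(x in (D0 : set B)) (dot_grad (truncate A F M) f x)%:E)%E.
  rewrite [RHS]integral_mkcond; apply: eq_integral => x _; rewrite patchE.
  case: ifPn => // /negP xD0; rewrite dotT0// => Ax; apply: xD0.
  by apply: mem_set; exact: AD0.
have mdot (G : V -> V) : meas_field D0 G -> @measurable_fun _ _ B (\bar R) D0 (fun x => (dot_grad G f x)%:E).
  move=> mG; apply/measurable_EFinP; apply: measurable_sum => i; apply: measurable_funM; first exact: mG.
  exact: test_measurable (test_derive (ebasis i) tf).
apply: ae_eq_integral => //.
- exact: mdot.
- by apply: mdot => i; apply: measurable_funS (meas_truncate i).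
- exists [set x | A x /\ M < eucl (F x)]; split => //= x nx.
  apply: contrapT => nbad; apply: nx => D0x.
  have [Ax|nAx] := pselect (A x); last by rewrite dot0// dotT0.
  rewrite /dot_grad /truncate mem_set//; split => //.
  by rewrite leNgt; apply/negP => Mx; apply: nbad.
Qed.
End truncation.

Section finite_hausdorff_extension.
Context {R : realType} {n : nat}.
Notation N := n.+1.
Notation V := 'rV[R]_N.
Notation B := (@BorelRN R N).
Notation lam := (@lebN R N).

Lemma integral_test_le (mu : {measure set B -> \bar R}) (U : set V) f (c : R) :
  open U -> (mu (U : set B) < +oo)%E -> test_fun U f -> (forall x, `|f x| <= c) ->
  `|\int[mu]_(x in (U : set B)) f x| <= fine (mu (U : set B)) * c.
Proof.
move=> oU fin tf fc; have mU := measurable_open oU.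
have int : mu.-integrable (U : set B) (EFin \o f) by exact: test_integrable_fin tf.
rewrite (le_trans (le_normr_Rintegral _ int))//.
rewrite mulrC -Rintegral_cst//; apply: le_Rintegral => //.
- exact: integrable_norm int.
- by apply: (@bounded_by_integrable _ _ _ _ _ _ `|c|).
Qed.

Theorem extension_finite_hausdorff (U : set V) (F : V -> V) : open U ->
  (hausdorff n (boundary U) < +oo)%E -> DM_infty U F -> extension_domain U F.
Proof.
move=> oU HU [mF [[M FM] [mu1 [mu2 [fin1 [fin2 HF]]]]]].
have mU := measurable_open oU.
have HT f : test_fun U f -> (\int[lam]_(x in (U : set B)) (dot_grad F f x)%:E =
    \int[lam]_x (dot_grad (truncate U F M) f x)%:E)%E.
  by move=> tf; apply: truncate_dot_grad tf _.
have m0 : 0 <= fine (mu1 (U : set B)) + fine (mu2 (U : set B)).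
  by rewrite addr_ge0// fine_ge0.
have [|C C0 HC] := extension_bound oU HU (meas_truncate M mU mF) (@truncate_le R n U F M)
  (@truncate_out R n U F M) m0.
  move=> f c tf fc; rewrite /Rintegral -HT// HF//.
  have int1 : mu1.-integrable (U : set B) (EFin \o f) by exact: test_integrable_fin tf.
  have int2 : mu2.-integrable (U : set B) (EFin \o f) by exact: test_integrable_fin tf.
  rewrite fineN fineB; [|exact: integrable_fin_num int1|exact: integrable_fin_num int2].
  rewrite normrN (le_trans (ler_normB _ _))// mulrDl.
  by rewrite lerD//; exact: integral_test_le.
exists (truncate U F M); split.
  have H1 := DM_infty_of_bounded (meas_truncate M mU mF) (@truncate_le R n U F M) C0.
  exact: H1 HC.
exact: truncate_neq.
Qed.
End finite_hausdorff_extension.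

(** * Mollification *)

Section convolution.
Context {R : realType} {N : nat}.
Notation V := 'rV[R]_N.
Notation B := (@BorelRN R N).

Lemma continuous_oboxP (f : V -> R) : continuous f <-> forall (x : V) (e : R), 0 < e ->
  exists2 r : R, 0 < r & forall y, obox x r y -> `|f x - f y| <= e.
Proof.
split=> [cf x e e0|H].
  have H : f @ nbhs x --> f x := cf x.
  by move/cvgrPdist_le : H => /(_ _ e0) /nbhs_obox.
suff cf (x : V) : f @ nbhs x --> f x by [].
by apply/cvgrPdist_le => e e0; apply/nbhs_obox; have [r r0 Hr] := H x e e0; exists r.
Qed.

(** A Lebesgue number for a cover of the support by boxes whose doubles have small oscillation. If
    only [x + z] lies in the support, the two points exchange roles. *)
Lemma test_unif_continuous (f : V -> R) (e : R) : test_fun setT f -> 0 < e ->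
  exists2 d : R, 0 < d & forall x z, obox 0 d z -> `|f (x + z) - f x| <= e.
Proof.
move=> tf e0; have [sf [K [cK [_ f0]]]] := tf.
have e20 : 0 < e / 2 by rewrite divr_gt0.
have /choice[r rP] : forall x : V, exists r : R, 0 < r /\ forall y, obox x (2 * r) y -> `|f x - f y| <= e / 2.
  move=> x; have /continuous_oboxP /(_ x _ e20)[r r0 rP] := smooth_continuous sf.
  exists (r / 2); rewrite divr_gt0//; split => // y.
  by rewrite mulrC divfK//; exact: rP.
have r0 x : 0 < r x by case: (rP x).
have [//|x _|s [us sK Ks]] := @finite_box_cover R N V K setT id r cK.
  by exists x => //; exact: obox_center.
pose d := \big[Num.min/1]_(c <- s) r c.
have d0 : 0 < d by rewrite /d; elim/big_ind : _ => // a b a0 b0; rewrite lt_min a0.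
have dr c : c \in s -> d <= r c.
  rewrite /d; elim: s {us sK Ks d d0} => // a s IH; rewrite inE big_cons ge_min => /orP[/eqP ->|/IH ->].
    by rewrite lexx.
  by rewrite orbT.
have main x z : K x -> obox 0 d z -> `|f (x + z) - f x| <= e.
  move=> /Ks[c cs xc] zd; have [_ H] := rP c.
  have h1 : `|f c - f x| <= e / 2.
    by apply: H; apply: sub_obox xc; rewrite ler_peMl ?ler1n// ltW.
  have h2 : `|f c - f (x + z)| <= e / 2.
    apply: H => i; rewrite mxE addrAC (le_lt_trans (ler_normD _ _))//.
    rewrite [ltRHS]mulr_natl mulr2n ltrD//.
    by have := zd i; rewrite mxE subr0 => /lt_le_trans; apply; exact: dr.
  rewrite (_ : f (x + z) - f x = (f c - f x) - (f c - f (x + z))); last by ring.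
  by rewrite (le_trans (ler_normB _ _))// [leRHS]splitr lerD.
exists d => // x z zd; have [Kx|nKx] := pselect (K x); first exact: main.
have [Kxz|nKxz] := pselect (K (x + z)); last by rewrite !f0// subrr normr0 ltW.
have zd' : obox 0 d (- z) by move=> i; have := zd i; rewrite !mxE !subr0 normrN.
by have := main _ _ Kxz zd'; rewrite addrK distrC.
Qed.

Lemma continuous_affine (f : V -> R) (a : R) (x : V) : continuous f ->
  continuous (fun y : V => f (a *: (x - y)) : R).
Proof.
move=> /continuous_oboxP cf; apply/continuous_oboxP => y e e0.
have [r r0 Hr] := cf (a *: (x - y)) e e0.
have a0 : 0 < `|a| + 1 by rewrite ltr_wpDl.
exists (r / (`|a| + 1)); first exact: divr_gt0.
move=> z yz; apply: Hr => i; rewrite !mxE.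
rewrite (_ : _ - _ = a * (y ord0 i - z ord0 i)); last by ring.
have := yz i; rewrite ltr_pdivlMr// distrC normrM; apply: le_lt_trans.
by rewrite mulrC ler_wpM2l// lerDl.
Qed.

Section convol.
Variables (nu : {measure set B -> \bar R}) (D : set B) (h : V -> R) (H : R).
Hypotheses (mD : measurable D) (nuD : (nu D < +oo)%E).
Hypotheses (mh : measurable_fun D (h : B -> R)) (hH : forall y, D y -> `|h y| <= H).

(** Here [f] is the kernel and [a] the inverse of its width. The measure is arbitrary: Lebesgue
    measure for the components of the field, and the two parts of its divergence for the test
    function. *)
Definition convol (f : V -> R) (a : R) (x : V) : R := \int[nu]_(y in D) (h y * f (a *: (x - y))).

Lemma convol_integrable f a x U : test_fun U f ->
  nu.-integrable D (EFin \o (fun y => h y * f (a *: (x - y)))).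
Proof.
move=> tf; have [c c0 fc] := test_bounded tf.
apply: (@bounded_by_integrable _ _ _ _ _ _ (H * c)) => //.
- apply: measurable_funM => //; apply: continuous_borelRN_measurable => //.
  by apply: continuous_affine; exact: smooth_continuous (test_smooth tf).
- by move=> y Dy; rewrite normrM ler_pM// hH.
Qed.

Lemma convol_continuous f a : test_fun setT f -> continuous (convol f a).
Proof.
move=> tf; apply/continuous_oboxP => x e e0.
have F0 : 0 < `|H| * fine (nu D) + 1 by rewrite ltr_wpDl// mulr_ge0// fine_ge0.
have [d d0 Hd] := test_unif_continuous tf (divr_gt0 e0 F0).
have a0 : 0 < `|a| + 1 by rewrite ltr_wpDl.
exists (d / (`|a| + 1)); first exact: divr_gt0.
move=> x' xx'; rewrite /convol -RintegralB//; [|exact: convol_integrable tf|exact: convol_integrable tf].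
have intB : nu.-integrable D (EFin \o (fun y => h y * f (a *: (x - y)) - h y * f (a *: (x' - y)))).
  rewrite (_ : EFin \o _ = ((EFin \o (fun y : B => (h y * f (a *: (x - (y : V))))%R)) \- (EFin \o (fun y : B => (h y * f (a *: (x' - (y : V))))%R)))%E) //.
  by apply: integrableB => //; exact: convol_integrable tf.
rewrite (le_trans (le_normr_Rintegral _ intB))//.
apply: (@le_trans _ _ (\int[nu]_(y in D) (`|H| * (e / (`|H| * fine (nu D) + 1))))).
  apply: le_Rintegral => //; first exact: integrable_norm intB.
    by apply: (@bounded_by_integrable _ _ _ _ _ _ `| `|H| * (e / (`|H| * fine (nu D) + 1))|).
  move=> y Dy; rewrite -mulrBr normrM ler_pM//.
    by rewrite (le_trans (hH Dy))// ler_norm.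
  rewrite (_ : a *: (x - y) = a *: (x' - y) + a *: (x - x')); last first.
    by rewrite -scalerDr [in RHS]addrC subrKA.
  apply: Hd => i; rewrite !mxE subr0 normrM.
  have := xx' i; rewrite ltr_pdivlMr// distrC; apply: le_lt_trans.
  by rewrite mulrC ler_wpM2l// lerDl.
rewrite Rintegral_cst// mulrAC mulrA ler_pdivrMr//.
by rewrite mulrC ler_wpM2l ?(ltW e0)// lerDl.
Qed.

Lemma is_derive_line (g : V -> R) (x v : V) (t : R) : derivable g (t *: v + x) v ->
  is_derive t (1 : R) (fun t : R => g (t *: v + x)) ('D_v g (t *: v + x)).
Proof.
move=> dg; apply: is_derive_cvg.
have -> : (fun k : R => k^-1 *: (g ((k *: (1 : R) + t) *: v + x) - g (t *: v + x))) =
  (fun k : R => k^-1 *: (g (k *: v + (t *: v + x)) - g (t *: v + x))).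
  by apply/funext => k; rewrite [k *: 1]mulr1 scalerDl addrA.
exact: dg.
Qed.

(** Differentiation under the integral in the real parameter of the line [t *: v + x]. The
    dominating function is a constant, integrable because [D] has finite measure. *)
Lemma convol_derive f a v x : test_fun setT f ->
  is_derive x v (convol f a) (a * convol (fun y => 'D_v f y) a x).
Proof.
move=> tf; have tDf := test_derive v tf.
have [c c0 fc] := test_bounded tDf.
pose k (t : R) (y : V) := h y * f (a *: (t *: v + x - y)).
have dk (y : V) (t : R) : is_derive t (1 : R) (k^~ y) (h y * (a * 'D_v f (a *: (t *: v + x - y)))).
  pose g z := f (a *: (z - y)).
  have [dg1 dg2] : is_derive (t *: v + x) v g (a * 'D_v f (a *: (t *: v + x - y))).
    by apply: is_derive_scale => z; exact: smooth_derivable (test_smooth tf).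
  have dl := is_derive_line dg1; rewrite dg2 in dl.
  exact: is_deriveZ.
have k1 t y : partial1of2 k t y = h y * (a * 'D_v f (a *: (t *: v + x - y))).
  by rewrite partial1of2E; have [_ ->] := dk y t.
have D0 : `](-1 : R), 1[%classic (0 : R) by rewrite /= in_itv/= ltrN10 ltr01.
have GH : 0 <= `|H| * (`|a| * c) by rewrite !mulr_ge0.
have L := @cvg_differentiation_under_integral R _ B nu k D mD 0 (-1) 1 D0.
have L1 t : `](-1 : R), 1[%classic t -> nu.-integrable D (EFin \o k t).
  by move=> _; rewrite /k; exact: (@convol_integrable _ _ (t *: v + x) _ tf).
have L2 t (y : B) : `](-1 : R), 1[%classic t -> D y -> derivable (k^~ y) t 1.
  by move=> _ _; have [] := dk y t.
have L3 : nu.-integrable D (EFin \o (fun=> `|H| * (`|a| * c))).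
  by apply: (@bounded_by_integrable _ _ _ _ _ _ (`|H| * (`|a| * c))) => // y Dy; rewrite ger0_norm.
have L4 t (y : B) : `](-1 : R), 1[%classic t -> D y -> `|partial1of2 k t y| <= `|H| * (`|a| * c).
  move=> _ Dy; rewrite k1 !normrM ler_pM//.
    by rewrite (le_trans (hH Dy))// ler_norm.
  by rewrite ler_wpM2l.
have := L L1 L2 _ (fun=> GH) L3 L4.
move=> cv; apply: is_derive_cvg; rewrite /convol.
rewrite (_ : (fun t : R => _) = (fun t : R => t^-1 *: (\int[nu]_(y in D) k (t + 0) y - \int[nu]_(y in D) k 0 y))); last first.
  by apply/funext => t; rewrite /k addr0 scale0r add0r.
rewrite -RintegralZl//; last exact: convol_integrable tDf.
suff -> : \int[nu]_(y in D) (a * (h y * 'D_v f (a *: (x - y)))) = \int[nu]_(y in D) partial1of2 k 0 y by [].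
by apply: eq_Rintegral => y _; rewrite k1 scale0r add0r; ring.
Qed.
End convol.
End convolution.

(** * Exchange of integrals, and integrals over supports *)

Section swap.
Context {R : realType} {d1 d2 : measure_display}.
Context {T1 : measurableType d1} {T2 : measurableType d2}.
Variables (p : {measure set T1 -> \bar R}) (q : {measure set T2 -> \bar R}).
Variables (D1 : set T1) (D2 : set T2) (k : T1 -> T2 -> R) (c : R).
Hypotheses (mD1 : measurable D1) (mD2 : measurable D2).
Hypotheses (pD1 : (p D1 < +oo)%E) (qD2 : (q D2 < +oo)%E).
Hypothesis mk : measurable_fun setT (fun z : T1 * T2 => k z.1 z.2).
Hypothesis kc : forall x y, D1 x -> D2 y -> `|k x y| <= c.

Lemma swap_integrable1 x : D1 x -> q.-integrable D2 (EFin \o k x).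
Proof.
move=> Dx; apply: (@bounded_by_integrable _ _ _ _ _ _ c) => // [|y Dy]; last exact: kc.
by apply: measurable_funTS; apply: measurableT_comp mk (measurable_pair1 x).
Qed.

Lemma swap_integrable2 y : D2 y -> p.-integrable D1 (EFin \o k^~ y).
Proof.
move=> Dy; apply: (@bounded_by_integrable _ _ _ _ _ _ c) => // [|x Dx]; last exact: kc.
by apply: measurable_funTS; apply: measurableT_comp mk (measurable_pair2 y).
Qed.

(** The measures are finite on [D1] and [D2] only. Restricting them to these sets makes them finite,
    and Fubini applies to the integrand extended by zero. *)
Lemma Rintegral_swap : \int[p]_(x in D1) \int[q]_(y in D2) k x y =
  \int[q]_(y in D2) \int[p]_(x in D1) k x y.
Proof.
pose p' : {finite_measure set T1 -> \bar R} := mfrestr mD1 pD1.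
pose q' : {finite_measure set T2 -> \bar R} := mfrestr mD2 qD2.
pose K := (fun z : T1 * T2 => (k z.1 z.2)%:E) \_ (D1 `*` D2).
have p'E (f : T1 -> \bar R) : (\int[p']_x (f \_ D1) x = \int[p]_(x in D1) f x)%E.
  rewrite -integral_mkcond; apply: eq_measure_integral => A mA AD.
  by rewrite /p' /= /mfrestr /mrestr setIidl.
have q'E (f : T2 -> \bar R) : (\int[q']_x (f \_ D2) x = \int[q]_(x in D2) f x)%E.
  rewrite -integral_mkcond; apply: eq_measure_integral => A mA AD.
  by rewrite /q' /= /mfrestr /mrestr setIidl.
have mD : measurable (D1 `*` D2) by exact: measurableX.
have iK : (p' \x q')%E.-integrable setT K.
  apply/(integrable_mkcond _ mD); apply: (@bounded_by_integrable _ _ _ _ _ (fun z => k z.1 z.2) c) => //.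
  - rewrite [ltLHS](_ : _ = (p' D1 * q' D2)%E); last exact: product_measure1E.
    by rewrite ltey_eq fin_numM// fin_num_measure.
  - exact: measurable_funTS.
  - by move=> [x y] [/= Dx Dy]; exact: kc.
have := Fubini iK.
rewrite (_ : (fun x => \int[q']_y K (x, y))%E = (fun x => (\int[q]_(y in D2) k x y)%:E) \_ D1); last first.
  apply/funext => x; rewrite patchE; case: ifPn => [/set_mem Dx|nDx].
    rewrite /Rintegral fineK; last by apply: integrable_fin_num => //; exact: swap_integrable1.
    rewrite -q'E; apply: eq_integral => y _; rewrite /K !patchE.
    by rewrite in_setX mem_set.
  by rewrite integral0_eq// => y _; rewrite /K patchE in_setX (negbTE nDx).
rewrite (_ : (fun y => \int[p']_x K (x, y))%E = (fun y => (\int[p]_(x in D1) k x y)%:E) \_ D2); last first.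
  apply/funext => y; rewrite patchE; case: ifPn => [/set_mem Dy|nDy].
    rewrite /Rintegral fineK; last by apply: integrable_fin_num => //; exact: swap_integrable2.
    rewrite -p'E; apply: eq_integral => x _; rewrite /K !patchE.
    by rewrite in_setX /= [y \in D2]mem_set// andbT.
  by rewrite integral0_eq// => x _; rewrite /K patchE in_setX (negbTE nDy) andbF.
by rewrite p'E q'E => E; rewrite {1}/Rintegral E.
Qed.
End swap.

Lemma le_Rintegral_subset {R : realType} d (T : measurableType d)
    (mu : {measure set T -> \bar R}) (A D : set T) (f : T -> R) :
  measurable A -> measurable D -> A `<=` D -> (forall x, 0 <= f x) ->
  mu.-integrable D (EFin \o f) -> \int[mu]_(x in A) f x <= \int[mu]_(x in D) f x.
Proof.
move=> mA mD AD f0 fi; apply: fine_le.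
- by apply: integrable_fin_num => //; exact: integrableS fi.
- exact: integrable_fin_num.
- apply: ge0_subset_integral => //; first by case/integrableP : fi.
  by move=> x _; rewrite lee_fin.
Qed.

Lemma integral_support {R : realType} d (T : measurableType d)
    (mu : {measure set T -> \bar R}) (A D : set T) (f : T -> \bar R) :
  A `<=` D -> (forall x, D x -> ~ A x -> f x = 0%E) ->
  (\int[mu]_(x in D) f x = \int[mu]_(x in A) f x)%E.
Proof.
move=> AD f0; rewrite integral_mkcond [RHS]integral_mkcond.
apply: eq_integral => x _; rewrite !patchE.
case: ifPn => [/set_mem Dx|/negP nDx]; case: ifPn => [Ax|/negP nAx] //.
  by apply: f0 => // Ax; apply: nAx; exact: mem_set.
by case: nDx; apply: mem_set; apply: AD; exact: set_mem.
Qed.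

Lemma Rintegral_support {R : realType} d (T : measurableType d)
    (mu : {measure set T -> \bar R}) (A D : set T) (f : T -> R) :
  A `<=` D -> (forall x, D x -> ~ A x -> f x = 0) ->
  \int[mu]_(x in D) f x = \int[mu]_(x in A) f x.
Proof.
by move=> AD f0; congr fine; apply: integral_support => // x Dx nAx; rewrite f0.
Qed.

(** * The mollifier and its integrals *)

Section mollifier.
Context {R : realType} {n : nat}.
Notation V := 'rV[R]_n.+1.
Notation B := (@BorelRN R n.+1).
Notation lam := (@lebN R n.+1).

(* Stands in for the exact volume of boxes: as long as [lebN] is not identically
   zero, a bump function has positive integral and can be normalized. *)
Lemma lebN_obox_eq0 (r : R) (A : set V) : 0 < r ->
  lam (obox 0 r : set B) = 0%E -> lam (A : set B) = 0%E.
Proof.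
move=> r0 l0; pose F k : set V := if unpickle k is Some q then obox (map_mx ratr (q : 'rV[rat]_n.+1)) r else set0.
have mF k : measurable (F k : set B).
  rewrite /F; case: unpickle => [q|]; last exact: measurable0.
  by apply: measurable_open; exact: open_obox.
have F0 k : lam (F k : set B) = 0%E.
  rewrite /F; case: unpickle => [q|]; last exact: measure0.
  rewrite -(lebN_shift (map_mx ratr q)) -[RHS]l0; congr lebN; rewrite predeqE => x.
  by split => xq i; have := xq i; rewrite !mxE ?subr0 ?addrK// addrK.
apply/eqP; rewrite eq_le measure_ge0 andbT (le_trans (le_lebN (subsetT A)))//.
apply: (@le_trans _ _ (\sum_(k <oo) lam (F k : set B))%E).
  apply: (@measure_sigma_subadditive _ _ B lam setT F) => //.
  move=> x _; have [q [k [xq qx]]] := rat_obox x r0.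
  exists (pickle q) => //; rewrite /F pickleK => i; rewrite distrC.
  by apply: qx; apply: obox_center; rewrite invr_gt0 ltr0n.
by rewrite eseries0.
Qed.

Lemma Rintegral_shift (f : V -> R) (v : V) : measurable_fun setT (f : B -> R) ->
  (forall x, 0 <= f x) -> \int[lam]_x f ((x : V) + v) = \int[lam]_x f x.
Proof.
move=> mf f0; rewrite /Rintegral; congr fine.
have mphi : measurable_fun setT ((fun x : V => x + v) : B -> B).
  apply: measurable_fun_coord => i.
  apply: (@continuous_borelRN_measurable R n.+1 setT (fun x : V => (x + v) ord0 i)) => //.
  apply/continuous_oboxP => x e e0; exists e => // y xy; rewrite !mxE.
  by rewrite opprD addrACA subrr addr0 -normrN opprB ltW.
have := @ge0_integral_pushforward _ _ B B R _ mphi lam setT (EFin \o f) measurableT.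
rewrite preimage_setT => <-.
- apply: eq_measure_integral => A mA _; exact: lebN_shift.
- exact/measurable_EFinP.
- by move=> y _; rewrite lee_fin.
Qed.

Variable eps : R.
Hypothesis eps0 : 0 < eps.

Definition mollifier_mass : R := \int[lam]_x (obump 0 eps x).
(** Normalized to integral 1 once the mass is positive; by the convention [0^-1 = 0] it is in any
    case a bounded, nonnegative, symmetric kernel. *)
Definition mollifier (x y : V) : R := mollifier_mass^-1 * obump 0 1 (eps^-1 *: (x - y)).

Lemma mollifierE x y : mollifier x y = mollifier_mass^-1 * obump y eps x.
Proof. by rewrite obump_scale. Qed.

Lemma mollifierC x y : mollifier x y = mollifier y x.
Proof. by rewrite /mollifier -obumpN -scalerN opprB. Qed.

Lemma mollifier_mass_ge0 : 0 <= mollifier_mass.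
Proof. by apply: Rintegral_ge0 => x _; exact: obump_ge0. Qed.

Lemma mollifier_ge0 x y : 0 <= mollifier x y.
Proof. by rewrite mulr_ge0 ?invr_ge0 ?mollifier_mass_ge0// obump_ge0. Qed.

Lemma mollifier_le x y : mollifier x y <= mollifier_mass^-1.
Proof. by rewrite ler_piMr ?invr_ge0 ?mollifier_mass_ge0// obump_le1. Qed.

Lemma mollifier_norm_le x y : `|mollifier x y| <= mollifier_mass^-1.
Proof. by rewrite ger0_norm ?mollifier_ge0 ?mollifier_le. Qed.

Lemma mollifier_eq0 x y : ~ obox x (2 * eps) y -> mollifier x y = 0.
Proof. by move=> xy; rewrite mollifierC mollifierE obump_eq0 ?mulr0. Qed.

Lemma measurable_mollifier : measurable_fun setT (fun z : B * B => mollifier z.1 z.2).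
Proof.
apply: measurable_funM => //.
apply: (@measurableT_comp _ _ _ _ B R (obump 0 1 : B -> R) _ (fun z : B * B => eps^-1 *: ((z.1 : V) - (z.2 : V)))).
  by apply: continuous_borelRN_measurable => //; exact: smooth_continuous (smooth_obump _ _).
apply: measurable_fun_coord => i.
rewrite (_ : (fun _ => _) = (fun z : B * B => eps^-1 * ((z.1 : V) ord0 i - (z.2 : V) ord0 i))); last first.
  by apply/funext => z; rewrite !mxE.
have mc : measurable_fun setT ((fun x : V => x ord0 i) : B -> R).
  apply: continuous_borelRN_measurable => //; exact: coord_continuous.
apply: measurable_funM => //; apply: measurable_funB.
  exact: (measurableT_comp mc measurable_fst).
exact: (measurableT_comp mc measurable_snd).
Qed.

Lemma integrable_mollifier (x : V) (D : set V) : measurable (D : set B) ->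
  lam.-integrable (D : set B) (EFin \o mollifier x).
Proof.
move=> mD; apply: (@compact_support_integrable _ _ _ (cbox x (2 * eps)) mollifier_mass^-1) => //.
- exact: compact_cbox.
- apply: measurable_funTS; exact: measurableT_comp measurable_mollifier (measurable_pair1 _).
- exact: mollifier_norm_le.
- move=> y xy; apply: mollifier_eq0; apply: contra_not xy; exact: obox_cbox.
Qed.

Hypothesis lam0 : lam (setT : set B) != 0%E.

Lemma mollifier_mass_gt0 : 0 < mollifier_mass.
Proof.
have mO : measurable (obox (0 : V) eps : set B) by apply: measurable_open; exact: open_obox.
have fO : (lam (obox (0 : V) eps : set B) < +oo)%E by exact: (@lebN_bounded _ _ _ eps).
apply: (@lt_le_trans _ _ (\int[lam]_(x in (obox (0 : V) eps : set B)) 1)).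
  rewrite Rintegral_cst// mul1r fine_gt0// fO andbT lt0e measure_ge0 andbT.
  by apply: contra_neq lam0; exact: lebN_obox_eq0.
rewrite (_ : \int[lam]_(x in _) 1 = \int[lam]_(x in (obox (0 : V) eps : set B)) obump 0 eps x); last first.
  by apply: eq_Rintegral => x /set_mem xO; rewrite obump_eq1//; exact: obox_cbox.
apply: le_Rintegral_subset => //; first by move=> x; exact: obump_ge0.
have cK := @compact_cbox R n.+1 0 (2 * eps).
apply: (@compact_support_integrable _ _ _ (cbox 0 (2 * eps)) 1) => //.
- by apply: continuous_borelRN_measurable => //; exact: smooth_continuous (smooth_obump _ _).
- by move=> x; rewrite ger0_norm ?obump_ge0 ?obump_le1.
- move=> y xy; apply: obump_eq0 => //; apply: contra_not xy; exact: obox_cbox.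
Qed.

Lemma mollifier_integral (x : V) : \int[lam]_y mollifier x y = 1.
Proof.
have mo : measurable_fun setT (obump 0 eps : B -> R).
  by apply: continuous_borelRN_measurable => //; exact: smooth_continuous (smooth_obump _ _).
have H := @Rintegral_shift (obump 0 eps) (- x) mo (obump_ge0 _ _).
have E y : mollifier x y = mollifier_mass^-1 * obump 0 eps (y - x).
  by rewrite mollifierC mollifierE obump_scale [in RHS]obump_scale subr0.
have iO : lam.-integrable (setT : set B) (EFin \o (fun y => obump 0 eps (y - x))).
  have -> : (fun y => obump 0 eps (y - x)) = (fun y => mollifier_mass * mollifier x y).
    by apply/funext => y; rewrite E mulVKf ?gt_eqF ?mollifier_mass_gt0.
  exact: (integrableZl measurableT mollifier_mass (@integrable_mollifier x setT measurableT)).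
under eq_Rintegral do rewrite E.
rewrite RintegralZl//; rewrite H; apply: mulVf; rewrite gt_eqF//; exact: mollifier_mass_gt0.
Qed.

Lemma mollifier_integral_le1 (D : set V) x : measurable (D : set B) ->
  \int[lam]_(y in (D : set B)) mollifier x y <= 1.
Proof.
move=> mD; rewrite -(mollifier_integral x); apply: le_Rintegral_subset => //.
  by move=> y; exact: mollifier_ge0.
exact: integrable_mollifier.
Qed.

Lemma mollifier_integral_eq1 (D : set V) x : obox x (2 * eps) `<=` D ->
  \int[lam]_(y in (D : set B)) mollifier x y = 1.
Proof.
move=> xD; rewrite -(mollifier_integral x); apply/esym/Rintegral_support => // y _ Dy.
by apply: mollifier_eq0; apply: contra_not Dy; exact: xD.
Qed.

Lemma mollifier_integral_eq0 (D : set V) x :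
  obox x (2 * eps) `&` D `<=` set0 -> \int[lam]_(y in (D : set B)) mollifier x y = 0.
Proof.
move=> xD; rewrite (_ : \int[lam]_(y in _) _ = \int[lam]_(y in (D : set B)) 0).
  by rewrite /Rintegral integral0.
apply: eq_Rintegral => y /set_mem Dy; apply: mollifier_eq0 => xy; exact: (xD y).
Qed.
End mollifier.

(** * Sets of finite perimeter *)

Section perimeter_bound.
Context {R : realType} {n : nat}.
Notation V := 'rV[R]_n.+1.
Notation B := (@BorelRN R n.+1).
Notation lam := (@lebN R n.+1).

Lemma integrable_EFinZl d (T : measurableType d) (mu : {measure set T -> \bar R})
    (D : set T) (a : R) (F : T -> R) : measurable D ->
  mu.-integrable D (EFin \o F) -> mu.-integrable D (EFin \o (fun x => a * F x)).
Proof. by move=> mD iF; have := integrableZl mD a iF. Qed.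

Lemma Rintegral_sum d (T : measurableType d) (mu : {measure set T -> \bar R})
    (D : set T) (I : Type) (s : seq I) (F : I -> T -> R) : measurable D ->
  (forall i, mu.-integrable D (EFin \o F i)) ->
  \int[mu]_(x in D) (\sum_(i <- s) F i x) = \sum_(i <- s) \int[mu]_(x in D) F i x.
Proof.
move=> mD iF; rewrite /Rintegral; under eq_integral do rewrite -sumEFin.
rewrite integral_sum// -sum_fine// => i _.
exact: integrable_fin_num (iF i).
Qed.

Lemma continuous_scale (s : R) (w : V -> R) : continuous w -> continuous (fun x : V => s * w x).
Proof. by move=> cw x; apply: continuousM; [exact: cst_continuous|exact: cw]. Qed.

Lemma C1Z (s : R) (w : V -> R) : C1 w -> C1 (fun x : V => s * w x).
Proof.
move=> [cw dw]; split; first exact: continuous_scale.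
move=> v; have [dv cv] := dw v.
have dZ x : is_derive x v (fun y : V => s * w y) (s * 'D_v w x).
  by have := derivableP (dv x); exact: is_deriveZ.
split; first by move=> x; have [] := dZ x.
rewrite (_ : (fun x => 'D_v _ x) = (fun x => s * 'D_v w x)); first exact: continuous_scale.
by apply/funext => x; have [_ ->] := dZ x.
Qed.

Lemma smooth_mollifier (eps : R) (x : V) : smooth (mollifier eps x).
Proof.
have -> : mollifier eps x = (fun y : V => (@mollifier_mass R n eps)^-1 * obump x eps y).
  by apply/funext => y; rewrite mollifierC mollifierE.
by apply: smoothZ; exact: smooth_obump.
Qed.

(** The kernel depends on [x - y], so its derivative in [y] is minus its derivative in [x]. This
    sign lets derivatives in [x] be traded for a test of the weak divergence in [y]. *)
Lemma derive_mollifier (eps : R) (x y v : V) : 'D_v (mollifier eps x) y =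
  - ((@mollifier_mass R n eps)^-1 * (eps^-1 * 'D_v (obump 0 1) (eps^-1 *: (x - y)))).
Proof.
have sb := @smooth_obump R n.+1 0 1.
rewrite smooth_deriveZ; last first.
  have := @smooth_obump R n.+1 x eps; congr smooth; apply/funext => z.
  by rewrite obump_scale -obumpN -scalerN opprB.
rewrite -mulrN; congr (_ * _).
have -> : (fun z : V => obump 0 1 (eps^-1 *: (x - z))) = (fun z : V => obump 0 1 ((- eps^-1) *: (z - x))).
  by apply/funext => z; rewrite scaleNr -scalerN opprB.
rewrite derive_scale; last by move=> z; exact: smooth_derivable.
by rewrite scaleNr -scalerN opprB mulNr.
Qed.

Variables (K : set V) (G : V -> V) (f : V -> R) (M c : R).
Variables (mu1 mu2 : {measure set B -> \bar R}).
Hypotheses (cK : compact K) (mG : meas_field setT G).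
Hypotheses (GM : forall x i, `|G x ord0 i| <= M).
Hypotheses (mu1K : (mu1 (K : set B) < +oo)%E) (mu2K : (mu2 (K : set B) < +oo)%E).
Hypotheses (tf : test_fun setT f) (fc : forall x, `|f x| <= c).
(** The weak divergence tested on multiples of [f]: the factor [e] will be the kernel centred at a
    point, while [f] supplies the compact support. *)
Hypothesis div : forall e : V -> R, smooth e ->
  \int[lam]_(x in (K : set B)) dot_grad G (fun y => f y * e y) x =
  - (\int[mu1]_(x in (K : set B)) (f x * e x) - \int[mu2]_(x in (K : set B)) (f x * e x)).

Let mK : measurable (K : set B) := measurable_compact cK.
Let lamK : (lam (K : set B) < +oo)%E := compact_lebN cK.
Let M0 : 0 <= M. Proof. by rewrite (le_trans _ (GM 0 ord0)). Qed.
Let c0 : 0 <= c. Proof. by rewrite (le_trans _ (fc 0)). Qed.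

Let g (x : V) := dot_grad G f x.

Lemma dot_grad_bounded : exists2 A : R, 0 <= A & forall x, `|dot_grad G f x| <= A.
Proof.
have /choice[b bP] : forall i : 'I_n.+1, exists b : R, 0 <= b /\ forall x, `|'D_(ebasis i) f x| <= b.
  by move=> i; have [b b0 fb] := test_bounded (test_derive (ebasis i) tf); exists b.
exists (n.+1%:R * M * \sum_i b i).
  by rewrite !mulr_ge0// sumr_ge0// => i _; case: (bP i).
move=> x; apply: normr_dot_grad_le => // i; have [bi H] := bP i.
rewrite (le_trans (H x))// (bigD1 i)//= lerDl sumr_ge0// => j _; by case: (bP j).
Qed.

Lemma measurable_dot_grad (D : set B) : measurable D -> measurable_fun D (g : B -> R).
Proof.
by move=> mD; have /integrableP[/measurable_EFinP] := dot_grad_integrable mG GM mD tf.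
Qed.

Let h (i : 'I_n.+1) (y : V) := G y ord0 i * f y.
Let mh i (D : set B) : measurable D -> measurable_fun D (h i : B -> R).
Proof.
by move=> mD; apply: measurable_funM; [exact: measurable_funS (mG i)|exact: test_measurable tf].
Qed.
Let hM i y : `|h i y| <= M * c. Proof. by rewrite normrM ler_pM. Qed.

Variables (eps : R).
Hypothesis eps0 : 0 < eps.

Let Z := @mollifier_mass R n eps.

Definition mollified (x : V) : V :=
  \row_i (Z^-1 * convol lam (K : set B) (h i) (obump 0 1) eps^-1 x).

Let tb : test_fun setT (obump (0 : V) (1 : R)) := test_obump 0 ltr01.

Let mollified_coord i : (fun y => mollified y ord0 i) =
  (fun y => Z^-1 * convol lam (K : set B) (h i) (obump 0 1) eps^-1 y).
Proof. by apply/funext => y; rewrite mxE. Qed.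

Lemma is_derive_mollified x v i : is_derive x v (fun y => mollified y ord0 i)
  (Z^-1 * (eps^-1 * convol lam (K : set B) (h i) (fun y => 'D_v (obump 0 1) y) eps^-1 x)).
Proof.
rewrite mollified_coord.
have H : is_derive x v (convol lam (K : set B) (h i) (obump 0 1) eps^-1)
  (eps^-1 * convol lam (K : set B) (h i) (fun y => 'D_v (obump 0 1) y) eps^-1 x).
  exact: (convol_derive mK lamK (mh i mK) (fun y _ => hM i y)).
exact: is_deriveZ.
Qed.

Lemma continuous_convol_mul (nu : {measure set B -> \bar R}) (k : V -> R) (H a : R) (w : V -> R) :
  (nu (K : set B) < +oo)%E -> measurable_fun (K : set B) (k : B -> R) -> (forall y, `|k y| <= H) ->
  test_fun setT w -> continuous (fun x => a * convol nu (K : set B) k w eps^-1 x).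
Proof.
move=> nuK mk kH tg x.
have ck := convol_continuous mK nuK mk (fun y _ => kH y) (a := eps^-1) tg.
by apply: continuousM; [exact: cst_continuous|exact: ck].
Qed.

Lemma C1_mollified i : C1 (fun x => mollified x ord0 i).
Proof.
split.
  by rewrite mollified_coord; exact: continuous_convol_mul (mh i mK) (hM i) tb.
move=> v; split; first by move=> x; have [] := is_derive_mollified x v i.
rewrite (_ : (fun x => 'D_v _ x) = (fun x => (Z^-1 * eps^-1) * convol lam (K : set B) (h i) (fun y => 'D_v (obump 0 1) y) eps^-1 x)); last first.
  by apply/funext => x; have [_ ->] := is_derive_mollified x v i; rewrite mulrA.
exact: continuous_convol_mul (mh i mK) (hM i) (test_derive v tb).
Qed.

Lemma mollified_support : compact_support_in mollified setT.
Proof.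
have [r r0 Kr] := compact_obox cK.
(* A cutoff of radius [eps] reaches as far as [2 * eps]. *)
exists (cbox 0 (r + 2 * eps)); split; first exact: compact_cbox.
split => // x nx; apply/rowP => i; rewrite !mxE /convol.
rewrite (_ : \int[lam]_(y in _) _ = 0) ?mulr0//.
rewrite /Rintegral integral0_eq// => y Ky; congr EFin.
rewrite [obump _ _ _](_ : _ = obump y eps x); last by rewrite [RHS]obump_scale.
rewrite obump_eq0 ?mulr0// => xy; apply: nx => j.
have := xy j; have := Kr _ Ky j; rewrite !mxE !subr0 => yr xyr.
rewrite (_ : x ord0 j = y ord0 j + (x ord0 j - y ord0 j)); last by ring.
by rewrite (le_trans (ler_normD _ _))// lerD// ltW.
Qed.


Lemma convol_mollifier (nu : {measure set B -> \bar R}) (k : V -> R) (H : R) x : 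
  (nu (K : set B) < +oo)%E -> measurable_fun (K : set B) (k : B -> R) -> (forall y, `|k y| <= H) ->
  Z^-1 * convol nu (K : set B) k (obump 0 1) eps^-1 x =
  \int[nu]_(y in (K : set B)) (k y * mollifier eps x y).
Proof.
move=> nuK mk kH; rewrite -RintegralZl//.
  by apply: eq_Rintegral => y _; rewrite mulrCA.
exact: (convol_integrable mK nuK mk (fun y _ => kH y) _ _ tb).
Qed.

Lemma mollify_integrable (D : set V) (k : V -> R) (H : R) x : measurable (D : set B) ->
  measurable_fun (D : set B) (k : B -> R) -> (forall y, `|k y| <= H) ->
  lam.-integrable (D : set B) (EFin \o (fun y => k y * mollifier eps x y)).
Proof.
move=> mD mk kH.
have int := @integrable_mollifier R n eps eps0 x D mD.
have intH := integrableZl mD H int.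
have mf : measurable_fun (D : set B) (fun y : B => k y * mollifier eps x y).
  by apply: measurable_funM => //; apply/measurable_EFinP; case/integrableP : int.
apply: le_integrable intH => //; first exact/measurable_EFinP.
move=> y _; rewrite /= lee_fin !normrM ler_wpM2r//.
by rewrite (le_trans (kH y))// ler_norm.
Qed.

Lemma mollify_le (D : set V) (k : V -> R) (H : R) x : measurable (D : set B) ->
  measurable_fun (D : set B) (k : B -> R) -> (forall y, `|k y| <= H) ->
  `|\int[lam]_(y in (D : set B)) (k y * mollifier eps x y)| <=
  H * \int[lam]_(y in (D : set B)) mollifier eps x y.
Proof.
move=> mD mk kH.
have int := @integrable_mollifier R n eps eps0 x D mD.
have ikm := mollify_integrable x mD mk kH.
have intH := integrableZl mD H int.
rewrite (le_trans (le_normr_Rintegral _ ikm))// -RintegralZl//.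
apply: le_Rintegral => //; first exact: integrable_norm ikm.
by move=> y _; rewrite normrM [X in _ * X]ger0_norm ?mollifier_ge0// ler_wpM2r// mollifier_ge0.
Qed.

Hypothesis lam0 : lam (setT : set B) != 0%E.

Lemma mollified_le x : eucl (mollified x) <= n.+1%:R * (M * c).
Proof.
apply: eucl_le => [|i]; first exact: mulr_ge0.
rewrite mxE (convol_mollifier _ lamK (mh i mK) (hM i)).
rewrite (le_trans (mollify_le x mK (mh i mK) (hM i)))//.
by rewrite ler_piMr ?mulr_ge0//; exact: mollifier_integral_le1.
Qed.

(* [G] is only weakly differentiable: the derivative falls on the kernel, and
   [div] is applied to [f] times the kernel. *)
Lemma divergence_mollified x : divergence mollified x =
  \int[mu1]_(y in (K : set B)) (f y * mollifier eps x y) -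
  \int[mu2]_(y in (K : set B)) (f y * mollifier eps x y) +
  \int[lam]_(y in (K : set B)) (g y * mollifier eps x y).
Proof.
have [A A0 gA] := dot_grad_bounded.
have sm := @smooth_mollifier eps x.
pose F i y := - (f y * (G y ord0 i * 'D_(ebasis i) (mollifier eps x) y)).
have FE i y : F i y = Z^-1 * eps^-1 * (h i y * 'D_(ebasis i) (obump 0 1) (eps^-1 *: (x - y))).
  by rewrite /F derive_mollifier -/Z /h; ring.
have tbi i := test_derive (ebasis i) tb.
have iFi i := convol_integrable mK lamK (mh i mK) (fun y _ => hM i y) eps^-1 x (tbi i).
have iF i : lam.-integrable (K : set B) (EFin \o F i).
  have := integrableZl mK (Z^-1 * eps^-1) (iFi i); congr integrable.
  by apply/funext => y; rewrite /= FE EFinM.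
rewrite /divergence (eq_bigr (fun i => \int[lam]_(y in (K : set B)) F i y)); last first.
  move=> i _; have [_ ->] := is_derive_mollified x (ebasis i) i.
  by under eq_Rintegral do rewrite FE; rewrite RintegralZl ?mulrA.
rewrite -Rintegral_sum//.
have -> : (fun y => \sum_i F i y) = (fun y => g y * mollifier eps x y - dot_grad G (fun z => f z * mollifier eps x z) y).
  apply/funext => y; rewrite dot_gradM//; last by case: tf.
  rewrite /F sumrN -mulr_sumr -/(dot_grad G (mollifier eps x) y) -/(g y); ring.
rewrite RintegralB//; last 2 first.
- exact: mollify_integrable (measurable_dot_grad mK) gA.
- have tfm : test_fun setT (fun z => f z * mollifier eps x z) by exact: testMr.
  exact: (dot_grad_integrable mG GM mK tfm).
by rewrite div// opprK addrC.
Qed.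

Section mollify.
Variables (nu : {measure set B -> \bar R}) (k : V -> R) (H : R) (D : set V).
Hypotheses (nuD : (nu (D : set B) < +oo)%E) (mD : measurable (D : set B)).
Hypotheses (mk : measurable_fun setT (k : B -> R)) (kH : forall y, `|k y| <= H).

Let mkD : measurable_fun (D : set B) (k : B -> R). Proof. exact: measurable_funS mk. Qed.

Lemma continuous_mollify :
  continuous (fun x => \int[nu]_(y in (D : set B)) (k y * mollifier eps x y)).
Proof.
have -> : (fun x => \int[nu]_(y in (D : set B)) (k y * mollifier eps x y)) =
    (fun x => Z^-1 * convol nu (D : set B) k (obump 0 1) eps^-1 x).
  apply/funext => x; rewrite -RintegralZl//; last exact: (convol_integrable mD nuD mkD (fun y _ => kH y) _ _ tb).
  by apply: eq_Rintegral => y _; rewrite mulrCA.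
have ck := convol_continuous mD nuD mkD (fun y _ => kH y) (a := eps^-1) tb.
have H2 (a : R) : continuous (fun x : V => a * convol nu (D : set B) k (obump 0 1) eps^-1 x).
  by move=> x; apply: continuousM; [exact: cst_continuous|exact: ck].
exact: H2.
Qed.

Lemma mollify_kernel_le (x y : V) : `|k y * mollifier eps x y| <= H * Z^-1.
Proof. by rewrite normrM ler_pM// mollifier_norm_le. Qed.

Lemma mollify_integrable2 (E : set V) : measurable (E : set B) -> (lam (E : set B) < +oo)%E ->
  lam.-integrable (E : set B)
    (EFin \o (fun x => \int[nu]_(y in (D : set B)) (k y * mollifier eps x y))).
Proof.
move=> mE lamE; apply: (@bounded_by_integrable _ _ _ _ _ _ (`|H * Z^-1| * fine (nu (D : set B)))) => //.
  by apply: continuous_borelRN_measurable => //; exact: continuous_mollify.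
move=> x _.
have ik : nu.-integrable (D : set B) (EFin \o (fun y => k y * mollifier eps x y)).
  apply: (@bounded_by_integrable _ _ _ _ _ _ (H * Z^-1)) => //.
    apply: measurable_funM => //; apply: measurable_funTS.
    exact: measurableT_comp (@measurable_mollifier R n eps) (measurable_pair1 _).
  by move=> y _; exact: mollify_kernel_le.
rewrite (le_trans (le_normr_Rintegral _ ik))// -Rintegral_cst//.
apply: le_Rintegral => //; first exact: integrable_norm ik.
  by apply: (@bounded_by_integrable _ _ _ _ _ _ `|(`|H * Z^-1|)|).
by move=> y _; rewrite (le_trans (mollify_kernel_le x y))// ler_norm.
Qed.

(** Fubini and the symmetry of the kernel move the mollification from [k] to the indicator of
    [E]. *)
Lemma mollify_swap (E : set V) : measurable (E : set B) -> (lam (E : set B) < +oo)%E ->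
  \int[lam]_(x in (E : set B)) \int[nu]_(y in (D : set B)) (k y * mollifier eps x y) =
  \int[nu]_(y in (D : set B)) (k y * \int[lam]_(x in (E : set B)) mollifier eps y x).
Proof.
move=> mE lamE.
rewrite (@Rintegral_swap R _ _ B B lam nu E D (fun x y => k y * mollifier eps x y) (H * Z^-1))//.
- apply: eq_Rintegral => y _.
  have int := integrable_mollifier eps0 y mE.
  rewrite -[RHS](@RintegralZl _ B R lam E _ (k y) mE int).
  by apply: eq_Rintegral => x _; rewrite mollifierC.
- apply: measurable_funM; last exact: measurable_mollifier.
  exact: (measurableT_comp mk measurable_snd).
- by move=> x y _ _; exact: mollify_kernel_le.
Qed.

End mollify.

Definition mollified_indic (E : set V) (y : V) : R := \int[lam]_(x in (E : set B)) mollifier eps y x.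

Lemma mollified_indic_ge0 E y : 0 <= mollified_indic E y.
Proof. by apply: Rintegral_ge0 => x _; exact: mollifier_ge0. Qed.

Lemma mollified_indic_le1 (E : set V) y : measurable (E : set B) -> mollified_indic E y <= 1.
Proof. by move=> mE; exact: mollifier_integral_le1. Qed.

Lemma measurable_mollified_indic (D : set B) (E : set V) : measurable D ->
  measurable (E : set B) -> (lam (E : set B) < +oo)%E ->
  measurable_fun D (mollified_indic E : B -> R).
Proof.
move=> mD mE lamE; apply: continuous_borelRN_measurable => //.
have := @continuous_mollify lam (fun=> 1) 1 E lamE mE (measurable_cst _).
rewrite (_ : (fun x => _) = mollified_indic E).
  by apply => _; rewrite normr1.
by apply/funext => y; apply: eq_Rintegral => x _; rewrite mul1r.
Qed.

Lemma integrable_mollified_indic (nu : {measure set B -> \bar R}) (k : V -> R) (H : R)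
    (D E : set V) :
  measurable (D : set B) -> measurable (E : set B) -> (lam (E : set B) < +oo)%E ->
  (nu (D : set B) < +oo)%E -> measurable_fun setT (k : B -> R) -> (forall y, `|k y| <= H) ->
  nu.-integrable (D : set B) (EFin \o (fun y => k y * mollified_indic E y)).
Proof.
move=> mD mE lamE nuD mk kH; apply: (@bounded_by_integrable _ _ _ _ _ _ H) => //.
  by apply: measurable_funM; [exact: measurable_funS mk|exact: measurable_mollified_indic].
move=> y _; rewrite normrM (ger0_norm (mollified_indic_ge0 _ _)) -[leRHS]mulr1.
by rewrite ler_pM// ?mollified_indic_ge0// mollified_indic_le1.
Qed.

(** After the exchange the weight is a mollified indicator with values in [[0, 1]], so the bound
    depends neither on [eps] nor on [E]. *)
Lemma mollify_swap_le (nu : {measure set B -> \bar R}) (k : V -> R) (H : R) (D E : set V) :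
  measurable (D : set B) -> measurable (E : set B) -> (lam (E : set B) < +oo)%E ->
  (nu (D : set B) < +oo)%E -> measurable_fun setT (k : B -> R) -> (forall y, `|k y| <= H) ->
  `|\int[lam]_(x in (E : set B)) \int[nu]_(y in (D : set B)) (k y * mollifier eps x y)| <=
  H * fine (nu (D : set B)).
Proof.
move=> mD mE lamE nuD mk kH; rewrite (mollify_swap nuD mD mk kH)//.
have int := integrable_mollified_indic mD mE lamE nuD mk kH.
rewrite (le_trans (le_normr_Rintegral _ int))// -Rintegral_cst//.
apply: le_Rintegral => //; first exact: integrable_norm int.
  apply: (@bounded_by_integrable _ _ _ _ _ _ H) => // y _.
  by rewrite ger0_norm// (le_trans _ (kH 0)).
move=> y _; rewrite normrM (ger0_norm (mollified_indic_ge0 _ _)) -[leRHS]mulr1.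
by rewrite ler_pM// ?mollified_indic_ge0// mollified_indic_le1.
Qed.

Variable U : set V.
Hypotheses (oU : open U) (UK : U `<=` K) (perU : (perimeter U < +oo)%E).

Let mU : measurable (U : set B) := measurable_open oU.
Let lamU : (lam (U : set B) < +oo)%E.
Proof. exact: le_lt_trans (le_lebN UK) lamK. Qed.

(** The points of [U] whose kernel reaches the complement of [U]. *)
Definition collar : set V := U `&` \bigcup_(y in ~` U) obox y (2 * eps).

Lemma open_collar : open collar.
Proof.
apply: openI => //; apply: bigcup_open => y _.
by apply: open_obox; rewrite mulr_gt0.
Qed.

Let mC : measurable (collar : set B) := measurable_open open_collar.
Let lamC : (lam (collar : set B) < +oo)%E.
Proof. by apply: le_lt_trans lamU; apply: le_lebN => x []. Qed.

Lemma obox_sym (x y : V) r : obox x r y -> obox y r x.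
Proof. by move=> xy i; rewrite distrC. Qed.

Lemma mollified_indic_out x : U x -> ~ collar x -> mollified_indic U x = 1.
Proof.
move=> Ux nC; apply: (mollifier_integral_eq1 eps0 lam0) => y xy.
by apply: contrapT => nU; apply: nC; split => //; exists y => //; exact: obox_sym.
Qed.

Lemma mollified_indicD_out x : U x -> ~ collar x -> mollified_indic (K `\` U) x = 0.
Proof.
move=> Ux nC; apply: (mollifier_integral_eq0 eps0) => y [xy [_ nU]].
by apply: nC; split => //; exists y => //; exact: obox_sym.
Qed.

Lemma collar_integral_le (w : V -> R) : measurable_fun (U : set B) (w : B -> R) ->
  (forall x, U x -> 0 <= w x <= 1) -> (forall x, U x -> ~ collar x -> w x = 0) ->
  \int[lam]_(x in (U : set B)) w x <= fine (lam (collar : set B)).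
Proof.
move=> mw w01 w0; rewrite (@Rintegral_support _ _ _ lam (collar : set B))//; last by move=> x [].
rewrite -[leRHS]mul1r -Rintegral_cst//; apply: le_Rintegral => //.
- apply: (@bounded_by_integrable _ _ _ _ _ _ 1) => //.
    by apply: measurable_funS mw => // x [].
  by move=> x [/w01/andP[w1 w2] _]; rewrite ger0_norm.
- by apply: (@bounded_by_integrable _ _ _ _ _ _ 1) => // x _; rewrite normr1.
- by move=> x [/w01/andP[]].
Qed.

Let gm (D : set V) : measurable (D : set B) -> measurable_fun (D : set B) (g : B -> R).
Proof. by move=> mD; exact: measurable_dot_grad. Qed.

(* The mollified indicator is 1 on [U] off the collar, and its mass outside [U]
   comes from the collar by symmetry of the kernel. *)
Lemma mollify_error (A : R) : (forall x, `|g x| <= A) ->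
  `|\int[lam]_(y in (K : set B)) (g y * mollified_indic U y) - \int[lam]_(y in (U : set B)) g y| <=
  2 * A * fine (lam (collar : set B)).
Proof.
move=> gA; have A0 : 0 <= A by rewrite (le_trans _ (gA 0)).
have mKU : measurable (K `\` U : set B) by exact: measurableD.
have lamKU : (lam (K `\` U : set B) < +oo)%E.
  by apply: le_lt_trans lamK; apply: le_lebN => x [].
have igw D mD lamD := @integrable_mollified_indic lam g A D U mD mU lamU lamD (gm measurableT) gA.
have KE : K = U `|` (K `\` U) by rewrite setDUK.
have igwK := igw _ mK lamK; have igwU := igw _ mU lamU; have igwD := igw _ mKU lamKU.
have -> : \int[lam]_(y in (K : set B)) (g y * mollified_indic U y) =
   \int[lam]_(y in (U : set B)) (g y * mollified_indic U y) +
   \int[lam]_(y in (K `\` U : set B)) (g y * mollified_indic U y).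
  rewrite {1}KE Rintegral_setU//; first by rewrite -KE.
  by apply/disj_setPS => x [Ux []].
have igU : lam.-integrable (U : set B) (EFin \o g).
  by apply: (@bounded_by_integrable _ _ _ _ _ _ A) => //; exact: gm.
rewrite addrAC -RintegralB// (le_trans (ler_normD _ _))// -mulrA mulrC mulr2n mulrDr mulr1.
rewrite lerD//.
  have iB := integrableB mU igwU igU.
  rewrite (le_trans (le_normr_Rintegral _ iB))//.
  pose w x := 1 - mollified_indic U x.
  have w01 x : U x -> 0 <= w x <= 1.
    by move=> _; rewrite subr_ge0 mollified_indic_le1// lerBlDr lerDl mollified_indic_ge0.
  have mw : measurable_fun (U : set B) (w : B -> R).
    by apply: measurable_funB => //; exact: measurable_mollified_indic.
  have iw : lam.-integrable (U : set B) (EFin \o w).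
    apply: (@bounded_by_integrable _ _ _ _ _ _ 1) => // x /w01/andP[w1 w2].
    by rewrite ger0_norm.
  apply: (@le_trans _ _ (\int[lam]_(x in (U : set B)) (A * w x))).
    apply: le_Rintegral => //; first exact: integrable_norm iB.
      exact: integrable_EFinZl.
    move=> x Ux; have /andP[w1 w2] := w01 x Ux.
    rewrite (_ : _ - _ = - (g x * w x)); last by rewrite /w; ring.
    by rewrite normrN normrM (ger0_norm w1) ler_wpM2r.
  rewrite RintegralZl// ler_wpM2l//; apply: collar_integral_le => //.
  by move=> x Ux nC; rewrite /w mollified_indic_out// subrr.
rewrite (le_trans (le_normr_Rintegral _ igwD))//.
have i1 := @integrable_mollified_indic lam (fun=> 1) 1 (K `\` U) U mKU mU lamU lamKU (measurable_cst _).
have {}i1 : lam.-integrable (K `\` U : set B) (EFin \o (fun y => 1 * mollified_indic U y)).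
  by apply: i1 => _; rewrite normr1.
apply: (@le_trans _ _ (\int[lam]_(x in (K `\` U : set B)) (A * (1 * mollified_indic U x)))).
  apply: le_Rintegral => //; first exact: integrable_norm igwD.
    exact: integrable_EFinZl.
  move=> x _; rewrite mul1r normrM (ger0_norm (mollified_indic_ge0 _ _)).
  by rewrite ler_wpM2r// mollified_indic_ge0.
rewrite RintegralZl// ler_wpM2l//.
have := @mollify_swap lam (fun=> 1) 1 _ lamKU mKU (measurable_cst _) _ U mU lamU.
move=> <-; last by move=> _; rewrite normr1.
have -> : (fun x => \int[lam]_(y in (K `\` U : set B)) (1 * mollifier eps x y)) = mollified_indic (K `\` U).
  by apply/funext => x; apply: eq_Rintegral => y _; rewrite mul1r.
apply: collar_integral_le.
- exact: measurable_mollified_indic.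
- by move=> x _; rewrite mollified_indic_ge0 mollified_indic_le1.
- exact: mollified_indicD_out.
Qed.

Let mf (D : set B) : measurable D -> measurable_fun D (f : B -> R).
Proof. by move=> mD; exact: test_measurable tf. Qed.

Lemma integrable_divergence : lam.-integrable (U : set B) (EFin \o divergence mollified).
Proof.
have [A A0 gA] := dot_grad_bounded.
have i1 := mollify_integrable2 mu1K mK (mf measurableT) fc mU lamU.
have i2 := mollify_integrable2 mu2K mK (mf measurableT) fc mU lamU.
have i3 := mollify_integrable2 lamK mK (gm measurableT) gA mU lamU.
have := integrableD mU (integrableB mU i1 i2) i3; congr integrable.
by apply/funext => x /=; rewrite divergence_mollified -EFinB -EFinD.
Qed.

(** The gradient term is rewritten with the mollified indicator, ready for comparison with its
    limit; the two measure terms remain double integrals, as they will only be bounded. *)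
Lemma integral_divergence : \int[lam]_(x in (U : set B)) divergence mollified x =
  \int[lam]_(x in (U : set B)) \int[mu1]_(y in (K : set B)) (f y * mollifier eps x y) -
  \int[lam]_(x in (U : set B)) \int[mu2]_(y in (K : set B)) (f y * mollifier eps x y) +
  \int[lam]_(y in (K : set B)) (g y * mollified_indic U y).
Proof.
have [A A0 gA] := dot_grad_bounded.
have i1 := mollify_integrable2 mu1K mK (mf measurableT) fc mU lamU.
have i2 := mollify_integrable2 mu2K mK (mf measurableT) fc mU lamU.
have i3 := mollify_integrable2 lamK mK (gm measurableT) gA mU lamU.
rewrite -(mollify_swap lamK mK (gm measurableT) gA mU lamU).
have iB : lam.-integrable (U : set B) (EFin \o (fun x =>
    \int[mu1]_(y in (K : set B)) (f y * mollifier eps x y) -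
    \int[mu2]_(y in (K : set B)) (f y * mollifier eps x y))).
  by have := integrableB mU i1 i2.
rewrite -RintegralB// -RintegralD//.
by apply: eq_Rintegral => x _; rewrite divergence_mollified.
Qed.

Lemma euclZ (s : R) (x : V) : eucl (s *: x) = `|s| * eucl x.
Proof.
rewrite /eucl; under eq_bigr do rewrite mxE exprMn.
by rewrite -mulr_sumr sqrtrM ?sqr_ge0// sqrtr_sqr.
Qed.

(** The field multiplied by [L^-1] and by [- L^-1] is a competitor in the perimeter, which bounds
    both signs of the integral. *)
Lemma divergence_perimeter : 0 < c ->
  `|\int[lam]_(x in (U : set B)) divergence mollified x| <=
  fine (perimeter U) * (n.+1%:R * ((M + 1) * c)).
Proof.
(* [M + 1] instead of [M] keeps [L] positive when [M = 0]. *)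
move=> cp; set L := n.+1%:R * ((M + 1) * c).
have L0 : 0 < L by rewrite !mulr_gt0// ltr_wpDl.
have per (s : R) : `|s| * L <= 1 ->
    ((s * \int[lam]_(x in (U : set B)) divergence mollified x)%:E <= perimeter U)%E.
  move=> sL; have coordE i : (fun y => (s *: mollified y) ord0 i) = (fun y => s * mollified y ord0 i).
    by apply/funext => y; rewrite mxE.
  have dZ x v i : is_derive x v (fun y => (s *: mollified y) ord0 i) (s * 'D_v (fun y => mollified y ord0 i) x).
    rewrite coordE; have [_ dm] := C1_mollified i; have [dm1 _] := dm v.
    have := derivableP (dm1 x); exact: is_deriveZ.
  apply: ereal_sup_ubound; exists (fun x => s *: mollified x).
    split; first split.
    - by move=> i; rewrite coordE; apply: C1Z; exact: C1_mollified.
    - have [K' [cK' [KT m0]]] := mollified_support; exists K'; split => //; split => // x nK.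
      by rewrite m0// scaler0.
    - move=> x; rewrite euclZ (le_trans _ sL)// ler_wpM2l// (le_trans (mollified_le x))//.
      by rewrite ler_wpM2l// ler_wpM2r// lerDl.
  have divE x : divergence (fun y => s *: mollified y) x = s * divergence mollified x.
    by rewrite /divergence mulr_sumr; apply: eq_bigr => i _; have [_ ->] := dZ x (ebasis i) i.
  have int := integrable_divergence; rewrite -RintegralZl// /Rintegral fineK.
    by apply: eq_integral => x _; rewrite divE.
  exact: integrable_fin_num (integrable_EFinZl s mU int).
have P0 : (0 <= perimeter U)%E by have := per 0; rewrite normr0 !mul0r; apply; exact: ler01.
have Pfin : perimeter U \is a fin_num by rewrite ge0_fin_numE.
have perR s : `|s| * L <= 1 -> s * \int[lam]_(x in (U : set B)) divergence mollified x <= fine (perimeter U).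
  by move=> sL; rewrite -lee_fin fineK//; exact: per.
have Li : `|L^-1| * L <= 1 by rewrite ger0_norm ?invr_ge0 ?(ltW L0)// mulVf ?gt_eqF.
rewrite ler_norml; apply/andP; split.
  have := perR (- L^-1); rewrite normrN => /(_ Li); rewrite mulNr lerNl.
  by rewrite ler_pdivlMl// mulrC mulNr mulrC.
by have := perR _ Li; rewrite ler_pdivrMl// mulrC.
Qed.

Lemma perimeter_bound_eps (A : R) : 0 < c -> (forall x, `|g x| <= A) ->
  `|\int[lam]_(x in (U : set B)) g x| <=
  (fine (perimeter U) * (n.+1%:R * (M + 1)) + fine (mu1 (K : set B)) + fine (mu2 (K : set B))) * c +
  2 * A * fine (lam (collar : set B)).
Proof.
move=> cp gA.
have b1 := mollify_swap_le mK mU lamU mu1K (mf measurableT) fc.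
have b2 := mollify_swap_le mK mU lamU mu2K (mf measurableT) fc.
have b3 := mollify_error gA; have b4 := divergence_perimeter cp.
have E := integral_divergence.
set I1 := (X in `|X| <= _) in b1; set I2 := (X in `|X| <= _) in b2.
set I := \int[lam]_(x in (U : set B)) g x in b3 *.
set J := \int[lam]_(y in (K : set B)) _ in b3 E.
rewrite E -/I1 -/I2 in b4.
(* [I1 - I2 + J] is the integral of the divergence, bounded by the perimeter; [I1] and [I2] are
   bounded by [c] times the masses of [K], and [J - I] by the collar. *)
rewrite (_ : I = (I1 - I2 + J) - I1 + I2 - (J - I)); last by ring.
rewrite (le_trans (ler_normB _ _))// lerD//.
rewrite (le_trans (ler_normD _ _))// !mulrDl lerD//; last by rewrite mulrC.
rewrite (le_trans (ler_normB _ _))// lerD//; last by rewrite mulrC.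
by rewrite -!mulrA; rewrite !mulrA in b4 *.
Qed.
End perimeter_bound.

Section finite_perimeter_extension.
Context {R : realType} {n : nat}.
Notation V := 'rV[R]_n.+1.
Notation B := (@BorelRN R n.+1).
Notation lam := (@lebN R n.+1).

(** Continuity from above: the collars decrease to the empty set, since every point of [U] has a box
    inside [U]. *)
Lemma collar_cvg0 (U : set V) (e : R) : open U -> (lam (U : set B) < +oo)%E -> 0 < e ->
  exists2 eps : R, 0 < eps & fine (lam (collar eps U : set B)) <= e.
Proof.
move=> oU lamU e0; pose F k : set V := collar k.+1%:R^-1 U.
have e_gt0 k : 0 < k.+1%:R^-1 :> R by rewrite invr_gt0.
have mF k : measurable (F k : set B) by apply: measurable_open; exact: open_collar.
have F0 : \bigcap_k F k = set0.
  rewrite predeqE => x; split => // Fx; have [Ux _] := Fx 0%N I.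
  have /nbhs_obox[r r0 xr] : nbhs x U by exact: open_nbhs_nbhs.
  have [k] := @ltr_add_invr R 0 (r / 2) ltac:(by rewrite divr_gt0).
  rewrite add0r => kr; have [_ [y nUy yx]] := Fx k I.
  apply: nUy; apply: xr; apply: obox_sym; apply: sub_obox yx.
  by rewrite mulrC -ler_pdivlMr// ltW.
have Fdec : nonincreasing_seq F.
  move=> i j ij; apply/subsetPset => x [Ux [y nUy yx]]; split => //; exists y => //.
  by apply: sub_obox yx; rewrite ler_wpM2l// lef_pV2 ?posrE// ler_nat.
have lamF0 : (lam (F 0%N : set B) < +oo)%E.
  by apply: le_lt_trans lamU; apply: le_lebN => x [].
have := @nonincreasing_cvg_mu _ B R lam F lamF0 mF _ Fdec.
rewrite F0 measure0 => /(_ measurable0) /fine_cvgP[_ /cvgrPdist_le /(_ e e0)][k _ Hk].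
exists k.+1%:R^-1 => //; have := Hk k (leqnn k).
by rewrite sub0r normrN /=; apply: le_trans; exact: ler_norm.
Qed.

Lemma perimeter_ge0 (U : set V) : (0 <= perimeter U)%E.
Proof.
have d0 (v : V) : (fun x => 'D_v (fun _ : V => 0 : R) x) = (fun=> 0).
  by apply/funext => x; exact: derive_cst.
apply: ereal_sup_ubound; exists (fun=> 0).
  split; last first.
    by move=> x; rewrite -(scale0r (0 : V)) euclZ normr0 mul0r ler01.
  split; last by exists set0; split; [exact: compact0|split].
  move=> i; rewrite (_ : (fun=> _) = (fun=> 0)); last by apply/funext => x; rewrite mxE.
  split; first by move=> x; exact: cst_continuous.
  move=> v; split; first by move=> x; exact: derivable_cst.
  by rewrite d0 => x; exact: cst_continuous.
apply: integral0_eq => x _; congr EFin; apply: big1 => i _.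
rewrite (_ : (fun=> _) = (fun=> 0)); last by apply/funext => y; rewrite mxE.
exact: derive_cst.
Qed.

(** The limit of [perimeter_bound_eps] as [eps] tends to 0. The collar term carries the bound [A] on
    [G . grad f], which therefore leaves no trace in the constant. *)
Lemma perimeter_bound (K U : set V) (G : V -> V) (f : V -> R) (M c : R)
    (mu1 mu2 : {measure set B -> \bar R}) :
  compact K -> meas_field setT G -> (forall x i, `|G x ord0 i| <= M) ->
  (mu1 (K : set B) < +oo)%E -> (mu2 (K : set B) < +oo)%E ->
  test_fun setT f -> (forall x, `|f x| <= c) ->
  (forall e : V -> R, smooth e ->
    \int[lam]_(x in (K : set B)) dot_grad G (fun y => f y * e y) x =
    - (\int[mu1]_(x in (K : set B)) (f x * e x) - \int[mu2]_(x in (K : set B)) (f x * e x))) ->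
  open U -> U `<=` K -> finite_perimeter U ->
  `|\int[lam]_(x in (U : set B)) dot_grad G f x| <=
  (fine (perimeter U) * (n.+1%:R * (M + 1)) + fine (mu1 (K : set B)) + fine (mu2 (K : set B))) * c.
Proof.
move=> cK mG GM mu1K mu2K tf fc div oU UK perU.
set Q := (X in _ <= X * c).
have c0 : 0 <= c by rewrite (le_trans _ (fc 0)).
have M0 : 0 <= M by rewrite (le_trans _ (GM 0 ord0)).
have P0 := perimeter_ge0 U.
have Q0 : 0 <= Q by rewrite !addr_ge0 ?fine_ge0// mulr_ge0 ?fine_ge0// mulr_ge0// addr_ge0.
have lamU : (lam (U : set B) < +oo)%E by exact: le_lt_trans (le_lebN UK) (compact_lebN cK).
(* The kernel is normalized under the assumption that [lebN] is not identically zero; in the other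
   case the left-hand side is 0. *)
have [lam0|lam0] := eqVneq (lam (setT : set B)) 0%E.
  have lU0 : lam (U : set B) = 0%E.
    by apply/eqP; rewrite eq_le measure_ge0 andbT -lam0 le_lebN.
  have mU := measurable_open oU.
  rewrite /Rintegral null_set_integral ?normr0 ?mulr_ge0//.
  by apply/measurable_EFinP; exact: measurable_dot_grad mG GM tf _ mU.
have [A A0 gA] := dot_grad_bounded GM tf.
apply/ler_addgt0Pr => e e0.
(* [c] may be 0 and is replaced by [c + a]; [a] and [d] keep [Q * a] and [2 * A * d] each below
   [e / 2]. *)
pose a := e / 2 / (Q + 1); pose d := e / 2 / (2 * A + 1).
have a0 : 0 < a by rewrite !divr_gt0// ltr_wpDl.
have A1 : 0 < 2 * A + 1 by rewrite ltr_wpDl// mulr_ge0.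
have d0 : 0 < d by rewrite !divr_gt0.
have [eps eps0 Heps] := collar_cvg0 oU lamU d0.
have ca : 0 < c + a by rewrite ltr_wpDl.
have fca x : `|f x| <= c + a by rewrite (le_trans (fc x))// lerDl ltW.
rewrite (le_trans (perimeter_bound_eps cK mG GM mu1K mu2K tf fca div eps0 lam0 oU UK perU ca gA))//.
rewrite -/Q mulrDr -addrA lerD2l [leRHS]splitr lerD//.
  by rewrite /a mulrCA ler_piMr ?(ltW (divr_gt0 e0 _))// ler_pdivrMr ?mul1r ?lerDl// ltr_wpDl.
apply: (@le_trans _ _ (2 * A * d)); first by rewrite ler_wpM2l// mulr_ge0.
by rewrite /d mulrCA ler_piMr ?(ltW (divr_gt0 e0 _))// ler_pdivrMr ?mul1r ?lerDl.
Qed.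

(** The divergence identity is known for test functions on [Omega] only. Hence [f] is multiplied by
    a cutoff [chi] that is 1 near the closure of [U] and supported in a compact [K] inside [Omega];
    on [U] the gradients of [f] and [f * chi] agree, and on [K] the field is bounded and the
    measures are finite. *)
Theorem extension_finite_perimeter (Omega : set V) (F : V -> V) : open Omega ->
  DM_infty_loc Omega F -> forall U : set V, open U -> finite_perimeter U ->
  compactly_contained U Omega -> extension_domain U F.
Proof.
move=> oO [mF [bF [mu1 [mu2 [fin HF]]]]] U oU perU [cU UO].
have [chi [[schi [K [cK [KO chi0]]]] chi01 [W [oW UW chi1]]]] := exists_cutoff cU oO UO.
have tchi : test_fun Omega chi by split => //; exists K.
have UclU : U `<=` closure U by exact: subset_closure.
have UK : U `<=` K.
  move=> x /UclU /UW /chi1 x1; apply: contrapT => /chi0; rewrite x1.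
  by apply/eqP; exact: oner_neq0.
have mU := measurable_open oU; have mO := measurable_open oO; have mK := measurable_compact cK.
have mFK : meas_field K F by move=> i; apply: measurable_funS (mF i).
have [M FM] := bF K cK KO; have [mu1K mu2K] := fin K cK KO.
pose G := truncate K F M.
have mG : meas_field setT G by exact: meas_truncate.
have GM x i : `|G x ord0 i| <= `|M| by exact: truncate_le.
have GK x f : ~ K x -> dot_grad G f x = 0.
  by move=> nK; apply: big1 => i _; rewrite /G truncate_out// mxE mul0r.
pose Fs x := if x \in (U : set B) then G x else 0.
have mFs : meas_field setT Fs.
  by apply: meas_field_mkcond => // i; apply: measurable_funS (mG i).
have FsM x i : `|Fs x ord0 i| <= `|M|.
  by rewrite /Fs; case: ifP => // _; rewrite mxE normr0.
have FsE x : U x -> Fs x = G x by move=> Ux; rewrite /Fs mem_set.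
exists Fs; split; last first.
  apply/eqP; rewrite eq_le measure_ge0 andbT -(truncate_neq FM).
  by apply: le_lebN => x [Ux]; rewrite FsE// => nF; split => //; exact: UK.
have P0 := perimeter_ge0 U.
set C := fine (perimeter U) * (n.+1%:R * (`|M| + 1)) + fine (mu1 (K : set B)) + fine (mu2 (K : set B)).
have C0 : 0 <= C by rewrite !addr_ge0 ?fine_ge0// mulr_ge0 ?fine_ge0// mulr_ge0// addr_ge0.
have H1 := DM_infty_of_bounded mFs FsM C0; apply: H1 => f c tf fc.
have sf := test_smooth tf.
pose f' x := f x * chi x.
have tf' : test_fun Omega f' by exact: testMl.
have f'K x : ~ K x -> f' x = 0 by move=> /chi0 x0; rewrite /f' x0 mulr0.
have f'c x : `|f' x| <= c.
  have /andP[h0 h1] := chi01 x.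
  by rewrite normrM (ger0_norm h0) (le_trans _ (fc x))// ler_piMr.
have -> : \int[lam]_x dot_grad Fs f x = \int[lam]_(x in (U : set B)) dot_grad G f' x.
  have Fs0 x : ~ U x -> dot_grad Fs f x = 0.
    by move=> nU; apply: big1 => i _; rewrite /Fs memNset// mxE mul0r.
  apply: (etrans (Rintegral_support lam (@subsetT _ (U : set B)) (fun x _ => Fs0 x))).
  apply: eq_Rintegral => x /set_mem Ux.
  rewrite (@eq_dot_grad_near _ _ G f' f).
    by apply: eq_bigr => i _; rewrite FsE.
  have : nbhs x W by apply: open_nbhs_nbhs; split => //; exact/UW/UclU.
  by apply: filterS => y /chi1 y1; rewrite /f' y1 mulr1.
have tf'T : test_fun setT f' by exact: test_sub tf'.
apply: (perimeter_bound cK mG GM mu1K mu2K tf'T f'c _ oU UK perU) => e se.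
(* [f' * e] is a test function on [Omega], so the divergence identity applies to it; its support
   lies in [K], which reduces all three integrals to [K]. *)
pose psi x := f' x * e x.
have psiK x : ~ K x -> psi x = 0 by move=> nK; rewrite /psi f'K// mul0r.
have tpsi : test_fun Omega psi by exact: testMr.
have psi_int (nu : {measure set B -> \bar R}) : (nu (K : set B) < +oo)%E ->
    (\int[nu]_(x in (Omega : set B)) (psi x)%:E)%E = (\int[nu]_(x in (K : set B)) psi x)%:E.
  move=> nuK; rewrite (@integral_support _ _ B nu (K : set B))//; last by move=> x _ /psiK ->.
  rewrite /Rintegral fineK//; apply: integrable_fin_num => //.
  exact: test_integrable_fin tpsi.
have := HF _ tpsi; rewrite !psi_int//.
rewrite (truncate_dot_grad mK mFK FM mO KO mF tpsi)//; last first.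
  move=> x _ nK; apply: big1 => i _.
  by rewrite (@derive_support _ _ _ K) ?mulr0//; exact: compact_closed.
rewrite (@integral_support _ _ B lam (K : set B))//; last by move=> x _ nK; rewrite GK.
by rewrite -EFinB -EFinN /Rintegral => ->.
Qed.
End finite_perimeter_extension.

Theorem theorem8p4 (R : realType) (N : nat) (hN : (0 < N)%N) :
  (forall (U : set 'rV[R]_N) (F : 'rV[R]_N -> 'rV[R]_N),
     open U -> (hausdorff (N - 1) (boundary U) < +oo)%E ->
     DM_infty U F -> extension_domain U F) /\
  (forall (Omega : set 'rV[R]_N) (F : 'rV[R]_N -> 'rV[R]_N),
     open Omega -> DM_infty_loc Omega F ->
     forall U : set 'rV[R]_N, open U -> finite_perimeter U ->
       compactly_contained U Omega -> extension_domain U F).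
Proof.
case: N hN => // n _; rewrite subn1; split => [U F|Omega F oO DF U].
  exact: extension_finite_hausdorff.
exact: extension_finite_perimeter DF U.
Qed.
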